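(* Assume (H1)–(H4). Let $u\in C(\mathbb{R}^n\times[0,T))$ be a viscosity solution of (1.1)–(1.2). Then: (i) if $(C_1,K_3)\ne(0,0)$, for all $(x,t)\in\mathbb{R}^n\times(0,T)$ and $p\in D_x^-u(x,t)$, $$\underline{I}(x,t;u_0)e^{-(C_1+K_3)t}-\frac{C_1\beta}{C_1+K_3}\big(1-e^{-(C_1+K_3)t}\big)\le|p|\le\overline{S}(x,t;u_0)e^{(C_1+K_3)t}+\frac{C_1\beta}{C_1+K_3}\big(e^{(C_1+K_3)t}-1\big);$$ (ii) if $(C_1,K_3)=(0,0)$, then $\underline{I}(x,t;u_0)\le|p|\le\overline{S}(x,t;u_0)$ for all $(x,t)\in\mathbb{R}^n\times(0,T)$ and $p\in D_x^-u(x,t)$.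
   Context: Let $T>0$, $n\ge1$. $H:\mathbb{R}^n\times[0,T]\times\mathbb{R}\times\mathbb{R}^n\to\mathbb{R}$ continuous, $u_0$ Lipschitz. Problem (1.1)–(1.2): $u_t+H(x,t,u,D_xu)=0$ in $\mathbb{R}^n\times(0,T)$, $u(x,0)=u_0(x)$. (H1) there exist $C_1\ge0$, $\beta\in\{0,1\}$ with $|H(x,t,u,p)-H(y,t,u,p)|\le C_1(\beta+|p|)|x-y|$. (H2) there exist $A_2,B_2\ge0$ with $|H(x,t,u,p)-H(x,t,u,q)|\le(A_2|x|+B_2)|p-q|$. (H3) there exists $K_3\ge0$ with $|H(x,t,u,p)-H(x,t,v,p)|\le K_3|u-v|$. (H4) $p\mapsto H(x,t,u,p)$ convex. (All for all arguments.) Viscosity solution: $u\in C(\mathbb{R}^n\times[0,T))$, $u(\cdot,0)=u_0$, and for every $\phi\in C^1(\mathbb{R}^n\times(0,T))$, if $u-\phi$ has a local max (resp. min) at $(x,t)\in\mathbb{R}^n\times(0,T)$ then $\phi_t+H(x,t,u(x,t),D_x\phi(x,t))\le0$ (resp. $\ge0$). $D^-f(x)=\{D\phi(x):\phi\in C^1,\ f-\phi$ has a local min at $x\}$; $D_x^-u(x,t)=\{p:(p,\tau)\in D^-u(x,t)\}$. $R(x,t)=(\frac{B_2}{A_2}+|x|)(e^{A_2t}-1)$ if $A_2>0$, $=B_2t$ if $A_2=0$. $\overline{S}(x,t;u_0)=\lim_{\delta\to0^+}\sup\{|p|:p\in D^-u_0(y),\ y\in\overline{B_{R(x,t)+\delta}(x)}\}$,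 $\underline{I}(x,t;u_0)=\lim_{\delta\to0^+}\inf\{|p|:p\in D^-u_0(y),\ y\in\overline{B_{R(x,t)+\delta}(x)}\}$. *)

(* Defs.v *)
From HB Require Import structures.
From mathcomp Require Import all_boot all_order all_algebra.
From mathcomp Require Import all_classical all_reals all_analysis.
Set Implicit Arguments. Unset Strict Implicit. Unset Printing Implicit Defensive.
Import Order.TTheory GRing.Theory Num.Theory.
Local Open Scope ring_scope.
Local Open Scope classical_set_scope.

Section Defs.
Variables (R : realType) (n : nat).
Local Notation vec := 'rV[R]_n.

Definition dotv (x y : vec) : R := \sum_(i < n) x ord0 i * y ord0 i.
Definition enorm (x : vec) : R := Num.sqrt (dotv x x).

Definition isC1_space (phi : vec -> R) (Dphi : vec -> vec) : Prop :=
  (forall x, forall e, 0 < e -> exists2 d, 0 < d & forall y, enorm (y - x) < d ->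
      `|phi y - phi x - dotv (Dphi x) (y - x)| <= e * enorm (y - x)) /\
  (forall x, forall e, 0 < e -> exists2 d, 0 < d & forall y, enorm (y - x) < d ->
      enorm (Dphi y - Dphi x) < e).

Definition isC1_st (T : R) (phi : vec -> R -> R) (Dx : vec -> R -> vec)
    (Dt : vec -> R -> R) : Prop :=
  (forall x t, 0 < t < T -> forall e, 0 < e -> exists2 d, 0 < d &
     forall y s, 0 < s < T -> enorm (y - x) < d -> `|s - t| < d ->
       `|phi y s - phi x t - dotv (Dx x t) (y - x) - Dt x t * (s - t)|
         <= e * (enorm (y - x) + `|s - t|)) /\
  (forall x t, 0 < t < T -> forall e, 0 < e -> exists2 d, 0 < d &
     forall y s, 0 < s < T -> enorm (y - x) < d -> `|s - t| < d ->
       enorm (Dx y s - Dx x t) < e /\ `|Dt y s - Dt x t| < e).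

Definition loc_max_st (T : R) (f : vec -> R -> R) (x : vec) (t : R) : Prop :=
  exists2 r, 0 < r & forall y s, 0 < s < T -> enorm (y - x) < r -> `|s - t| < r ->
    f y s <= f x t.
Definition loc_min_st (T : R) (f : vec -> R -> R) (x : vec) (t : R) : Prop :=
  exists2 r, 0 < r & forall y s, 0 < s < T -> enorm (y - x) < r -> `|s - t| < r ->
    f x t <= f y s.
Definition loc_min_space (f : vec -> R) (x : vec) : Prop :=
  exists2 r, 0 < r & forall y, enorm (y - x) < r -> f x <= f y.

Definition cont_st (T : R) (u : vec -> R -> R) : Prop :=
  forall x t, 0 <= t < T -> forall e, 0 < e -> exists2 d, 0 < d &
    forall y s, 0 <= s < T -> enorm (y - x) < d -> `|s - t| < d ->
      `|u y s - u x t| < e.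

Definition cont_H (T : R) (H : vec -> R -> R -> vec -> R) : Prop :=
  forall x t r p, 0 <= t <= T -> forall e, 0 < e -> exists2 d, 0 < d &
    forall y s q w, 0 <= s <= T -> enorm (y - x) < d -> `|s - t| < d ->
      `|q - r| < d -> enorm (w - p) < d ->
      `|H y s q w - H x t r p| < e.

Definition lipschitz_vec (f : vec -> R) : Prop :=
  exists L : R, forall x y, `|f x - f y| <= L * enorm (x - y).

Definition viscosity_solution (T : R) (H : vec -> R -> R -> vec -> R)
    (u0 : vec -> R) (u : vec -> R -> R) : Prop :=
  cont_st T u /\ (forall x, u x 0 = u0 x) /\
  forall phi Dx Dt, isC1_st T phi Dx Dt -> forall x t, 0 < t < T ->
    (loc_max_st T (fun y s => u y s - phi y s) x t ->
        Dt x t + H x t (u x t) (Dx x t) <= 0) /\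
    (loc_min_st T (fun y s => u y s - phi y s) x t ->
        Dt x t + H x t (u x t) (Dx x t) >= 0).

Definition subdiff (f : vec -> R) (x : vec) (p : vec) : Prop :=
  exists Dphi phi, isC1_space phi Dphi /\
    loc_min_space (fun y => f y - phi y) x /\ Dphi x = p.

(* D_x^- u(x,t) = { p : (p,tau) in D^- u(x,t) } *)
Definition subdiff_x (T : R) (u : vec -> R -> R) (x : vec) (t : R) (p : vec) : Prop :=
  exists Dt Dx phi, isC1_st T phi Dx Dt /\
    loc_min_st T (fun y s => u y s - phi y s) x t /\ Dx x t = p.

Definition Rfun (A2 B2 : R) (x : vec) (t : R) : R :=
  if 0 < A2 then (B2 / A2 + enorm x) * (expR (A2 * t) - 1) else B2 * t.

Definition grad_norms (A2 B2 : R) (u0 : vec -> R) (x : vec) (t d : R) : set R :=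
  [set r | exists y p, enorm (y - x) <= Rfun A2 B2 x t + d /\ subdiff u0 y p /\
                       r = enorm p].

Definition Sbar (A2 B2 : R) (u0 : vec -> R) (x : vec) (t : R) : R :=
  lim ((fun d : R => (sup (grad_norms A2 B2 u0 x t d) : R^o)) @ 0^'+).
Definition Ibar (A2 B2 : R) (u0 : vec -> R) (x : vec) (t : R) : R :=
  lim ((fun d : R => (inf (grad_norms A2 B2 u0 x t d) : R^o)) @ 0^'+).

End Defs.

(* Main.v *)
Require Import Defs.
From HB Require Import structures.
From mathcomp Require Import all_boot all_order all_algebra.
From mathcomp Require Import all_classical all_reals all_analysis.
From mathcomp Require Import ring lra.
Import Order.TTheory GRing.Theory Num.Theory.
Import numFieldTopology.Exports numFieldNormedType.Exports.
Local Open Scope ring_scope.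
Local Open Scope classical_set_scope.

(** Two estimates on the initial datum are propagated along the equation inside
    the backward cone of dependence.

    If all subgradients of [u0] in the base of the cone have norm at most [M],
    then [u0] is [M]-Lipschitz there, and doubling the variables shows that
    [u(., t)] is [L t]-Lipschitz with [L' = (C1 + K3) L + C1 beta], [L 0 = M];
    this gives the upper bound.

    If they all have norm at least [m], then every point [x] of the base has a
    point [y] at distance at most [r0] with [u0 y <= u0 x - m r0].  Put
    [r t = r0 exp(C1 t)] and let [w x t] be the infimum of [u(., t)] over the ball
    of centre [x] and radius [r t].  For convex Hamiltonians the subgradients of
    the continuous solution [u] satisfy [tau + H <= 0] (Barron-Jensen), an
    inequality that infima over balls inherit, up to the error [C1 beta r]; hence
    [w + psi] is a subsolution when [psi' = - K3 psi - C1 beta r].  Comparison gives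
    [w + psi <= u] at the apex [(x0, t0)], so that
    [psi t0 <= (|p| + o(1)) r t0] as [r0 -> 0] for every spatial subgradient [p] of
    [u] there; this is the lower bound. *)

(** The radius [Rfun] appears because the cone solves [- rho' = A2 (|x0| + rho) + B2] up to a margin
    [d]; the limit over enlarged balls in [Sbar] and [Ibar] pays for this margin. A Lipschitz bound
    is not smooth on the diagonal, so it is obtained as an envelope of moduli [a |x - z|^2 + b]. The
    radius [r] grows at rate [C1] because (H1), used to move the equation from the minimizer to the
    centre, costs [C1 (beta + |p|) r]: the growth [r' |p|] cancels the part with [|p|]. Since
    [psi / r] does not depend on [r0], dividing by [r t0] and letting [r0] tend to 0 loses nothing,
    and [psi t0 / r t0] is exactly the lower bound with [m] in place of the infimum. The passage
    from super- to subgradients needs bounded slopes; hence the Lipschitz estimate, with the global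
    constant of [u0], also precedes the lower bound. [H] is controlled on [[0, T]] and [u] on
    [[0, T)]: both are extended by freezing time outside a compact interval, so that all functions
    are continuous on the whole space and only the inequalities are restricted to an open time
    interval. *)

Section ContinuityBasics.
Implicit Type T : topologicalType.

Lemma continuous_pairf T (U V : topologicalType) (f : T -> U) (g : T -> V) :
  continuous f -> continuous g -> continuous (fun x => (f x, g x)).
Proof. by move=> cf cg x; apply: cvg_pair; [exact: cf|exact: cg]. Qed.

Lemma continuous_compf T (U V : topologicalType) (f : T -> U) (g : U -> V) :
  continuous f -> continuous g -> continuous (fun x => g (f x)).
Proof. by move=> cf cg x; apply: continuous_comp; [exact: cf|exact: cg]. Qed.

Lemma continuous_idf T : continuous (fun x : T => x).
Proof. by move=> x; exact: cvg_id. Qed.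

Lemma continuous_cstf T (U : topologicalType) (c : U) : continuous (fun _ : T => c).
Proof. by move=> x; exact: cvg_cst. Qed.

Lemma continuousBv T (R : realType) (V : normedModType R) (f g : T -> V) :
  continuous f -> continuous g -> continuous (fun x => f x - g x).
Proof. by move=> cf cg x; apply: cvgB; [exact: cf|exact: cg]. Qed.

End ContinuityBasics.

(** * Euclidean norm of row vectors and its topology *)

Section Euclid.
Context {R : realType} {n : nat}.
Implicit Types (x y z : 'rV[R]_n) (c : R).

Lemma dotvC x y : dotv x y = dotv y x.
Proof. by rewrite /dotv; apply: eq_bigr => i _; rewrite mulrC. Qed.

Lemma dotvDl x y z : dotv (x + y) z = dotv x z + dotv y z.
Proof.
by rewrite /dotv -big_split; apply: eq_bigr => i _; rewrite mxE mulrDl.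
Qed.

Lemma dotvZl c x y : dotv (c *: x) y = c * dotv x y.
Proof.
by rewrite /dotv mulr_sumr; apply: eq_bigr => i _; rewrite mxE mulrA.
Qed.

Lemma dotvDr x y z : dotv x (y + z) = dotv x y + dotv x z.
Proof. by rewrite dotvC dotvDl !(dotvC x). Qed.

Lemma dotvZr c x y : dotv x (c *: y) = c * dotv x y.
Proof. by rewrite dotvC dotvZl dotvC. Qed.

Lemma dotvNl x y : dotv (- x) y = - dotv x y.
Proof. by rewrite -scaleN1r dotvZl mulN1r. Qed.

Lemma dotvNr x y : dotv x (- y) = - dotv x y.
Proof. by rewrite dotvC dotvNl dotvC. Qed.

Lemma dotvBl x y z : dotv (x - y) z = dotv x z - dotv y z.
Proof. by rewrite dotvDl dotvNl. Qed.

Lemma dotvBr x y z : dotv x (y - z) = dotv x y - dotv x z.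
Proof. by rewrite dotvDr dotvNr. Qed.

Lemma dotv0r x : dotv x 0 = 0.
Proof. by rewrite -(scale0r 0) dotvZr mul0r. Qed.

Lemma dotv0l x : dotv 0 x = 0.
Proof. by rewrite dotvC dotv0r. Qed.

Lemma dotvv_ge0 x : 0 <= dotv x x.
Proof. by apply: sumr_ge0 => i _; rewrite -expr2 sqr_ge0. Qed.

Lemma enorm_ge0 x : 0 <= enorm x.
Proof. exact: sqrtr_ge0. Qed.

Lemma enorm_sqr x : enorm x ^+ 2 = dotv x x.
Proof. by rewrite sqr_sqrtr // dotvv_ge0. Qed.

Lemma enorm0 : enorm (0 : 'rV[R]_n) = 0.
Proof. by rewrite /enorm dotv0r sqrtr0. Qed.

Lemma enormN x : enorm (- x) = enorm x.
Proof. by rewrite /enorm dotvNl dotvNr opprK. Qed.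

Lemma enormB x y : enorm (x - y) = enorm (y - x).
Proof. by rewrite -enormN opprB. Qed.

Lemma enormZ c x : enorm (c *: x) = `|c| * enorm x.
Proof.
by rewrite /enorm dotvZl dotvZr mulrA -expr2 sqrtrM ?sqr_ge0// sqrtr_sqr.
Qed.

(** The topology of row vectors comes from the maximum norm; this bound and [enorm_le_mx_norm] carry
    statements about Euclidean balls over to its filters. *)
Lemma mx_norm_le_enorm x : `|x| <= enorm x.
Proof.
rewrite [leLHS]mx_normrE; apply/bigmax_leP; split=> [|[i j] _]; first exact: enorm_ge0.
rewrite /= ord1 -sqrtr_sqr ler_wsqrtr//.
rewrite /dotv (bigD1 j)//= -expr2 lerDl.
by apply: sumr_ge0 => k _; rewrite -expr2 sqr_ge0.
Qed.

Lemma enorm_eq0 x : enorm x = 0 -> x = 0.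
Proof.
by move=> x0; apply/normr0_eq0/eqP; rewrite eq_le normr_ge0 -x0 mx_norm_le_enorm.
Qed.

Lemma enorm_gt0 x : x != 0 -> 0 < enorm x.
Proof.
by rewrite lt0r enorm_ge0 andbT; apply: contra => /eqP /enorm_eq0 ->.
Qed.

(* Expand [| |y| x - |x| y |^2 >= 0]. *)
Lemma dotv_le x y : dotv x y <= enorm x * enorm y.
Proof.
have [->|x0] := eqVneq x 0; first by rewrite dotv0l enorm0 mul0r.
have [->|y0] := eqVneq y 0; first by rewrite dotv0r enorm0 mulr0.
have := dotvv_ge0 (enorm y *: x - enorm x *: y).
rewrite !(dotvBl, dotvBr, dotvZl, dotvZr) -!enorm_sqr (dotvC y x).
have := enorm_gt0 _ x0; have := enorm_gt0 _ y0.
set a := enorm x; set b := enorm y => b0 a0 h.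
have {}h : 0 <= (2 * (a * b)) * (a * b - dotv x y) by nra.
by rewrite -subr_ge0; move: h; rewrite pmulr_rge0// !mulr_gt0.
Qed.

Lemma dotv_ge x y : - (enorm x * enorm y) <= dotv x y.
Proof. by rewrite lerNl -dotvNl (le_trans (dotv_le _ _))// enormN. Qed.

Lemma enorm_sqrD x y :
  enorm (x + y) ^+ 2 = enorm x ^+ 2 + 2 * dotv x y + enorm y ^+ 2.
Proof. by rewrite !enorm_sqr dotvDl !dotvDr (dotvC y x); ring. Qed.

Lemma enormD x y : enorm (x + y) <= enorm x + enorm y.
Proof.
rewrite -(@ler_pXn2r _ 2)// ?nnegrE ?addr_ge0 ?enorm_ge0//.
by rewrite enorm_sqrD; have := dotv_le x y; nra.
Qed.

Lemma enorm_triangle z x y : enorm (x - y) <= enorm (x - z) + enorm (z - y).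
Proof. by rewrite (le_trans _ (enormD _ _))// addrA subrK. Qed.

Lemma enorm_lip x y : `|enorm x - enorm y| <= enorm (x - y).
Proof.
rewrite ler_norml; apply/andP; split.
  by have := enorm_triangle x y 0; rewrite !subr0 (enormB y); lra.
by have := enorm_triangle y x 0; rewrite !subr0; lra.
Qed.

(* AM-GM: [2 |a| |a + v| <= |a|^2 + |a + v|^2]. *)
Lemma enorm_taylor (a v : 'rV[R]_n) : 0 < enorm a ->
  enorm (a + v) <= enorm a + dotv ((enorm a)^-1 *: a) v
                   + enorm v ^+ 2 / (2 * enorm a).
Proof.
move=> a0; rewrite dotvZl -(ler_pM2l (_ : 0 < 2 * enorm a)) ?mulr_gt0//.
have -> : 2 * enorm a * (enorm a + (enorm a)^-1 * dotv a v
            + enorm v ^+ 2 / (2 * enorm a)) =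
          enorm a ^+ 2 + enorm (a + v) ^+ 2.
  by rewrite enorm_sqrD; field; rewrite gt_eqF.
by have := sqr_ge0 (enorm a - enorm (a + v)); nra.
Qed.

Lemma enorm_le_mx_norm x : enorm x <= n%:R * `|x|.
Proof.
rewrite /enorm -(@ler_pXn2r _ 2)// ?nnegrE ?mulr_ge0 ?sqrtr_ge0//.
rewrite sqr_sqrtr ?dotvv_ge0//.
have h i : x ord0 i * x ord0 i <= `|x| ^+ 2.
  rewrite -expr2 -real_normK ?num_real// ler_pXn2r ?nnegrE//.
  by rewrite [leRHS]mx_normrE (le_bigmax _ (fun ij => `|x ij.1 ij.2|) (ord0, i)).
rewrite (le_trans (ler_sum _ (fun i _ => h i)))//.
rewrite sumr_const card_ord -[leLHS]mulr_natl exprMn ler_wpM2r ?sqr_ge0//.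
by rewrite -natrX ler_nat; case: (n) => // k; rewrite leq_pmulr.
Qed.

Lemma dotv_continuous : continuous (fun p : 'rV[R]_n * 'rV[R]_n => dotv p.1 p.2).
Proof.
rewrite /continuous_at /dotv => p; apply: cvg_big; first exact: add_continuous.
move=> i _; apply: cvgM.
  exact: (continuous_comp (@cvg_fst _ _ _ _ _) (@coord_continuous _ _ _ _ _ _)).
exact: (continuous_comp (@cvg_snd _ _ _ _ _) (@coord_continuous _ _ _ _ _ _)).
Qed.

Lemma enorm_continuous : continuous (@enorm R n).
Proof.
move=> x; apply: continuous_comp; last exact: sqrt_continuous.
have cid := @continuous_idf ('rV[R]_n : topologicalType).
exact: (continuous_compf _ _ _ _ _ (continuous_pairf _ _ _ _ _ cid cid)
          dotv_continuous).
Qed.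

Definition eball (x0 : 'rV[R]_n) (r : R) : set 'rV[R]_n :=
  [set x | enorm (x - x0) <= r].

Lemma eball_compact x0 (r : R) : compact (eball x0 r).
Proof.
apply: bounded_closed_compact.
  exists (r + `|x0|); split; first exact: num_real.
  move=> M rM x xr /=; rewrite -(subrK x0 x) (le_trans (ler_normD _ _))//.
  rewrite (le_trans _ (ltW rM))// lerD2r.
  exact: le_trans (mx_norm_le_enorm _) xr.
apply: (@preimage_closed _ _ (fun x => enorm (x - x0)) [set s | s <= r]);
  last exact: closed_le.
move=> x _; apply: (@continuous_comp _ _ _ (fun x => x - x0) (@enorm R n)).
  exact: (continuousBv _ _ _ _ _ (continuous_idf _) (continuous_cstf _ _ x0)).
exact: enorm_continuous.
Qed.

Lemma near_eball x (r : R) : 0 < r -> \forall y \near x, enorm (y - x) < r.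
Proof.
move=> r0; have N0 : 0 < n%:R + 1 :> R by rewrite ltr_wpDl.
have : 0 < r / (n%:R + 1) by rewrite divr_gt0.
move=> /(nbhsx_ballx x); rewrite -ball_normE.
apply: filterS => y /= xy; rewrite enormB (le_lt_trans (enorm_le_mx_norm _))//.
rewrite (@le_lt_trans _ _ ((n%:R + 1) * `|x - y|))//.
  by rewrite ler_wpM2r// lerDl.
by move: xy; rewrite ltr_pdivlMr// mulrC.
Qed.

Lemma near_eballP x (P : set 'rV[R]_n) :
  (\forall y \near x, P y) -> exists2 d : R, 0 < d & forall y, enorm (y - x) < d -> P y.
Proof.
move=> /nbhs_ballP[d d0 dP]; exists d => // y yx; apply: dP.
by rewrite -ball_normE /= distrC (le_lt_trans (mx_norm_le_enorm _)).
Qed.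

End Euclid.

(** * Continuity of composite expressions and extrema on compact sets *)

Section Continuity.
Context {R : realType}.
Implicit Type T : topologicalType.

Lemma continuous_near T (f : T -> R) :
  (forall x (e : R), 0 < e -> \forall y \near x, `|f x - f y| < e) ->
  continuous f.
Proof. by move=> h x; apply/cvgrPdist_lt => e; exact: h. Qed.

Lemma continuousNf T (f : T -> R) : continuous f -> continuous (fun x => - f x).
Proof. by move=> cf x; apply: cvgN; exact: cf. Qed.

Lemma continuousMf T (f g : T -> R) :
  continuous f -> continuous g -> continuous (fun x => f x * g x).
Proof. by move=> cf cg x; apply: cvgM; [exact: cf|exact: cg]. Qed.

Lemma continuous_fstf T (U V : topologicalType) (f : T -> U * V) :
  continuous f -> continuous (fun x => (f x).1).
Proof. by move=> cf x; apply: (continuous_comp (cf x)); exact: cvg_fst. Qed.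

Lemma continuous_sndf T (U V : topologicalType) (f : T -> U * V) :
  continuous f -> continuous (fun x => (f x).2).
Proof. by move=> cf x; apply: (continuous_comp (cf x)); exact: cvg_snd. Qed.

Lemma continuous_uncurry_comp T (U V : topologicalType) (f : U -> V -> R)
    (a : T -> U) (b : T -> V) :
  continuous (fun z => f z.1 z.2) -> continuous a -> continuous b ->
  continuous (fun x => f (a x) (b x)).
Proof.
move=> cf ca cb.
exact: (continuous_compf _ _ _ _ _ (continuous_pairf _ _ _ _ _ ca cb) cf).
Qed.

Lemma continuousDv T (V : normedModType R) (f g : T -> V) :
  continuous f -> continuous g -> continuous (fun x => f x + g x).
Proof. by move=> cf cg x; apply: cvgD; [exact: cf|exact: cg]. Qed.

Lemma continuousZv T (V : normedModType R) (f : T -> R) (g : T -> V) :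
  continuous f -> continuous g -> continuous (fun x => f x *: g x).
Proof. by move=> cf cg x; apply: cvgZ; [exact: cf|exact: cg]. Qed.

Lemma continuousXf T (f : T -> R) k :
  continuous f -> continuous (fun x => f x ^+ k).
Proof.
by move=> cf; exact: (continuous_compf _ _ _ _ _ cf (@exprn_continuous _ k)).
Qed.

Lemma continuous_maxf T (f g : T -> R) :
  continuous f -> continuous g -> continuous (fun x => Num.max (f x) (g x)).
Proof. by move=> cf cg x; apply: continuous_max; [exact: cf|exact: cg]. Qed.

Lemma continuous_minf T (f g : T -> R) :
  continuous f -> continuous g -> continuous (fun x => Num.min (f x) (g x)).
Proof. by move=> cf cg x; apply: continuous_min; [exact: cf|exact: cg]. Qed.

Lemma continuous_expf T (f : T -> R) :
  continuous f -> continuous (fun x => expR (f x)).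
Proof. by move=> cf; exact: (continuous_compf _ _ _ _ _ cf (@continuous_expR R)). Qed.

Lemma continuous_enormf T n (f : T -> 'rV[R]_n) :
  continuous f -> continuous (fun x => enorm (f x)).
Proof. by move=> cf; exact: (continuous_compf _ _ _ _ _ cf enorm_continuous). Qed.

Lemma continuous_max_attained T (f : T -> R) (A : set T) :
  A !=set0 -> compact A -> continuous f ->
  exists2 c, A c & forall t, A t -> f t <= f c.
Proof.
move=> A0 cA cf.
have [|c /set_mem Ac h] := compact_EVT_max A0 cA (f := f).
  exact: continuous_subspaceT.
by exists c => // t At; apply: h; exact/mem_set.
Qed.

Lemma continuous_min_attained T (f : T -> R) (A : set T) :
  A !=set0 -> compact A -> continuous f ->
  exists2 c, A c & forall t, A t -> f c <= f t.
Proof.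
move=> A0 cA cf.
have [c Ac h] := continuous_max_attained T _ A A0 cA (continuousNf _ _ cf).
by exists c => // t /h; rewrite lerN2.
Qed.

(** A form of the tube lemma: closeness near each point [(a, b)] spreads over the compact set of
    parameters [b]. It supplies every uniform modulus of continuity used below. *)
Lemma compact_near_uniform (T U : topologicalType) (F : T -> U -> R)
    (K : set U) (a : T) (e : R) :
  compact K -> continuous (fun z => F z.1 z.2) -> 0 < e ->
  \forall a' \near a, forall b, K b -> `|F a' b - F a b| < e.
Proof.
move=> /compact_near_coveringP cK cF e0.
apply: (cK T (nbhs a) (fun a' b => `|F a' b - F a b| < e)) => b Kb.
have e20 : 0 < e / 2 by rewrite divr_gt0.
have /cvgrPdist_lt/(_ _ e20) h := cF (a, b).
have [[A B] /= [An Bn] AB] := h.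
exists (B, A `&` [set a' | True]) => /=; first by split => //; apply: filterI => //; exact: filterT.
move=> [b' a'] /= [Bb' [Aa' _]].
have h1 := AB (a', b') (conj Aa' Bb').
have h2 := AB (a, b') (conj (nbhs_singleton An) Bb').
rewrite /= in h1 h2.
have -> : F a' b' - F a b' = (F a b - F a b') - (F a b - F a' b') by ring.
by rewrite (le_lt_trans (ler_normB _ _))// [e]splitr ltrD.
Qed.

End Continuity.

(** The generic application clauses match the arithmetic operations as well, so they come last. *)
Ltac cont :=
  lazymatch goal with
  | H : ?P |- ?P => exact: H
  | |- forall y, continuous_at y (fun _ => ?c) => exact: continuous_cstf
  | |- forall y, continuous_at y (fun x => x) => exact: continuous_idf
  | |- forall y, continuous_at y (fun x => (@?f x).1) =>
      apply: (continuous_fstf _ _ _ f); cont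
  | |- forall y, continuous_at y (fun x => (@?f x).2) =>
      apply: (continuous_sndf _ _ _ f); cont
  | |- forall y, continuous_at y (fun x => (@?f x, @?g x)) =>
      apply: (continuous_pairf _ _ _ f g); cont
  | |- forall y, continuous_at y (fun x => @?f x - @?g x) =>
      apply: (continuousBv _ _ _ f g); cont
  | |- forall y, continuous_at y (fun x => @?f x + @?g x) =>
      apply: (continuousDv _ _ f g); cont
  | |- forall y, continuous_at y (fun x => - (@?f x)) =>
      apply: (continuousNf _ f); cont
  | |- forall y, continuous_at y (fun x => @?f x * @?g x) =>
      apply: (continuousMf _ f g); cont
  | |- forall y, continuous_at y (fun x => @?f x *: @?g x) =>
      apply: (continuousZv _ _ f g); cont
  | |- forall y, continuous_at y (fun x => (@?f x) ^+ ?k) =>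
      apply: (continuousXf _ f k); cont
  | |- forall y, continuous_at y (fun x => expR (@?f x)) =>
      apply: (continuous_expf _ f); cont
  | |- forall y, continuous_at y (fun x => Num.max (@?f x) (@?g x)) =>
      apply: (continuous_maxf _ f g); cont
  | |- forall y, continuous_at y (fun x => Num.min (@?f x) (@?g x)) =>
      apply: (continuous_minf _ f g); cont
  | |- forall y, continuous_at y (fun x => enorm (@?f x)) =>
      apply: (continuous_enormf _ _ f); cont
  | |- forall y, continuous_at y (fun x => ?h (@?f x) (@?g x)) =>
      apply: (continuous_uncurry_comp _ _ _ h f g); cont
  | |- forall y, continuous_at y (fun x => ?h (@?f x)) =>
      apply: (continuous_compf _ _ _ f h); cont
  | |- _ => try assumption
  end.

(** * Second-order bounds and proximal gradients *)

Section QDiff.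
Context {R : realType}.
Implicit Types (a b : R -> R) (c d e t : R).

(** Differentiability with a quadratic remainder: the test functions are quadratic, and a remainder
    that is only [o(s - t)] could not be absorbed by them. *)
Definition qdiff a t d := exists k r, [/\ 0 <= k, 0 < r &
  forall s, `|s - t| < r -> `|a s - a t - d * (s - t)| <= k * (s - t) ^+ 2].

Lemma qdiff_cst c t : qdiff (fun=> c) t 0.
Proof.
by exists 0, 1; split=> // s _; rewrite subrr !mul0r subr0 normr0.
Qed.

Lemma qdiff_lin c t : qdiff (fun s => c * s) t c.
Proof.
by exists 0, 1; split=> // s _; rewrite -mulrBr subrr mul0r normr0.
Qed.

Lemma qdiffD a b t d e :
  qdiff a t d -> qdiff b t e -> qdiff (fun s => a s + b s) t (d + e).
Proof.
move=> [k [r [k0 r0 ar]]] [k' [r' [k0' r0' br]]].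
exists (k + k'), (Num.min r r'); split; [exact: addr_ge0|by rewrite lt_min r0|].
move=> s; rewrite lt_min => /andP[/ar ha /br hb].
have -> : a s + b s - (a t + b t) - (d + e) * (s - t) =
  (a s - a t - d * (s - t)) + (b s - b t - e * (s - t)) by ring.
by rewrite (le_trans (ler_normD _ _))// mulrDl lerD.
Qed.

Lemma qdiffZ a c t d : qdiff a t d -> qdiff (fun s => c * a s) t (c * d).
Proof.
move=> [k [r [k0 r0 ar]]]; exists (`|c| * k), r; split=> //.
  by rewrite mulr_ge0.
move=> s /ar h; have -> : c * a s - c * a t - c * d * (s - t) =
  c * (a s - a t - d * (s - t)) by ring.
by rewrite normrM -mulrA ler_wpM2l.
Qed.

Lemma qdiff_lip a t d : qdiff a t d -> exists k r, [/\ 0 <= k, 0 < r &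
  forall s, `|s - t| < r -> `|a s - a t| <= k * `|s - t|].
Proof.
move=> [k [r [k0 r0 ar]]]; exists (`|d| + k * r), r; split=> //.
  by rewrite addr_ge0// mulr_ge0// ltW.
move=> s sr; have -> : a s - a t = (a s - a t - d * (s - t)) + d * (s - t).
  by ring.
rewrite (le_trans (ler_normD _ _))// normrM mulrDl addrC lerD2l.
rewrite (le_trans (ar _ sr))// -real_normK ?num_real// expr2 mulrA.
by rewrite ler_wpM2r// ler_wpM2l// ltW.
Qed.

(** The tangent inequalities at [h] and [- h] give [1 + h <= exp h] and [exp h (1 - h) <= 1];
    moreover [(1 + h + 2 h^2) (1 - h) = 1 + h^2 (1 - 2 h) >= 1] for [h <= 1/2]. *)
Lemma expR_quadratic (h : R) : `|h| <= 1 / 2 -> `|expR h - 1 - h| <= 2 * h ^+ 2.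
Proof.
move=> h1; have := expR_ge1Dx h; have := expR_ge1Dx (- h).
rewrite ler_norml; have := expRxMexpNx_1 h; have := expR_gt0 h.
move: h1; rewrite ler_norml => /andP[].
set E := expR h; set E' := expR (- h) => h1 h2 E0 EE h3 h4.
have h5 : E * (1 - h) <= 1 by nra.
have h6 : 0 <= h ^+ 2 * (1 - 2 * h) by rewrite mulr_ge0 ?sqr_ge0//; lra.
have h7 : (E - (1 + h + 2 * h ^+ 2)) * (1 - h) <= 0 by lra.
apply/andP; split; first by have := sqr_ge0 h; lra.
have h8 : 0 < 1 - h by lra.
by move: h7; rewrite pmulr_lle0//; lra.
Qed.

Lemma qdiff_exp c t : qdiff (fun s => expR (c * s)) t (c * expR (c * t)).
Proof.
exists (2 * expR (c * t) * c ^+ 2), (1 / 2 / (`|c| + 1)); split.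
- by rewrite mulr_ge0 ?sqr_ge0// mulr_ge0 ?expR_ge0.
- by rewrite !divr_gt0// ltr_wpDl.
move=> s sr; have -> : expR (c * s) - expR (c * t) - c * expR (c * t) * (s - t)
  = expR (c * t) * (expR (c * (s - t)) - 1 - c * (s - t)).
  have -> : expR (c * s) = expR (c * t) * expR (c * (s - t)).
    by rewrite -expRD; congr expR; ring.
  by ring.
rewrite normrM (gtr0_norm (expR_gt0 _)).
have -> : 2 * expR (c * t) * c ^+ 2 * (s - t) ^+ 2 =
  expR (c * t) * (2 * (c * (s - t)) ^+ 2) by ring.
rewrite ler_wpM2l ?expR_ge0// expR_quadratic// normrM.
move: sr; rewrite ltr_pdivlMr ?ltr_wpDl// => sr.
by have := normr_ge0 (s - t); nra.
Qed.

End QDiff.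

Section Prox.
Context {R : realType} {n : nat}.
Local Notation V := 'rV[R]_n.
Implicit Types (f g : V -> R -> R) (x y p q : V) (s t : R).

(* First-order jets realized by quadratic test functions, the only test functions
   at which the viscosity inequalities are needed. *)
Definition prox_sup f x t p (tau : R) := exists k r, [/\ 0 <= k, 0 < r &
  forall y s, enorm (y - x) < r -> `|s - t| < r ->
    f y s <= f x t + dotv p (y - x) + tau * (s - t)
             + k * (enorm (y - x) ^+ 2 + (s - t) ^+ 2)].

Definition prox_sub f x t p (tau : R) := exists k r, [/\ 0 <= k, 0 < r &
  forall y s, enorm (y - x) < r -> `|s - t| < r ->
    f x t + dotv p (y - x) + tau * (s - t)
             - k * (enorm (y - x) ^+ 2 + (s - t) ^+ 2) <= f y s].

(* Subgradients of [f] at [(x, t)] are the supergradients of [mirror f] at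
   [(- x, - t)], with the same slopes. *)
Definition mirror f y s := - f (- y) (- s).

Lemma mirrorK f : mirror (mirror f) = f.
Proof.
by rewrite /mirror; apply/funext => y; apply/funext => s; rewrite !opprK.
Qed.

Lemma mirror_continuous f : continuous (fun z : V * R => f z.1 z.2) ->
  continuous (fun z : V * R => mirror f z.1 z.2).
Proof.
move=> cf; apply: continuousNf.
apply: (continuous_uncurry_comp _ _ _ _ (fun z : V * R => - z.1)
  (fun z : V * R => - z.2) cf).
  rewrite (_ : (fun z => _) = (fun z : V * R => 0 - z.1)); first by cont.
  by apply/funext => z; rewrite sub0r.
by cont.
Qed.

Lemma prox_sup_mirror f x t p tau :
  prox_sup (mirror f) x t p tau -> prox_sub f (- x) (- t) p tau.
Proof.
move=> [k [r [k0 r0 h]]]; exists k, r; split=> // y s yr sr.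
have e1 : - y - x = - (y - - x) by rewrite opprD opprK.
have e2 : - s - t = - (s - - t) by rewrite opprD opprK.
have := h (- y) (- s); rewrite e1 e2 enormN normrN => /(_ yr sr).
by rewrite /mirror !opprK dotvNr sqrrN mulrN; lra.
Qed.

Lemma prox_sub_mirror f x t p tau :
  prox_sub f x t p tau -> prox_sup (mirror f) (- x) (- t) p tau.
Proof.
move=> [k [r [k0 r0 h]]]; exists k, r; split=> // y s yr sr.
have e1 : - y - x = - (y - - x) by rewrite opprD opprK.
have e2 : - s - t = - (s - - t) by rewrite opprD opprK.
have := h (- y) (- s); rewrite e1 e2 enormN normrN => /(_ yr sr).
by rewrite /mirror !opprK dotvNr sqrrN mulrN; lra.
Qed.

Lemma prox_supD f g x t p q (tau nu : R) :
  prox_sup f x t p tau -> prox_sup g x t q nu ->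
  prox_sup (fun y s => f y s + g y s) x t (p + q) (tau + nu).
Proof.
move=> [k [r [k0 r0 hf]]] [k' [r' [k0' r0' hg]]].
exists (k + k'), (Num.min r r'); split; [exact: addr_ge0|by rewrite lt_min r0|].
move=> y s; rewrite !lt_min => /andP[y1 y2] /andP[s1 s2].
by have := hf _ _ y1 s1; have := hg _ _ y2 s2; rewrite dotvDl; lra.
Qed.

Lemma prox_sup_dom f g x t p (tau r : R) : 0 < r ->
  (forall y s, enorm (y - x) < r -> `|s - t| < r ->
    f y s - f x t <= g y s - g x t) ->
  prox_sup g x t p tau -> prox_sup f x t p tau.
Proof.
move=> r0 fg [k [r' [k0 r0' hg]]].
exists k, (Num.min r r'); split; [by []|by rewrite lt_min r0|].
move=> y s; rewrite !lt_min => /andP[y1 y2] /andP[s1 s2].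
by have := fg _ _ y1 s1; have := hg _ _ y2 s2; lra.
Qed.

Lemma prox_sup_time (a : R -> R) x t d :
  qdiff a t d -> prox_sup (fun _ s => a s) x t 0 d.
Proof.
move=> [k [r [k0 r0 h]]]; exists k, r; split=> // y s yr /h.
rewrite dotv0l ler_norml => /andP[_].
by have := mulr_ge0 k0 (sqr_ge0 (enorm (y - x))); lra.
Qed.

Lemma prox_sup_quad (a : R -> R) x t d z : qdiff a t d ->
  prox_sup (fun y s => a s * enorm (y - z) ^+ 2) x t ((2 * a t) *: (x - z))
    (d * enorm (x - z) ^+ 2).
Proof.
move=> [k [r [k0 r0 h]]].
set N := enorm (x - z); have N0 : 0 <= N := enorm_ge0 _.
(* The three constants absorb [a t |y - x|^2], the mixed terms in [s - t] and [y - x], and the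
   remainder of [a] times [|y - z|^2 <= (N + 1)^2]. *)
exists (`|a t| + `|d| * (2 * N + 1) + k * (N + 1) ^+ 2), (Num.min r 1); split.
- by rewrite !addr_ge0// mulr_ge0// ?sqr_ge0// addr_ge0// mulr_ge0.
- by rewrite lt_min r0 /=.
move=> y s; rewrite !lt_min => /andP[_ y1] /andP[sr s1].
have -> : y - z = (x - z) + (y - x) by rewrite [RHS]addrC addrA subrK.
have tri : enorm (x - z + (y - x)) <= N + 1.
  by rewrite (le_trans (enormD _ _))// lerD2l ltW.
have := enorm_sqrD (x - z) (y - x); rewrite -/N.
have := dotv_le (x - z) (y - x); have := dotv_ge (x - z) (y - x).
rewrite -/N dotvZl; move: (enorm_ge0 (y - x)) y1 tri (enorm_ge0 (x - z + (y - x))).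
set D := enorm (y - x); set c := dotv _ _; set Y := enorm (_ + _).
move=> D0 D1 YN Y0 c1 c2 YE.
have := h s sr; rewrite ler_norml => /andP[_].
set h' := s - t in s1 *; set A := a s => hA.
have Y2 : 0 <= Y ^+ 2 by exact: sqr_ge0.
have h2 : 0 <= h' ^+ 2 by exact: sqr_ge0.
have D2 : 0 <= D ^+ 2 by exact: sqr_ge0.
have s1' : A * Y ^+ 2 <= (a t + d * h' + k * h' ^+ 2) * Y ^+ 2.
  by rewrite ler_wpM2r//; lra.
have s2' : k * h' ^+ 2 * Y ^+ 2 <= k * h' ^+ 2 * (N + 1) ^+ 2.
  apply: ler_wpM2l; first exact: mulr_ge0.
  by rewrite ler_pXn2r ?nnegrE//; lra.
have s3 : a t * D ^+ 2 <= `|a t| * D ^+ 2 by rewrite ler_wpM2r// ler_norm.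
have hD : `|h'| * D <= h' ^+ 2 + D ^+ 2.
  rewrite -[h' ^+ 2]real_normK ?num_real//.
  by have := sqr_ge0 (`|h'| - D); have := sqr_ge0 `|h'|; nra.
have s4 : d * h' * (2 * c + D ^+ 2) <= `|d| * ((2 * N + 1) * (h' ^+ 2 + D ^+ 2)).
  rewrite (le_trans (ler_norm _))// !normrM -mulrA ler_wpM2l//.
  have cD : `|2 * c + D ^+ 2| <= (2 * N + 1) * D.
    by rewrite ler_norml; apply/andP; split; nra.
  rewrite (@le_trans _ _ (`|h'| * ((2 * N + 1) * D)))// ?ler_wpM2l//.
  by rewrite mulrCA ler_wpM2l//; lra.
have s5 : 0 <= k * (N + 1) ^+ 2 * D ^+ 2.
  by apply: mulr_ge0 => //; apply: mulr_ge0 => //; exact: sqr_ge0.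
have s6 : 0 <= `|a t| * h' ^+ 2 by rewrite mulr_ge0.
rewrite YE in s1' s2' *.
by lra.
Qed.

Lemma maxr0_ge0 (m : R) : 0 <= Num.max 0 m.
Proof. by rewrite le_max lexx. Qed.

(** The squared positive part is smooth enough across the lateral boundary, and the norm is singular
    only at [x0], where [m = 0] because [rho t >= 0]; there the slope is read with [0 / 0 = 0]. *)
Lemma prox_sup_barrier (N : R) (rho : R -> R) x0 x t d : 0 <= N -> 0 <= rho t ->
  qdiff rho t d ->
  let m := Num.max 0 (enorm (x - x0) - rho t) in
  prox_sup (fun y s => N * Num.max 0 (enorm (y - x0) - rho s) ^+ 2) x t
    ((2 * N * m / enorm (x - x0)) *: (x - x0)) (2 * N * m * - d).
Proof.
move=> N0 rho0 qd m; have [k [r [k0 r0 h]]] := qd.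
have [l [r' [l0 r0' h']]] := qdiff_lip _ _ _ qd.
have mm y s : enorm (y - x) < Num.min r r' -> `|s - t| < Num.min r r' ->
    `|enorm (y - x0) - rho s - (enorm (x - x0) - rho t)|
      <= enorm (y - x) + l * `|s - t|.
  rewrite !lt_min => /andP[y1 y2] /andP[s1 s2].
  have -> : enorm (y - x0) - rho s - (enorm (x - x0) - rho t) =
    (enorm (y - x0) - enorm (x - x0)) - (rho s - rho t) by ring.
  rewrite (le_trans (ler_normB _ _))// lerD ?h'//.
  rewrite (le_trans (enorm_lip _ _))// opprB addrA subrK//.
have sq (D e : R) : (D + l * e) ^+ 2 <= 2 * (1 + l ^+ 2) * (D ^+ 2 + e ^+ 2).
  by have := sqr_ge0 (D - l * e); have := sqr_ge0 (l * D); have := sqr_ge0 e; nra.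
have minr : 0 < Num.min r r' by rewrite lt_min r0.
have [m0|m0] := leP (enorm (x - x0) - rho t) 0.
  have {}m0' : m = 0 by rewrite /m; apply: max_l.
  exists (N * (2 * (1 + l ^+ 2))), (Num.min r r'); split=> //.
    by rewrite !mulr_ge0// addr_ge0// sqr_ge0.
  move=> y s yr sr; rewrite -/m m0' !(mulr0, mul0r) scale0r dotv0l.
  rewrite expr0n mulr0 !(mul0r, add0r) -mulrA ler_wpM2l//.
  have := sq (enorm (y - x)) `|s - t|.
  rewrite real_normK ?num_real//; apply: le_trans.
  rewrite ler_pXn2r ?nnegrE ?maxr0_ge0 ?addr_ge0 ?mulr_ge0 ?enorm_ge0//.
  rewrite ge_max addr_ge0 ?mulr_ge0 ?enorm_ge0//=.
  by have := mm y s yr sr; rewrite ler_norml => /andP[_]; lra.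
have mE : m = enorm (x - x0) - rho t by rewrite /m; apply/max_r/ltW.
have xx0 : 0 < enorm (x - x0) by lra.
exists (2 * N * m * (k + (2 * enorm (x - x0))^-1) + N * (2 * (1 + l ^+ 2))),
  (Num.min r r'); split=> //.
  rewrite addr_ge0 ?mulr_ge0 ?addr_ge0 ?invr_ge0 ?mulr_ge0 ?sqr_ge0//.
    by rewrite mE ltW.
  by rewrite enorm_ge0.
move=> y s yr sr; have := mm y s yr sr; rewrite -/m -mE => hm.
have tay := enorm_taylor (x - x0) (y - x) xx0.
have yE : x - x0 + (y - x) = y - x0 by rewrite addrC addrA subrK.
rewrite yE dotvZl in tay.
have := h s; move: (sr); rewrite lt_min => /andP[sr1 _] /(_ sr1).
rewrite ler_norml => /andP[hl _].
set M := enorm (y - x0) - rho s in hm *.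
have M2 : Num.max 0 M ^+ 2 <= M ^+ 2.
  by have [_|_//] := leP M 0; rewrite expr0n sqr_ge0.
have M3 : (M - m) ^+ 2 <= 2 * (1 + l ^+ 2) * (enorm (y - x) ^+ 2 + (s - t) ^+ 2).
  rewrite -[(s - t) ^+ 2]real_normK ?num_real//.
  apply: le_trans (sq (enorm (y - x)) `|s - t|).
  rewrite -[(M - m) ^+ 2]real_normK ?num_real// ler_pXn2r ?nnegrE//.
  by rewrite addr_ge0 ?mulr_ge0 ?enorm_ge0.
rewrite !dotvZl.
have M4 : M - m <= (enorm (x - x0))^-1 * dotv (x - x0) (y - x) - d * (s - t)
   + (k + (2 * enorm (x - x0))^-1) * (enorm (y - x) ^+ 2 + (s - t) ^+ 2).
  have h1 : 0 <= k * enorm (y - x) ^+ 2 by rewrite mulr_ge0 ?sqr_ge0.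
  have h2 : 0 <= (2 * enorm (x - x0))^-1 * (s - t) ^+ 2.
    by rewrite mulr_ge0 ?sqr_ge0 ?invr_ge0 ?mulr_ge0 ?enorm_ge0.
  by rewrite /M mE; lra.
have M5 : 2 * N * m * (M - m) <= 2 * N * m * ((enorm (x - x0))^-1 *
   dotv (x - x0) (y - x) - d * (s - t)
   + (k + (2 * enorm (x - x0))^-1) * (enorm (y - x) ^+ 2 + (s - t) ^+ 2)).
  by rewrite ler_wpM2l// !mulr_ge0// mE ltW.
have M6 := ler_wpM2l N0 M3; have M7 := ler_wpM2l N0 M2.
(* Expansion of [M^2] about [m]: the linear term is bounded by [M5], the square by [M6], and [M^2]
   dominates the squared positive part. *)
have -> : m ^+ 2 = M ^+ 2 - 2 * m * (M - m) - (M - m) ^+ 2 by ring.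
by lra.
Qed.

End Prox.

(** * Mean value inequalities and convexity *)

Section MeanValue.
Context {R : realType} {n : nat}.
Local Notation V := 'rV[R]_n.
Implicit Types (f : V -> R -> R) (x y p q : V) (s t : R).

Lemma near_prod_eball x t (P : set (V * R)) : (\forall z \near (x, t), P z) ->
  exists2 d, 0 < d & forall y s, enorm (y - x) < d -> `|s - t| < d -> P (y, s).
Proof.
move=> [[A B] /= [An Bn] AB]; have [d d0 dA] := near_eballP _ _ An.
move: Bn => /nbhs_ballP[d' d'0 dB].
exists (Num.min d d'); first by rewrite lt_min d0.
move=> y s; rewrite !lt_min => /andP[y1 _] /andP[_ s1].
by apply: AB; split; [exact: dA|apply: dB; rewrite -ball_normE /= distrC].
Qed.

Lemma continuous_dist f x t (e : R) : continuous (fun z : V * R => f z.1 z.2) ->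
  0 < e -> exists2 d, 0 < d & forall y s, enorm (y - x) < d -> `|s - t| < d ->
    `|f y s - f x t| < e.
Proof.
move=> /(_ (x, t)) /cvgrPdistC_lt cf e0.
exact: near_prod_eball _ _ _ (cf _ e0).
Qed.

(* Maximize [f - c' a - k |z - z0 - a zeta|^2] over the points [z] and
   [0 <= a <= h], with [k] large and [c' > c].  A maximum with [a > 0] would
   exhibit a supergradient of slope at least [c'] along [zeta]. *)
Lemma prox_sup_increment f x0 t0 (xi : V) (om h c e : R) :
  continuous (fun z : V * R => f z.1 z.2) -> 0 <= h -> 0 < e ->
  (forall a y s p (tau : R), 0 <= a <= h -> enorm (y - (x0 + a *: xi)) < e ->
     `|s - (t0 + a * om)| < e -> prox_sup f y s p tau ->
     dotv p xi + tau * om <= c) ->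
  f (x0 + h *: xi) (t0 + h * om) <= f x0 t0 + c * h.
Proof.
move=> cf h0 e0 slope; apply/ler_addgt0Pr => th th0.
pose th' := th / (h + 1).
have h1 : 0 < h + 1 by rewrite ltr_wpDl.
have th'0 : 0 < th' / 2 by rewrite !divr_gt0.
suff : f (x0 + h *: xi) (t0 + h * om) <= f x0 t0 + (c + th' / 2) * h + th' / 2.
  move=> hh; rewrite (le_trans hh)//.
  have : th' * h + th' = th by rewrite /th'; field; rewrite gt_eqF.
  by move: th'0; rewrite ltr_pdivlMr// mul0r => th'0; nra.
set c' := c + th' / 2; have cc' : c < c' by rewrite ltrDl.
have [d d0 near0] := continuous_dist _ x0 t0 _ cf th'0.
pose e1 := Num.min (Num.min e 1) d.
have e10 : 0 < e1 by rewrite !lt_min e0 ltr01 d0.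
have [e1e e11 e1d] : [/\ e1 <= e, e1 <= 1 & e1 <= d].
  by rewrite /e1; split; rewrite !ge_min lexx ?orbT.
(* The segment, one unit for the distance of the maximizer to it, and one more unit in which the
   maximizer can be tested. *)
pose Rb := h * (enorm xi + `|om|) + 2.
have Rb0 : 0 <= Rb by rewrite addr_ge0// mulr_ge0// addr_ge0// enorm_ge0.
pose K := (eball x0 Rb `*` `[t0 - Rb, t0 + Rb]) `*` `[0, h] : set ((V * R) * R).
have cK : compact K.
  apply: compact_setX; [apply: compact_setX|]; [|exact: segment_compact..].
  exact: eball_compact.
have KP y s a : enorm (y - x0) <= Rb -> `|s - t0| <= Rb -> 0 <= a <= h ->
    K ((y, s), a).
  move=> y1 s1 a1; split; [split; [exact: y1|]|] => /=; rewrite in_itv//=.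
  by move: s1; rewrite ler_norml => /andP[s1 s2]; apply/andP; split; lra.
have K0 : K !=set0.
  exists ((x0, t0), 0); apply: KP; rewrite ?subrr ?enorm0 ?normr0 ?lexx//.
have [[[ym sm] am] _ fmax] := continuous_max_attained _
  (fun z : (V * R) * R => f z.1.1 z.1.2) K K0 cK ltac:(by cont).
rewrite /= in fmax.
pose zh := f (x0 + h *: xi) (t0 + h * om).
(* Comparison with the end of the segment gives [k D < W] at the maximizer; [k = W / e1^2] then
   keeps it within [e1] of the segment. *)
pose W := f ym sm + 2 * `|c'| * h - zh + 1.
have zhK : K ((x0 + h *: xi, t0 + h * om), h).
  apply: KP; last by rewrite h0 lexx.
    rewrite addrC addKr enormZ ger0_norm// /Rb mulrDr.
    by have := mulr_ge0 h0 (normr_ge0 om); lra.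
  rewrite addrC addKr normrM (ger0_norm h0) /Rb mulrDr.
  by have := mulr_ge0 h0 (enorm_ge0 xi); lra.
have W0 : 0 < W.
  rewrite /W; have := fmax _ zhK; rewrite /= -/zh.
  by have := mulr_ge0 (normr_ge0 c') h0; lra.
pose k := W / e1 ^+ 2.
have k0 : 0 < k by rewrite divr_gt0// exprn_gt0.
pose D y s a := enorm (y - (x0 + a *: xi)) ^+ 2 + (s - (t0 + a * om)) ^+ 2.
have [[[y s] a] [/= [y1 s1] a1]] := continuous_max_attained _
  (fun z : (V * R) * R => f z.1.1 z.1.2 - c' * z.2 - k * D z.1.1 z.1.2 z.2) K
   K0 cK ltac:(by rewrite /D; cont).
rewrite /= in_itv/= in a1; move: (a1) => /andP[a0 ah] /= hmax.
have Dsmall : D y s a < e1 ^+ 2.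
  rewrite -(ltr_pM2l k0) {2}/k divfK ?gt_eqF ?exprn_gt0//.
  have := hmax _ zhK; have := fmax _ (conj (conj y1 s1) _ : K ((y, s), a)).
  rewrite /= in_itv/= a0 ah => /(_ isT).
  rewrite /D !subrr enorm0 expr0n/= addr0 mulr0 subr0 -/(D y s a) -/zh /W.
  have : `|c' * a| <= `|c'| * h by rewrite normrM (ger0_norm a0) ler_wpM2l.
  have : `|c' * h| <= `|c'| * h by rewrite normrM (ger0_norm h0).
  by rewrite !ler_norml => /andP[_ ?] /andP[? _]; lra.
have ye : enorm (y - (x0 + a *: xi)) < e1.
  rewrite -(@ltr_pXn2r _ 2)// ?nnegrE ?enorm_ge0 ?(ltW e10)//.
  by rewrite (le_lt_trans _ Dsmall)// lerDl sqr_ge0.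
have se : `|s - (t0 + a * om)| < e1.
  rewrite -(@ltr_pXn2r _ 2)// ?nnegrE ?(ltW e10)// real_normK ?num_real//.
  by rewrite (le_lt_trans _ Dsmall)// lerDr sqr_ge0.
have inK y' s' : enorm (y' - y) < 1 -> `|s' - s| < 1 -> K ((y', s'), a).
  move=> y'1 s'1; apply: KP => //.
    rewrite (le_trans (enorm_triangle y _ _))//.
    have := enorm_triangle (x0 + a *: xi) y x0.
    rewrite [X in _ + enorm X]addrC addKr enormZ ger0_norm// /Rb.
    have := ler_wpM2r (enorm_ge0 xi) ah; have := mulr_ge0 h0 (normr_ge0 om).
    by lra.
  have -> : s' - t0 = (s' - s) + (s - (t0 + a * om)) + a * om by ring.
  rewrite (le_trans (ler_normD _ _))// normrM (ger0_norm a0).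
  have := ler_normD (s' - s) (s - (t0 + a * om)); rewrite /Rb.
  have := ler_wpM2r (normr_ge0 om) ah; have := mulr_ge0 h0 (enorm_ge0 xi).
  by lra.
pose p := (2 * k) *: (y - (x0 + a *: xi)).
pose tau := 2 * k * (s - (t0 + a * om)).
have prox : prox_sup f y s p tau.
  exists k, 1; split=> [|//|y' s' y'1 s'1]; first exact: ltW.
  have := hmax _ (inK _ _ y'1 s'1); rewrite /= /D.
  have -> : y' - (x0 + a *: xi) = (y - (x0 + a *: xi)) + (y' - y).
    by rewrite [RHS]addrC addrA subrK.
  rewrite enorm_sqrD /p /tau dotvZl.
  by set A := enorm (y - _) ^+ 2; set B := dotv _ _; set C := enorm _ ^+ 2; nra.
have slp : dotv p xi + tau * om <= c.
  by apply: (slope a _ _ _ _ a1 _ _ prox); [exact: lt_le_trans ye _|exact: lt_le_trans se _].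
have [a00|a00] := eqVneq a 0.
  have := hmax _ zhK; rewrite /= /D !subrr enorm0 expr0n/= -/zh.
  rewrite a00 scale0r mul0r !addr0 !mulr0 !subr0 in ye se *.
  have := near0 y s (lt_le_trans ye e1d) (lt_le_trans se e1d).
  rewrite ltr_norml => /andP[_ n1].
  have : 0 <= k * (enorm (y - x0) ^+ 2 + (s - t0) ^+ 2).
    by rewrite mulr_ge0 ?addr_ge0 ?sqr_ge0// ltW.
  by lra.
have {}a00 : 0 < a by rewrite lt_neqAle eq_sym a00.
pose Z := enorm xi ^+ 2 + om ^+ 2.
have Z0 : 0 <= Z by rewrite addr_ge0 ?sqr_ge0.
(* Lowering [a] by [l] changes the functional by [l (c' - slope) - l^2 k Z], which is positive for
   small [l] since the slope is at most [c < c']. Only a decrease of [a] is tested, so [a = h] is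
   allowed. *)
pose l := Num.min a ((c' - c) / (2 * (k * Z + 1))).
have kZ : 0 < k * Z + 1 by rewrite ltr_wpDl// mulr_ge0// ltW.
have l0 : 0 < l by rewrite lt_min a00 divr_gt0 ?subr_gt0 ?mulr_gt0.
have la : l <= a by rewrite /l ge_min lexx.
have lc : l * (2 * (k * Z + 1)) <= c' - c.
  by rewrite -ler_pdivlMr ?mulr_gt0// /l ge_min lexx orbT.
have alh : 0 <= a - l <= h.
  by rewrite subr_ge0 la (le_trans _ ah)// gerBl ltW.
have := hmax ((y, s), a - l); rewrite /K /= => /(_ _)/wrap[].
  by split=> //=; rewrite in_itv.
have -> : D y s (a - l) = D y s a + 2 * l * (dotv (y - (x0 + a *: xi)) xi
    + (s - (t0 + a * om)) * om) + l ^+ 2 * Z.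
  rewrite /D scalerBl.
  have -> : y - (x0 + (a *: xi - l *: xi)) = (y - (x0 + a *: xi)) + l *: xi.
    by rewrite addrA opprD opprK addrA.
  rewrite enorm_sqrD dotvZr enormZ exprMn real_normK ?num_real// /Z.
  by ring.
move=> hl; have {hl} : l * (c' - (dotv p xi + tau * om)) <= l * (l * (k * Z)).
  by rewrite /p /tau dotvZl; lra.
rewrite ler_pM2l// => hl.
have := mulr_ge0 (ltW l0) (mulr_ge0 (ltW k0) Z0).
by lra.
Qed.

(** The mirrored function turns subgradients into supergradients with the same slopes and runs
    through the segment backwards. *)
Lemma prox_sub_increment f x0 t0 (xi : V) (om h c e : R) :
  continuous (fun z : V * R => f z.1 z.2) -> 0 <= h -> 0 < e ->
  (forall a y s p (tau : R), 0 <= a <= h -> enorm (y - (x0 + a *: xi)) < e ->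
     `|s - (t0 + a * om)| < e -> prox_sub f y s p tau ->
     dotv p xi + tau * om <= c) ->
  f (x0 + h *: xi) (t0 + h * om) <= f x0 t0 + c * h.
Proof.
move=> cf h0 e0 slope.
have := prox_sup_increment (mirror f) (- (x0 + h *: xi)) (- (t0 + h * om))
  xi om h c e (mirror_continuous _ cf) h0 e0.
rewrite /mirror !(opprD, opprK) !addrK.
move=> /(_ _)/wrap[|]; last by lra.
move=> a y s p tau /andP[a0 ah] ya sa /prox_sup_mirror.
apply: (slope (h - a)); first by apply/andP; split; lra.
  rewrite -enormN opprD !opprK; congr (enorm _ < _): ya.
  by rewrite scalerBl !opprD; apply/rowP => i; rewrite !mxE; ring.
by rewrite -normrN; congr (`| _ | < _): sa; ring.
Qed.

(** Minimizing [F + k |z - p|^2] yields the exact subgradient [- 2 k (z - p)] at the minimizer [z].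
    Moving the base point back to [p] costs [L N - 2 k N^2] with [N = |z - p|], which is at most
    [L^2 / (8 k) <= e]. *)
Lemma approx_subgradient (F : V -> R) (L : R) p e : 0 <= L -> 0 < e ->
  (forall q q', `|F q - F q'| <= L * enorm (q - q')) ->
  (forall q q' l, 0 <= l <= 1 ->
     F ((1 - l) *: q + l *: q') <= (1 - l) * F q + l * F q') ->
  exists xi, forall q, F p + dotv xi (q - p) - e <= F q.
Proof.
move=> L0 e0 lipF convF.
have cF : continuous F.
  apply: (@continuous_near R V) => q d d0.
  have L1 : 0 < L + 1 by rewrite ltr_wpDl.
  have : 0 < d / (L + 1) by rewrite divr_gt0.
  move=> /(near_eball q); apply: filterS => q' qq'.
  rewrite (le_lt_trans (lipF _ _))// enormB.
  move: qq'; rewrite ltr_pdivlMr// => qq'.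
  by have := enorm_ge0 (q' - q); nra.
pose k := L ^+ 2 / (8 * e) + 1.
have k0 : 0 < k by rewrite ltr_wpDl// divr_ge0 ?sqr_ge0// mulr_ge0// ltW.
have ke : L ^+ 2 <= 8 * k * e.
  rewrite /k mulrDr mulrDl; have -> : 8 * (L ^+ 2 / (8 * e)) * e = L ^+ 2.
    by field; rewrite gt_eqF.
  by lra.
(* The minimizer satisfies [|z - p| <= L / k], so steps of length at most 1 from it stay in the
   ball. *)
pose r := L / k + 1.
have r0 : 0 < r by rewrite ltr_wpDl// divr_ge0// ltW.
have [z zr zmin] := continuous_min_attained _
   (fun z : V => F z + k * enorm (z - p) ^+ 2) (eball p r)
   ltac:(by exists p; rewrite /eball /= subrr enorm0 ltW)
   (eball_compact p r) ltac:(by cont).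
have zp : enorm (z - p) <= L / k.
  rewrite ler_pdivlMr// mulrC.
  have := zmin p; rewrite /eball /= subrr enorm0 expr0n mulr0 addr0 => /(_ (ltW r0)).
  have := lipF p z; rewrite enormB ler_norml => /andP[_ h1] h2.
  have [->|zp0] := eqVneq (enorm (z - p)) 0; first by rewrite mulr0.
  have {}zp0 : 0 < enorm (z - p) by rewrite lt_neqAle eq_sym zp0 enorm_ge0.
  by rewrite -(ler_pM2r zp0); lra.
exists (- (2 * k) *: (z - p)) => q; rewrite dotvZl.
(* Convexity compares [z] with the point a fraction [l] of the way to [q]; the quadratic term has
   order [l^2] and vanishes after division by [l]. *)
have key : F z - 2 * k * dotv (z - p) (q - z) <= F q.
  apply/ler_addgt0Pr => d d0.
  pose N := enorm (q - z).
  have N0 : 0 <= N := enorm_ge0 _.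
  pose l := Num.min 1 (Num.min (1 / (N + 1)) (d / (k * N ^+ 2 + 1))).
  have kN : 0 < k * N ^+ 2 + 1 by rewrite ltr_wpDl// mulr_ge0 ?sqr_ge0// ltW.
  have N1 : 0 < N + 1 by rewrite ltr_wpDl.
  have l0 : 0 < l by rewrite !lt_min ltr01 !divr_gt0.
  have l1 : l <= 1 by rewrite /l ge_min lexx.
  have lN : l * (N + 1) <= 1.
    by rewrite -ler_pdivlMr// /l !ge_min lexx !orbT.
  have ld : l * (k * N ^+ 2 + 1) <= d.
    by rewrite -ler_pdivlMr// /l !ge_min lexx !orbT.
  have zE : (1 - l) *: z + l *: q = z + l *: (q - z).
    by rewrite scalerBl scale1r scalerBr addrAC -addrA.
  have zq : z + l *: (q - z) - p = (z - p) + l *: (q - z) by rewrite addrAC.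
  have := zmin (z + l *: (q - z)) => /(_ _)/wrap[|h1].
    rewrite /eball /= zq (le_trans (enormD _ _))// lerD//.
    rewrite enormZ gtr0_norm// -/N; nra.
  have := convF z q l; rewrite (ltW l0) l1 zE => /(_ isT) h2.
  move: h1; rewrite zq (enorm_sqrD (z - p)) dotvZr enormZ exprMn real_normK ?num_real// -/N.
  move=> h1; have {h1 h2} : l * (F z - 2 * k * dotv (z - p) (q - z)) <=
    l * (F q + l * (k * N ^+ 2)) by lra.
  by rewrite ler_pM2l//; lra.
have -> : dotv (z - p) (q - p) = dotv (z - p) (q - z) + enorm (z - p) ^+ 2.
  by rewrite enorm_sqr -dotvDr addrA subrK.
have h1 := lipF p z; move: h1; rewrite enormB ler_norml => /andP[_ h1].
have : 0 <= (L - 4 * k * enorm (z - p)) ^+ 2 by exact: sqr_ge0.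
have := enorm_ge0 (z - p); move: key h1; set N := enorm (z - p).
move=> key h1 N0 h2.
have h3 : 8 * k * (L * N - 2 * k * N ^+ 2) <= 8 * k * e by lra.
have h4 : L * N - 2 * k * N ^+ 2 <= e by move: h3; rewrite ler_pM2l// mulr_gt0.
by lra.
Qed.

(* Convexity enters here: an affine minorant of [G x t] at [p], with slope
   [xi], turns the inequality on supergradients into a bound on the increment
   of [f] along [(xi, 1)], to which a subgradient can be compared. *)
Lemma prox_sup_to_sub f (G : V -> R -> V -> R) x t p (sigma L M : R) :
  continuous (fun z : V * R => f z.1 z.2) -> 0 <= M ->
  (forall q q', `|G x t q - G x t q'| <= M * enorm (q - q')) ->
  (forall q q' l, 0 <= l <= 1 ->
     G x t ((1 - l) *: q + l *: q') <= (1 - l) * G x t q + l * G x t q') ->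
  (forall e, 0 < e -> exists2 d, 0 < d & forall y s q, enorm (y - x) < d ->
     `|s - t| < d -> enorm q <= L -> `|G y s q - G x t q| <= e) ->
  (exists2 d, 0 < d & forall y s q tau, enorm (y - x) < d -> `|s - t| < d ->
     prox_sup f y s q tau -> enorm q <= L /\ tau + G y s q <= 0) ->
  prox_sub f x t p sigma -> sigma + G x t p <= 0.
Proof.
move=> cf M0 lipG convG contG [d1 d10 supG] [k [r [k0 r0 sub]]].
apply/ler_addgt0Pr => e e0; rewrite add0r.
have e40 : 0 < e / 4 by rewrite divr_gt0.
have [xi hxi] := approx_subgradient (G x t) M p (e / 4) M0 e40 lipG convG.
have [d2 d20 cG] := contG _ e40.
pose N := enorm xi; have N0 : 0 <= N := enorm_ge0 _.
pose D := Num.min (Num.min d1 d2) r.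
have D0 : 0 < D by rewrite !lt_min d10 d20.
have [Dd1 Dd2 Dr] : [/\ D <= d1, D <= d2 & D <= r].
  by rewrite /D; split; rewrite !ge_min lexx ?orbT.
pose h := Num.min (D / (2 * (N + 1))) (e / (4 * (k * (N ^+ 2 + 1) + 1))).
have N1 : 0 < 2 * (N + 1) by rewrite mulr_gt0// ltr_wpDl.
have kN : 0 < 4 * (k * (N ^+ 2 + 1) + 1).
  by rewrite mulr_gt0// ltr_wpDl// mulr_ge0// addr_ge0 ?sqr_ge0.
have h0 : 0 < h by rewrite lt_min !divr_gt0.
have hD : h * (2 * (N + 1)) <= D.
  by rewrite -ler_pdivlMr// /h ge_min lexx.
have he : h * (4 * (k * (N ^+ 2 + 1) + 1)) <= e.
  by rewrite -ler_pdivlMr// /h ge_min lexx orbT.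
have hN : h * N + D / 2 <= D by lra.
have D20 : 0 < D / 2 by rewrite divr_gt0.
(* At a nearby supergradient [(q, tau)] the slope of [f] along [(xi, 1)] is at most
   [q . xi - G y s q]. Passing to [G x t] costs [e / 4], and the affine minorant bounds the result
   by [p . xi - G x t p] at the cost of another [e / 4]. *)
have := prox_sup_increment f x t xi 1 h (dotv xi p - G x t p + e / 2) (D / 2)
  cf (ltW h0) D20.
move=> /(_ _)/wrap[|inc].
  move=> a y s q tau /andP[a0 ah] ya sa qq.
  have yx : enorm (y - x) < D.
    rewrite (le_lt_trans (enorm_triangle (x + a *: xi) _ _))//.
    rewrite [X in _ + enorm X]addrC addKr enormZ ger0_norm// -/N.
    by have := ler_wpM2r N0 ah; lra.
  have sx : `|s - t| < D.
    have -> : s - t = (s - (t + a * 1)) + a by ring.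
    rewrite (le_lt_trans (ler_normD _ _))// (ger0_norm a0).
    by have := mulr_ge0 (ltW h0) N0; lra.
  have [qL qG] := supG _ _ _ _ (lt_le_trans yx Dd1) (lt_le_trans sx Dd1) qq.
  have := cG _ _ _ (lt_le_trans yx Dd2) (lt_le_trans sx Dd2) qL.
  rewrite ler_norml => /andP[c1 c2]; have := hxi q.
  by rewrite dotvBr (dotvC xi q); lra.
have hr : h * N < r /\ h < r.
  by split; have := mulr_ge0 (ltW h0) N0; lra.
have := sub (x + h *: xi) (t + h * 1).
have -> : x + h *: xi - x = h *: xi by rewrite addrC addKr.
have -> : t + h * 1 - t = h by ring.
rewrite enormZ gtr0_norm// -/N dotvZr => /(_ hr.1 hr.2) s1.
have : h * (sigma + G x t p - e / 2) <= h * (h * (k * (N ^+ 2 + 1))).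
  by rewrite (dotvC xi p) in inc; lra.
by rewrite ler_pM2l//; lra.
Qed.

(** The mirror image of [prox_sup_to_sub]: slopes are preserved, so the inequality keeps its sign
    while sub- and supergradients are exchanged. *)
Lemma prox_sub_to_sup f (G : V -> R -> V -> R) x t p (sigma L M : R) :
  continuous (fun z : V * R => f z.1 z.2) -> 0 <= M ->
  (forall q q', `|G x t q - G x t q'| <= M * enorm (q - q')) ->
  (forall q q' l, 0 <= l <= 1 ->
     G x t ((1 - l) *: q + l *: q') <= (1 - l) * G x t q + l * G x t q') ->
  (forall e, 0 < e -> exists2 d, 0 < d & forall y s q, enorm (y - x) < d ->
     `|s - t| < d -> enorm q <= L -> `|G y s q - G x t q| <= e) ->
  (exists2 d, 0 < d & forall y s q tau, enorm (y - x) < d -> `|s - t| < d ->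
     prox_sub f y s q tau -> enorm q <= L /\ tau + G y s q <= 0) ->
  prox_sup f x t p sigma -> sigma + G x t p <= 0.
Proof.
move=> cf M0 lipG convG contG [d d0 subG] sup.
pose G' y s q := G (- y) (- s) q.
have e1 y : - y - x = - (y - - x) by rewrite opprD opprK.
have e2 s : - s - t = - (s - - t) by rewrite opprD opprK.
have := @prox_sup_to_sub (mirror f) G' (- x) (- t) p sigma L M.
rewrite /G' !opprK; apply=> //; first exact: mirror_continuous.
- move=> e /contG[d' d'0 h]; exists d' => // y s q y1 s1; apply: h.
    by rewrite -opprD enormN.
  by rewrite -opprD normrN.
- exists d => // y s q tau y1 s1 /prox_sup_mirror; apply: subG.
    by rewrite -opprD enormN.
  by rewrite -opprD normrN.
rewrite -[f]mirrorK in sup.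
have [k [r [k0 r0 h]]] := sup; exists k, r; split=> // y s y1 s1.
have := h (- y) (- s); rewrite e1 e2 enormN normrN => /(_ y1 s1).
by rewrite /mirror !opprK dotvNr sqrrN mulrN; lra.
Qed.

End MeanValue.

(** * Jets of the penalization terms *)

Section ProxCalculus.
Context {R : realType} {n : nat}.
Local Notation V := 'rV[R]_n.
Implicit Types (f : V -> R -> R) (x y p q : V) (s t : R).

Lemma qdiff_sqr (c s t : R) : qdiff (fun r => c * (r - s) ^+ 2) t (2 * c * (t - s)).
Proof.
exists `|c|, 1; split=> // r _.
have -> : c * (r - s) ^+ 2 - c * (t - s) ^+ 2 - 2 * c * (t - s) * (r - t)
  = c * (r - t) ^+ 2 by ring.
by rewrite normrM [`|_ ^+ 2|]ger0_norm ?sqr_ge0.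
Qed.

(** Serves for the barrier at the second point [z] of the doubling, which depends on the time [t]
    but not on [x]. *)
Lemma prox_sup_slice f x z t p (tau : R) : prox_sup f z t p tau ->
  prox_sup (fun _ s => f z s) x t 0 tau.
Proof.
move=> [k [r [k0 r0 h]]]; exists k, r; split=> // y s y1 s1.
have := h z s; rewrite subrr enorm0 dotv0r dotv0l expr0n/= => /(_ r0 s1).
by have := mulr_ge0 k0 (sqr_ge0 (enorm (y - x))); lra.
Qed.

Lemma prox_sup_opp f x t p (tau : R) :
  prox_sup (fun y s => - f y s) x t p tau -> prox_sub f x t (- p) (- tau).
Proof.
move=> [k [r [k0 r0 h]]]; exists k, r; split=> // y s y1 s1.
by have := h y s y1 s1; rewrite dotvNl; lra.
Qed.

Lemma prox_sup_pos (N t0 : R) x t : 0 <= N ->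
  prox_sup (fun _ s => N * Num.max 0 (s - t0) ^+ 2) x t 0
    (2 * N * Num.max 0 (t - t0)).
Proof.
move=> N0; exists N, 1; split=> // y s _ _; rewrite dotv0l addr0.
suff h : Num.max 0 (s - t0) ^+ 2 <= Num.max 0 (t - t0) ^+ 2 +
    2 * Num.max 0 (t - t0) * (s - t) + (s - t) ^+ 2.
  have := ler_wpM2l N0 h; have := mulr_ge0 N0 (sqr_ge0 (enorm (y - x))); lra.
have [t1|t1] := leP (t - t0) 0; have [s1|s1] := leP (s - t0) 0;
  rewrite ?expr0n ?mulr0 ?mul0r ?add0r /=.
- exact: sqr_ge0.
- nra.
- by have := sqr_ge0 (s - t0); nra.
- by nra.
Qed.

Lemma enorm_normalize_le (c : R) x : 0 <= c -> enorm ((c / enorm x) *: x) <= c.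
Proof.
move=> c0; rewrite enormZ ger0_norm ?divr_ge0 ?enorm_ge0//.
have [->|x0] := eqVneq (enorm x) 0; first by rewrite mulr0.
by rewrite divfK.
Qed.

End ProxCalculus.

(** * Comparison in a cone *)

Section Doubling.
Context {R : realType} {n : nat}.
Local Notation V := 'rV[R]_n.

(** The conditions are imposed at all real times, because the theorem applies them to [H] with its
    time argument clamped to [[0, T]]. *)
Record hamiltonian (H : V -> R -> R -> V -> R) (C1 beta A2 B2 K3 : R) : Prop :=
 Hamiltonian {
  ham_cont : continuous (fun z : V * R * (R * V) => H z.1.1 z.1.2 z.2.1 z.2.2);
  ham_C1 : 0 <= C1;
  ham_beta : 0 <= beta;
  ham_x : forall x y t r p,
    `|H x t r p - H y t r p| <= C1 * (beta + enorm p) * enorm (x - y);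
  ham_A2 : 0 <= A2;
  ham_B2 : 0 <= B2;
  ham_p : forall x t r p q,
    `|H x t r p - H x t r q| <= (A2 * enorm x + B2) * enorm (p - q);
  ham_K3 : 0 <= K3;
  ham_u : forall x t r v p, `|H x t r p - H x t v p| <= K3 * `|r - v|;
  ham_convex : forall x t r p q l, 0 <= l <= 1 ->
    H x t r ((1 - l) *: p + l *: q) <= (1 - l) * H x t r p + l * H x t r q }.

Definition subsolution (T : R) (H : V -> R -> R -> V -> R) (f : V -> R -> R) :=
  forall x t p tau, 0 < t < T -> prox_sup f x t p tau ->
    tau + H x t (f x t) p <= 0.

Definition supersolution (T : R) (H : V -> R -> R -> V -> R) (f : V -> R -> R) :=
  forall x t p tau, 0 < t < T -> prox_sub f x t p tau ->
    0 <= tau + H x t (f x t) p.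

(* The lateral boundary [|x - x0| = rho t] recedes faster than the maximal
   speed of propagation; [d] leaves room for the penalization. *)
Record cone (T A2 B2 K3 d : R) (x0 : V) (rho rho' : R -> R) : Prop := Cone {
  cone_gt0 : 0 < d;
  cone_cont : continuous rho;
  cone_ge0 : forall t, 0 <= t < T -> 0 <= rho t;
  cone_le0 : forall t, 0 <= t < T -> rho t <= rho 0;
  cone_diff : forall t, 0 < t < T -> qdiff rho t (rho' t);
  cone_speed : forall t, 0 < t < T ->
    A2 * (enorm x0 + rho t + d) + B2 + K3 * d <= - rho' t }.

(** [mod_ineq] says that [a t l^2 + b t] grows fast enough for two solutions at points at distance
    [l]: the doubled slope has norm [2 a t l], so (H1) costs [C1 (beta + 2 a t l) l], and (H3) costs
    [K3] times the modulus. *)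
Record modulus (T C1 beta K3 : R) (a b a' b' : R -> R) : Prop := Modulus {
  mod_a : continuous a;
  mod_b : continuous b;
  mod_a0 : 0 <= a 0;
  mod_b0 : 0 <= b 0;
  mod_ale : forall t, 0 <= t < T -> a 0 <= a t;
  mod_ble : forall t, 0 <= t < T -> b 0 <= b t;
  mod_adiff : forall t, 0 < t < T -> qdiff a t (a' t);
  mod_bdiff : forall t, 0 < t < T -> qdiff b t (b' t);
  mod_ineq : forall t l, 0 < t < T -> 0 <= l ->
    C1 * (beta + 2 * a t * l) * l + K3 * (a t * l ^+ 2 + b t)
      <= a' t * l ^+ 2 + b' t }.

(* Maximize [exp(-(K3 + 1) t) (f x t - g z s - a t |x - z|^2 - b t - B)], where [B]
   collects the barriers at the boundary of the cone, for both [x] and [z] at time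
   [t], a barrier beyond [t0], and [kap (t - s)^2].  The exponential absorbs the
   dependence of [H] on the unknown.  With [a], [b] fixed and [kap] large, the
   slopes stay bounded, so continuity of [H] in time suffices. *)
Lemma doubling (H : V -> R -> R -> V -> R) (C1 beta A2 B2 K3 T t0 d : R)
    (f g : V -> R -> R) (x0 : V) (rho rho' a b a' b' : R -> R) :
  hamiltonian H C1 beta A2 B2 K3 ->
  cone T A2 B2 K3 d x0 rho rho' ->
  modulus T C1 beta K3 a b a' b' ->
  continuous (fun z : V * R => f z.1 z.2) ->
  continuous (fun z : V * R => g z.1 z.2) ->
  subsolution T H f -> supersolution T H g ->
  (forall x z, enorm (x - x0) <= rho 0 + d -> enorm (z - x0) <= rho 0 + d ->
     f x 0 - g z 0 <= a 0 * enorm (x - z) ^+ 2 + b 0) ->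
  0 < t0 < T ->
  forall x z, enorm (x - x0) <= rho t0 -> enorm (z - x0) <= rho t0 ->
     f x t0 - g z t0 <= a t0 * enorm (x - z) ^+ 2 + b t0.
Proof.
move=> [cH C10 beta0 Hx A20 B20 Hp K30 Hu _] [d0 crho rho0 rhole drho speed].
move=> [ca cb a00 b00 ale ble da db ineq] cf cg subf supg base.
move=> /andP[t00 t0T] x1 z1 x1r z1r; rewrite leNgt; apply/negP => viol.
(* The rate [K3] compensates (H3); the additional 1 leaves a term [X >= E0] that nothing
   balances. *)
pose k := K3 + 1; have k0 : 0 < k by rewrite ltr_wpDl.
pose E0 := expR (- k * t0) *
  (f x1 t0 - g z1 t0 - (a t0 * enorm (x1 - z1) ^+ 2 + b t0)).
have E00 : 0 < E0 by rewrite mulr_gt0 ?expR_gt0// subr_gt0.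
(* The factor 3 keeps [t2 = t0 + 2 h] below [T]; [h k <= 1] lets the slope [2 N mT] of the barrier
   beyond [t0] dominate [K3 Bt]. *)
pose h := Num.min ((T - t0) / 3) (1 / k).
have h0 : 0 < h by rewrite lt_min !divr_gt0// subr_gt0.
have hT : h * 3 <= T - t0 by rewrite -ler_pdivlMr// /h ge_min lexx.
have hk : h * k <= 1 by rewrite -ler_pdivlMr// /h ge_min lexx orbT.
clearbody h.
pose t2 := t0 + 2 * h.
have t2T : t2 < T by rewrite /t2; clear -hT h0; lra.
have t20 : 0 < t2 by rewrite /t2; clear -t00 h0; lra.
pose Rm := rho 0 + d.
have rho00 : 0 <= rho 0 by apply: rho0; rewrite lexx (lt_trans t00).
have Rm0 : 0 < Rm by rewrite ltr_wpDl.
pose Ball := eball x0 Rm.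
have cBall : compact Ball by exact: eball_compact.
have Ball0 : Ball x0 by rewrite /Ball /eball /= subrr enorm0 ltW.
pose I : set R := `[0, t2].
have cI : compact I by exact: segment_compact.
have IP t : 0 <= t <= t2 -> I t by move=> th; rewrite /I /= in_itv.
have I0 : I 0 by apply: IP; rewrite lexx ltW.
pose K := (Ball `*` Ball) `*` (I `*` I).
have cK : compact K by do !apply: compact_setX.
have [m [[_ _] [_ _]] fgmax] := continuous_max_attained _
  (fun z : (V * V) * (R * R) => f z.1.1 z.2.1 - g z.1.2 z.2.2) K
  (ex_intro _ ((x0, x0), (0, 0)) (conj (conj Ball0 Ball0) (conj I0 I0))) cK
  ltac:(by cont).
pose M := `|f m.1.1 m.2.1 - g m.1.2 m.2.2| + 1.
have M0 : 0 < M by rewrite ltr_wpDl.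
have fgM x z t s : Ball x -> Ball z -> I t -> I s -> f x t - g z s <= M.
  move=> Bx Bz It Is; have := fgmax ((x, z), (t, s)) (conj (conj Bx Bz) (conj It Is)).
  move=> /= /le_trans -> //; rewrite /M (le_trans (ler_norm _))// lerDl//.
clear fgmax.
have [mg [_ _] gmax] := continuous_max_attained _
  (fun z : V * R => `|g z.1 z.2|) (Ball `*` I)
  (ex_intro _ (x0, 0) (conj Ball0 I0)) (compact_setX cBall cI)
  ltac:(by move=> z; apply: (continuous_comp (cg z)); exact: norm_continuous).
pose Mg := `|g mg.1 mg.2|.
have [ma _ amax] := continuous_max_attained _ a I (ex_intro _ 0 I0) cI ca.
pose Am := a ma.
have Am0 : 0 <= Am by apply: (le_trans a00); exact: amax.
pose P := 2 * Am * (2 * Rm).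
(* The final error is [w] from the time variation of [H] and [K3 w] from the penalty in [t - s],
   together [E0 / 4]. *)
pose w := E0 / (4 * k).
have w0 : 0 < w by rewrite divr_gt0// mulr_gt0.
have wk : w * k = E0 / 4 by rewrite /w; field; rewrite gt_eqF.
have wE : w <= E0 / 4.
  by rewrite -wk ler_peMr ?(ltW w0)// /k lerDr.
have equi (G : V -> R -> R) : continuous (fun z : V * R => G z.1 z.2) ->
    exists2 e, 0 < e & forall z t s, Ball z -> I t -> `|s - t| < e ->
      `|G z s - G z t| < w.
  move=> cG.
  have := compact_near_uniform _ _ (fun (tau : R) (z : V * R) => G z.1 (z.2 + tau))
    (Ball `*` I) (0 : R) w (compact_setX cBall cI) ltac:(by cont) w0.
  move=> /nbhs_ballP[e e0 eP]; exists e => // z t s Bz It st.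
  have := eP (s - t); rewrite -ball_normE /= sub0r normrN => /(_ st (z, t)).
  by rewrite /= addr0 (addrC t) subrK; exact.
have [e1 e10 fe] := equi f cf.
have [e2 e20 ge] := equi g cg.
have [e3 e30 He] : exists2 e, 0 < e & forall z t s r p, Ball z -> I t ->
    `|r| <= Mg -> enorm p <= P -> `|s - t| < e -> `|H z s r p - H z t r p| < w.
  have cKH : compact ((Ball `*` I) `*` ((`[- Mg, Mg] : set R) `*` eball (0 : V) P)).
    do !apply: compact_setX => //; first exact: segment_compact.
    exact: eball_compact.
  have := compact_near_uniform _ _
    (fun (tau : R) (z : (V * R) * (R * V)) => H z.1.1 (z.1.2 + tau) z.2.1 z.2.2)
    _ (0 : R) w cKH _ w0.
  move=> /(_ _)/wrap[|].
    apply: (continuous_compf _ _ _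
      (fun z : R * ((V * R) * (R * V)) =>
         ((z.2.1.1, z.2.1.2 + z.1), (z.2.2.1, z.2.2.2))) _ _ cH).
    by cont.
  move=> /nbhs_ballP[e e0 eP]; exists e => // z t s r p Bz It rM pP st.
  have := eP (s - t); rewrite -ball_normE /= sub0r normrN => /(_ st).
  move=> /(_ ((z, t), (r, p))); rewrite /= addr0 (addrC t) subrK; apply.
  split=> //=; split; first by rewrite /= in_itv/= -ler_norml.
  by rewrite /eball /= subr0.
pose e := Num.min (Num.min e1 e2) (Num.min e3 h).
have e0 : 0 < e.
  by rewrite lt_min; apply/andP; split; rewrite lt_min ?e10 ?e20 ?e30 ?h0.
have [ee1 ee2 ee3 eh] : [/\ e <= e1, e <= e2, e <= e3 & e <= h].
  by rewrite /e; split; rewrite !ge_min lexx ?orbT.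
(* With [M] an upper bound of [f - g], the barriers reach [M] at distance [d] outside the cone and
   at time [t0 + h], and [kap] makes the penalty reach [M] at [|t - s| = e]. A positive maximum
   therefore lies inside all these limits. *)
pose N := M / d ^+ 2 + M / h ^+ 2.
have Nd : M <= N * d ^+ 2.
  by rewrite mulrDl divfK ?gt_eqF ?exprn_gt0// lerDl mulr_ge0 ?divr_ge0 ?sqr_ge0 ?ltW.
have Nh : M <= N * h ^+ 2.
  rewrite mulrDl [X in _ + X]divfK ?gt_eqF ?exprn_gt0// lerDr.
  by rewrite mulr_ge0 ?divr_ge0 ?sqr_ge0 ?ltW.
have N0 : 0 <= N by rewrite addr_ge0 ?divr_ge0 ?sqr_ge0 ?ltW.
pose kap := M / e ^+ 2.
have kape : kap * e ^+ 2 = M by rewrite divfK// gt_eqF// exprn_gt0.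
have kap0 : 0 < kap by rewrite divr_gt0// exprn_gt0.
pose B x t := N * Num.max 0 (enorm (x - x0) - rho t) ^+ 2.
pose Bt t := N * Num.max 0 (t - t0) ^+ 2.
have B0 x t : 0 <= B x t by rewrite mulr_ge0 ?sqr_ge0.
have Bt0 t : 0 <= Bt t by rewrite mulr_ge0 ?sqr_ge0.
pose Psi x z t s := expR (- k * t) * (f x t - g z s -
  (a t * enorm (x - z) ^+ 2 + b t + B x t + B z t + Bt t + kap * (t - s) ^+ 2)).
have [[[x z] [t s]] [/= [Bx Bz] [It Is]] hmax] := continuous_max_attained _
  (fun z : (V * V) * (R * R) => Psi z.1.1 z.1.2 z.2.1 z.2.2) K
  (ex_intro _ ((x0, x0), (0, 0)) (conj (conj Ball0 Ball0) (conj I0 I0))) cK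
  ltac:(by rewrite /Psi /B /Bt; cont).
have {}hmax x' z' t' s' : Ball x' -> Ball z' -> I t' -> I s' ->
    Psi x' z' t' s' <= Psi x z t s.
  by move=> *; exact: (hmax ((_, _), (_, _))).
set E := Psi x z t s in hmax.
have EE0 : E0 <= E.
  have rt0 : rho t0 <= Rm.
    by rewrite (le_trans (rhole _ _)) ?(ltW t00)// /Rm lerDl ltW.
  have It0 : I t0 by apply: IP; rewrite (ltW t00)/= /t2; clear -h0; lra.
  have := hmax x1 z1 t0 t0 (le_trans x1r rt0) (le_trans z1r rt0) It0 It0.
  rewrite /Psi /B /Bt !subrr maxxx !max_l ?subr_le0//.
  by rewrite expr0n /= !mulr0 !addr0.
have E_gt0 : 0 < E by exact: lt_le_trans EE0.
move: (It) (Is); rewrite /I /= !in_itv/= => /andP[t_ge0 tt2] /andP[s_ge0 st2].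
have tT : 0 <= t < T by rewrite t_ge0 (le_lt_trans tt2).
have at0 : 0 <= a t := le_trans a00 (ale t tT).
have bt0 : 0 <= b t := le_trans b00 (ble t tT).
pose X := f x t - g z s -
  (a t * enorm (x - z) ^+ 2 + b t + B x t + B z t + Bt t + kap * (t - s) ^+ 2).
have XE : X = E * expR (k * t).
  by rewrite /E /Psi -/X mulrAC -expRD mulNr addNr expR0 mul1r.
have XE0 : E0 <= X.
  rewrite XE (le_trans EE0)// ler_peMr ?(ltW E_gt0)//.
  by rewrite -expR0 ler_expR mulr_ge0// ltW.
have X0 : 0 < X := lt_le_trans E00 XE0.
have fgE : f x t - g z s = X + a t * enorm (x - z) ^+ 2 + b t + B x t + B z t
   + Bt t + kap * (t - s) ^+ 2 by rewrite /X; ring.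
have aq0 : 0 <= a t * enorm (x - z) ^+ 2 by rewrite mulr_ge0 ?sqr_ge0.
have kq0 : 0 <= kap * (t - s) ^+ 2 by rewrite mulr_ge0 ?sqr_ge0 ?ltW.
have fgMs := fgM x z t s Bx Bz It Is.
have BM y : B y t < M -> enorm (y - x0) - rho t < d.
  move=> BM; rewrite ltNge; apply/negP => dy; move: BM; apply/negP.
  rewrite -leNgt (le_trans Nd)// /B ler_wpM2l// ler_pXn2r ?nnegrE ?maxr0_ge0 ?(ltW d0)//.
  by rewrite le_max dy orbT.
have mx : enorm (x - x0) - rho t < d.
  apply: BM; have := B0 z t; have := Bt0 t; clear -fgE aq0 kq0 fgMs X0 bt0; lra.
have mz : enorm (z - x0) - rho t < d.
  apply: BM; have := B0 x t; have := Bt0 t; clear -fgE aq0 kq0 fgMs X0 bt0; lra.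
have th : t - t0 < h.
  rewrite ltNge; apply/negP => dy.
  have : M <= Bt t.
    rewrite (le_trans Nh)// /Bt ler_wpM2l// ler_pXn2r ?nnegrE ?maxr0_ge0 ?(ltW h0)//.
    by rewrite le_max dy orbT.
  have := B0 x t; have := B0 z t; clear -fgE aq0 kq0 fgMs X0 bt0; lra.
have tse : `|t - s| < e.
  rewrite -(@ltr_pXn2r _ 2)// ?nnegrE ?(ltW e0)// real_normK ?num_real//.
  rewrite -(ltr_pM2l kap0) kape.
  have := B0 x t; have := B0 z t; have := Bt0 t.
  clear -fgE aq0 fgMs X0 bt0; lra.
clear BM fgMs.
have s_t2 : s < t2.
  move: (lt_le_trans tse eh) th; rewrite /t2 ltr_norml => /andP[h1 _].
  clear -h1; lra.
have t_t2 : t < t2 by rewrite /t2; clear -th h0; lra.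
(* If one time is 0, the other is below [e], so moving both to 0 changes [f - g] by less than
   [2 w <= E0 / 2], and the initial inequality contradicts [X >= E0]. *)
have [t_gt0 s_gt0] : 0 < t /\ 0 < s.
  suff : ~ (t = 0 \/ s = 0).
    move=> ts0; split; rewrite lt_neqAle eq_sym.
      by rewrite t_ge0 andbT; apply/eqP => ?; apply: ts0; left.
    by rewrite s_ge0 andbT; apply/eqP => ?; apply: ts0; right.
  move=> ts0.
  have [te se] : `|t - 0| < e /\ `|s - 0| < e.
    rewrite !subr0 !ger0_norm//; case: ts0 tse => ->.
      by rewrite sub0r normrN ger0_norm.
    by rewrite subr0 ger0_norm.
  have := fe x 0 t Bx I0 (lt_le_trans te ee1).
  have := ge z 0 s Bz I0 (lt_le_trans se ee2).
  rewrite !ltr_norml => /andP[h1 _] /andP[_ h2].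
  have := base x z Bx Bz; have := B0 x t; have := B0 z t; have := Bt0 t.
  have := ler_wpM2r (sqr_ge0 (enorm (x - z))) (ale t tT).
  have := ble t tT.
  clear -fgE XE0 h1 h2 kq0 wE E00; lra.
have tT' : 0 < t < T by rewrite t_gt0 (lt_trans t_t2).
have sT' : 0 < s < T by rewrite s_gt0 (lt_trans s_t2).
pose mX := Num.max 0 (enorm (x - x0) - rho t).
pose mZ := Num.max 0 (enorm (z - x0) - rho t).
pose mT := Num.max 0 (t - t0).
have rRm : rho t <= rho 0 := rhole t tT.
have inBall y (r : R) : enorm (y - x0) - rho t < d ->
    exists2 e' : R, 0 < e' & forall y', enorm (y' - y) < e' -> Ball y'.
  move=> yd; exists (d - (enorm (y - x0) - rho t)); first by rewrite subr_gt0.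
  move=> y' y'y; rewrite /Ball /eball /= (le_trans (enorm_triangle y _ _))//.
  by rewrite /Rm; clear -y'y rRm; lra.
have inI (r : R) : 0 < r < t2 -> exists2 e' : R, 0 < e' & forall r', `|r' - r| < e' -> I r'.
  move=> /andP[r0 rt2]; exists (Num.min r (t2 - r)).
    by rewrite lt_min r0 subr_gt0.
  move=> r'; rewrite lt_min => /andP[h1 h2]; apply: IP.
  move: h1 h2; rewrite !ltr_norml => /andP[h1 _] /andP[_ h2].
  by clear -h1 h2; apply/andP; split; lra.
(* With [z] and [s] frozen, [Psi <= E] multiplied by [exp(k t)] bounds [f] by the penalties plus
   [E exp(k t)], whose time derivative at the maximum is [k X]. *)
have supF : prox_sup f x t
   ((2 * a t) *: (x - z) + (2 * N * mX / enorm (x - x0)) *: (x - x0))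
   (a' t * enorm (x - z) ^+ 2 + b' t + 2 * N * mX * - rho' t
     + 2 * N * mZ * - rho' t + 2 * N * mT + 2 * kap * (t - s) + k * X).
  have [r1 r10 hr1] := inBall x 0 mx.
  have [r2 r20 hr2] := inI t ltac:(by rewrite t_gt0).
  have r120 : 0 < Num.min r1 r2 by rewrite lt_min r10.
  have rt := rho0 t tT.
  have q1 := prox_sup_quad a x t (a' t) z (da t tT').
  have q2 := prox_sup_time b x t _ (db t tT').
  have q3 := prox_sup_barrier N rho x0 x t _ N0 rt (drho t tT').
  have q4 := prox_sup_slice _ x z t _ _
     (prox_sup_barrier N rho x0 z t _ N0 rt (drho t tT')).
  have q5 := prox_sup_pos N t0 x t N0.
  have q6 := prox_sup_time _ x t _ (qdiff_sqr kap s t).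
  have q7 := prox_sup_time _ x t _ (qdiffZ _ E t _ (qdiff_exp k t)).
  have qq := prox_supD _ _ _ _ _ _ _ _ (prox_supD _ _ _ _ _ _ _ _
    (prox_supD _ _ _ _ _ _ _ _ (prox_supD _ _ _ _ _ _ _ _
    (prox_supD _ _ _ _ _ _ _ _ (prox_supD _ _ _ _ _ _ _ _
      q1 q2) q3) q4) q5) q6) q7.
  rewrite !addr0 -/mX -/mZ -/mT in qq.
  have <- : E * (k * expR (k * t)) = k * X by rewrite XE mulrCA.
  apply: prox_sup_dom r120 _ qq => y r; rewrite !lt_min => /andP[/hr1 y1 _].
  move=> /andP[_ /hr2 r1'].
  have := hmax y z r s y1 Bz r1' Is.
  have -> : (Psi y z r s <= E) = (f y r - g z s -
  (a r * enorm (y - z) ^+ 2 + b r + B y r + B z r + Bt r + kap * (r - s) ^+ 2)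
     <= E * expR (k * r)).
    by rewrite -(ler_pM2r (expR_gt0 (k * r))) /Psi mulrAC -expRD mulNr addNr expR0 mul1r.
  have := XE; rewrite /X /B /Bt; clear; lra.
have subG : prox_sub g z s
   ((2 * a t) *: (x - z) - (2 * N * mZ / enorm (z - x0)) *: (z - x0))
   (2 * kap * (t - s)).
  have [r1 r10 hr1] := inBall z 0 mz.
  have [r2 r20 hr2] := inI s ltac:(by rewrite s_gt0).
  have r120 : 0 < Num.min r1 r2 by rewrite lt_min r10.
  have rt := rho0 t tT.
  have q1 := prox_sup_quad (fun=> a t) z s 0 x (qdiff_cst _ _).
  have q3 := prox_sup_barrier N (fun=> rho t) x0 z s _ N0 rt (qdiff_cst _ _).
  have q6 := prox_sup_time _ z s _ (qdiff_sqr kap t s).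
  have qq := prox_supD _ _ _ _ _ _ _ _ (prox_supD _ _ _ _ _ _ _ _ q1 q3) q6.
  rewrite !(addr0, mul0r, oppr0, mulr0, add0r) -/mZ in qq.
  have -> : (2 * a t) *: (x - z) - (2 * N * mZ / enorm (z - x0)) *: (z - x0) =
    - ((2 * a t) *: (z - x) + (2 * N * mZ / enorm (z - x0)) *: (z - x0)).
    by rewrite -(opprB z x) scalerN opprD.
  have -> : 2 * kap * (t - s) = - (2 * kap * (s - t)) by ring.
  apply: prox_sup_opp; apply: prox_sup_dom r120 _ qq => y r; rewrite !lt_min.
  move=> /andP[/hr1 y1 _] /andP[_ /hr2 r1'].
  have := hmax x y t r Bx y1 It r1'.
  rewrite {1}/Psi /E /Psi ler_pM2l ?expR_gt0//.
  rewrite /B (enormB x y) (enormB x z).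
  have -> : (t - r) ^+ 2 = (r - t) ^+ 2 by ring.
  have -> : (t - s) ^+ 2 = (s - t) ^+ 2 by ring.
  by clear; lra.
clear inBall inI.
(* Moving [s] to [t] can only lower [Psi], so the penalty is bounded by the oscillation of [g], much
   better than by [M]. *)
have kapw : kap * (t - s) ^+ 2 <= w.
  have := hmax x z t t Bx Bz It It.
  rewrite /E /Psi ler_pM2l ?expR_gt0// subrr expr0n mulr0.
  have := ge z t s Bz It; rewrite distrC => /(_ (lt_le_trans tse ee2)).
  rewrite ltr_norml => /andP[h1 _]; clear -h1; lra.
clear hmax.
have := subf _ _ _ _ tT' supF; have := supg _ _ _ _ sT' subG.
pose p := (2 * a t) *: (x - z); rewrite -/p.
set pF := p + _ *: (x - x0); set pG := p - _ *: (z - x0).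
move=> hG hF.
have mX0 : 0 <= mX := maxr0_ge0 _.
have mZ0 : 0 <= mZ := maxr0_ge0 _.
have mT0 : 0 <= mT := maxr0_ge0 _.
have spd := speed t tT'.
(* The recession of the boundary pays for the barrier: its slope [2 N mu] costs [A2 |y| + B2] times
   itself by (H2), and [K3 N mu^2 <= 2 N mu (K3 d)] since [mu <= d]. *)
have drift (y : V) (mu : R) (q : V) : mu = Num.max 0 (enorm (y - x0) - rho t) ->
    enorm (y - x0) - rho t < d -> enorm q <= 2 * N * mu ->
    (A2 * enorm y + B2) * enorm q + K3 * (N * mu ^+ 2) <= 2 * N * mu * - rho' t.
  move=> muE yd qN.
  have mu0 : 0 <= mu by rewrite muE maxr0_ge0.
  have mud : mu <= d by rewrite muE ge_max (ltW d0) ltW.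
  have yle : enorm y <= enorm x0 + rho t + d.
    have := enorm_triangle x0 y 0; rewrite !subr0; clear -yd; lra.
  have Nm : 0 <= 2 * N * mu by rewrite !mulr_ge0.
  have c0 : 0 <= A2 * enorm y + B2 by rewrite addr_ge0 ?mulr_ge0 ?enorm_ge0.
  have s1 := ler_wpM2l c0 qN.
  have s2 : K3 * (N * mu ^+ 2) <= (2 * N * mu) * (K3 * d).
    have s3 : K3 * N * mu * mu <= K3 * N * mu * d by rewrite ler_wpM2l ?mulr_ge0.
    have s4 : 0 <= K3 * N * mu * d by rewrite !mulr_ge0// ltW.
    clear -s3 s4; lra.
  have s3 : (A2 * enorm y + B2) * (2 * N * mu) <=
            (A2 * (enorm x0 + rho t + d) + B2) * (2 * N * mu).
    by rewrite ler_wpM2r// lerD2r ler_wpM2l.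
  have s4 := ler_wpM2l Nm spd.
  by clear -s1 s2 s3 s4; lra.
have NmX : 0 <= 2 * N * mX by rewrite !mulr_ge0.
have NmZ : 0 <= 2 * N * mZ by rewrite !mulr_ge0.
have dX := drift x mX _ erefl mx (enorm_normalize_le _ (x - x0) NmX).
have dZ := drift z mZ _ erefl mz (enorm_normalize_le _ (z - x0) NmZ).
have hpX := Hp x t (f x t) p pF; have hpZ := Hp z s (g z s) pG p.
have eX : enorm (p - pF) = enorm ((2 * N * mX / enorm (x - x0)) *: (x - x0)).
  by rewrite /pF opprD addrA subrr sub0r enormN.
have eZ : enorm (pG - p) = enorm ((2 * N * mZ / enorm (z - x0)) *: (z - x0)).
  by rewrite /pG addrAC subrr sub0r enormN.
rewrite eX in hpX; rewrite eZ in hpZ.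
set lam := enorm (x - z) in aq0 fgE hF *.
have lam0 : 0 <= lam := enorm_ge0 _.
have pE : enorm p = 2 * a t * lam by rewrite /p enormZ ger0_norm ?mulr_ge0.
have lamR : lam <= 2 * Rm.
  rewrite /lam (le_trans (enorm_triangle x0 _ _))//.
  move: Bx Bz; rewrite /Ball /eball /= (enormB x0 z); clear; lra.
have pP : enorm p <= P.
  have aA : a t <= Am by exact: amax.
  rewrite pE /P -!mulrA ler_wpM2l// ler_pM//.
have gMg : `|g z s| <= Mg by exact: (gmax (z, s) (conj Bz Is)).
have := He z t s (g z s) p Bz It gMg pP; rewrite distrC.
move=> /(_ (lt_le_trans tse ee3)) hHt.
have hHx := Hx z x t (g z s) p; rewrite enormB -/lam pE in hHx.
have hHu := Hu x t (g z s) (f x t) p.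
have fg0 : 0 <= f x t - g z s.
  rewrite fgE; have := B0 x t; have := B0 z t; have := Bt0 t.
  clear -aq0 kq0 X0 bt0; lra.
rewrite distrC [X in _ * X]distrC (ger0_norm fg0) fgE in hHu.
have hin := ineq t lam tT' lam0.
have hTm : K3 * Bt t <= 2 * N * mT.
  have mTh : mT <= h by rewrite /mT ge_max (ltW h0) ltW.
  have Km : K3 * mT <= 1.
    rewrite (le_trans _ hk)// mulrC ler_pM// /k lerDl//.
  have := ler_wpM2l (mulr_ge0 N0 mT0) Km; have := mulr_ge0 N0 mT0.
  rewrite /Bt -/mT; clear; lra.
have kw := ler_wpM2l K30 kapw.
have wK : w + K3 * w = E0 / 4 by rewrite -wk /k; ring.
move: hHx hHt hHu hpX hpZ; rewrite !ler_norml ltr_norml.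
move=> /andP[_ hHx] /andP[_ hHt] /andP[hHu _] /andP[_ hpX] /andP[_ hpZ].
move: dX dZ hpX hpZ.
set QX := (A2 * enorm x + B2) * _; set QZ := (A2 * enorm z + B2) * _.
have BX : B x t = N * mX ^+ 2 by [].
have BZ : B z t = N * mZ ^+ 2 by [].
rewrite -BX -BZ => dX dZ hpX hpZ.
rewrite /k in hF.
clear -hG hF dX dZ hpX hpZ hHx hHt hHu hin hTm kw wK XE0 E00.
lra.
Qed.

End Doubling.

(** * Lipschitz estimates *)

Section Propagation.
Context {R : realType} {n : nat}.
Local Notation V := 'rV[R]_n.

Lemma enorm_le_slope (x p : V) (L : R) : 0 <= L ->
  (forall e, 0 < e -> exists2 d, 0 < d & forall y, enorm (y - x) < d ->
     dotv p (y - x) <= (L + e) * enorm (y - x)) -> enorm p <= L.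
Proof.
move=> L0 h; apply/ler_addgt0Pr => e e0; have [d d0 hd] := h e e0.
have [p0|p0] := eqVneq (enorm p) 0; first by rewrite p0 addr_ge0// ltW.
have {}p0 : 0 < enorm p by rewrite lt_neqAle eq_sym p0 enorm_ge0.
pose s := d / 2 / enorm p.
have s0 : 0 < s by rewrite !divr_gt0.
have sp : s * enorm p = d / 2 by rewrite divfK// gt_eqF.
have xE : x + s *: p - x = s *: p by rewrite addrC addKr.
have := hd (x + s *: p); rewrite xE enormZ gtr0_norm// dotvZr -enorm_sqr.
have d2 : d / 2 < d by lra.
rewrite sp => /(_ d2); rewrite -sp.
have -> : s * enorm p ^+ 2 = enorm p * (s * enorm p) by ring.
by rewrite ler_pM2r// mulr_gt0.
Qed.

Lemma prox_sup_le_lip (f : V -> R -> R) x t p (tau L d : R) : 0 <= L -> 0 < d ->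
  (forall y, enorm (y - x) < d -> f x t - f y t <= L * enorm (y - x)) ->
  prox_sup f x t p tau -> enorm p <= L.
Proof.
move=> L0 d0 lip [k [r [k0 r0 h]]]; rewrite -enormN.
apply: (enorm_le_slope x) => // e e0.
have k1 : 0 < k + 1 by rewrite ltr_wpDl.
exists (Num.min (Num.min d r) (e / (k + 1))); first by rewrite !lt_min d0 r0 divr_gt0.
move=> y; rewrite !lt_min => /andP[/andP[y1 y2]]; rewrite ltr_pdivlMr// => y3.
have := h y t y2; rewrite subrr normr0 => /(_ r0).
have := lip y y1; rewrite dotvNl expr0n/=; move: y3 (enorm_ge0 (y - x)).
set N := enorm _ => y3 N0 l1 l2.
have l3 : k * N ^+ 2 <= e * N by nra.
by lra.
Qed.

Lemma prox_sub_le_lip (f : V -> R -> R) x t p (tau L d : R) : 0 <= L -> 0 < d ->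
  (forall y, enorm (y - x) < d -> f y t - f x t <= L * enorm (y - x)) ->
  prox_sub f x t p tau -> enorm p <= L.
Proof.
move=> L0 d0 lip /prox_sub_mirror; apply: prox_sup_le_lip d0 _ => //.
move=> y; rewrite /mirror !opprK [_ + f _ _]addrC.
have -> : y + x = - (- y - x) by rewrite opprD !opprK.
by rewrite enormN; exact: lip.
Qed.

(** The cone solves [- rho' = A2 (|x0| + rho + d) + B2 + K3 d] exactly, with [rho t0 = d]. Its base
    radius tends to [Rfun] as [d] tends to 0. *)
Lemma cone_exists (A2 B2 K3 : R) (x0 : V) (t0 T eta : R) :
  0 <= A2 -> 0 <= B2 -> 0 <= K3 -> 0 < t0 < T -> 0 < eta ->
  exists T1 d rho rho', [/\ t0 < T1 <= T, cone T1 A2 B2 K3 d x0 rho rho',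
    0 < rho t0 & rho 0 + d <= Rfun A2 B2 x0 t0 + eta].
Proof.
move=> A20 B20 K30 /andP[t00 t0T] eta0; rewrite /Rfun; case: ifPn => [Apos|].
- pose E := expR (A2 * t0).
  have E1 : 1 <= E by rewrite -expR0 ler_expR mulr_ge0// ltW.
  (* The coefficient of [d] in the affine expression [rho 0 + d - Rfun]; it becomes [K3 t0 + 2] when
     [A2 = 0]. *)
  pose Cc := (1 + K3 / A2) * (E - 1) + E + 1.
  have KA : 0 <= K3 / A2 by rewrite divr_ge0.
  have Cc0 : 0 < Cc.
    by rewrite /Cc; have := mulr_ge0 KA (_ : 0 <= E - 1); nra.
  pose d := eta / Cc; have d0 : 0 < d by rewrite divr_gt0.
  pose Q := enorm x0 + d + (B2 + K3 * d) / A2.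
  have Q0 : 0 <= Q.
    have BK : 0 <= (B2 + K3 * d) / A2.
      by rewrite divr_ge0// addr_ge0// mulr_ge0// ltW.
    by rewrite !addr_ge0 ?enorm_ge0// ltW.
  have AQ : A2 * Q = A2 * (enorm x0 + d) + B2 + K3 * d.
    by rewrite /Q; field; rewrite gt_eqF.
  have Qd : 0 < Q + d by rewrite ltr_wpDl.
  have AQd : 0 < A2 * (Q + d) by rewrite mulr_gt0.
  (* At [t0] the radius is [d] and decreases at rate [A2 (Q + d)], more slowly afterwards, so it
     stays nonnegative for a time [d / (A2 (Q + d))] beyond [t0]. *)
  exists (Num.min T (t0 + d / (A2 * (Q + d)))), d,
    (fun t => (Q + d) * E * expR (- A2 * t) + - Q),
    (fun t => (Q + d) * E * (- A2 * expR (- A2 * t)) + 0).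
  have EE : E * expR (- A2 * t0) = 1 by rewrite mulNr expRxMexpNx_1.
  split.
  + by rewrite lt_min t0T ltrDl divr_gt0//= ge_min lexx.
  + split=> //.
    * by cont.
    * move=> t /andP[tge0]; rewrite lt_min => /andP[_ tT].
      rewrite subr_ge0 -mulrA -expRD.
      have := expR_ge1Dx (A2 * t0 + - A2 * t).
      have {}tT : (t - t0) * (A2 * (Q + d)) < d by rewrite -ltr_pdivlMr//; lra.
      by move=> /(ler_wpM2l (ltW Qd)); lra.
    * move=> t /andP[tge0 _]; rewrite lerD2r ler_wpM2l//.
        by rewrite mulr_ge0 ?(ltW Qd)// /E expR_ge0.
      by rewrite mulr0 ler_expR mulNr oppr_le0 mulr_ge0.
    * move=> t _; apply: qdiffD; last exact: qdiff_cst.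
      by apply: qdiffZ; exact: qdiff_exp.
    * move=> t _; rewrite mulrDr mulrDr; lra.
  + by rewrite -mulrA EE; lra.
  + rewrite mulr0 expR0 mulr1 -/E.
    have -> : eta = d * Cc by rewrite divfK// gt_eqF.
    rewrite /Cc /Q le_eqVlt; apply/orP; left; apply/eqP.
    by field; rewrite gt_eqF.
- rewrite -leNgt => A2le; have {A2le A20} -> : A2 = 0 by apply/le_anti/andP.
  pose Cc := K3 * t0 + 2.
  have Cc0 : 0 < Cc by rewrite ltr_wpDl// mulr_ge0// ltW.
  pose d := eta / Cc; have d0 : 0 < d by rewrite divr_gt0.
  pose S := B2 + K3 * d.
  have S0 : 0 <= S by rewrite addr_ge0// mulr_ge0// ltW.
  have S1 : 0 < S + 1 by rewrite ltr_wpDl.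
  exists (Num.min T (t0 + d / (S + 1))), d,
    (fun t => (- S) * t + (d + S * t0)), (fun t => - S + 0).
  split.
  + by rewrite lt_min t0T ltrDl divr_gt0//= ge_min lexx.
  + split=> //.
    * by cont.
    * move=> t /andP[tge0]; rewrite lt_min => /andP[_ tT].
      have {}tT : (t - t0) * (S + 1) < d by rewrite -ltr_pdivlMr//; lra.
      have [tt|tt] := leP t t0; first by have := mulr_ge0 S0 (_ : 0 <= t0 - t); nra.
      by nra.
    * by move=> t /andP[tge0 _]; have := mulr_ge0 S0 tge0; lra.
    * move=> t _; apply: qdiffD; last exact: qdiff_cst.
      exact: qdiff_lin.
    * by move=> t _; rewrite mul0r addr0 opprK /S; lra.
  + by lra.
  + have -> : eta = d * Cc by rewrite divfK// gt_eqF.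
    by rewrite /Cc /S; lra.
Qed.

(* Solution of [L' = (C1 + K3) L + C1 beta] with [L 0 = M]. *)
Definition lip_growth (C1 beta K3 M t : R) :=
  (M + C1 * beta / (C1 + K3)) * expR ((C1 + K3) * t) - C1 * beta / (C1 + K3).

(* If [C1 + K3 = 0] then [C1 = 0] and the quotient is [0 / 0 = 0]. *)
Lemma coef_growth (C1 beta K3 : R) : 0 <= C1 -> 0 <= K3 ->
  C1 * beta / (C1 + K3) * (C1 + K3) = C1 * beta.
Proof.
move=> C10 K30; have [h|h] := eqVneq (C1 + K3) 0; last by rewrite divfK.
have -> : C1 = 0 by lra.
by rewrite !mul0r.
Qed.

Lemma coef_ge0 (C1 beta K3 : R) : 0 <= C1 -> 0 <= beta -> 0 <= K3 ->
  0 <= C1 * beta / (C1 + K3).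
Proof. by move=> *; rewrite divr_ge0 ?mulr_ge0 ?addr_ge0. Qed.

Lemma lip_growth_ge (C1 beta K3 M t : R) : 0 <= C1 -> 0 <= beta -> 0 <= K3 ->
  0 <= M -> 0 <= t -> M <= lip_growth C1 beta K3 M t.
Proof.
move=> C10 beta0 K30 M0 t0; rewrite /lip_growth.
have c0 := coef_ge0 _ _ _ C10 beta0 K30.
have : 1 <= expR ((C1 + K3) * t) by rewrite -expR0 ler_expR !mulr_ge0 ?addr_ge0.
by have := addr_ge0 M0 c0; nra.
Qed.

Lemma lip_growth_le (C1 beta K3 M t s : R) : 0 <= C1 -> 0 <= beta -> 0 <= K3 ->
  0 <= M -> t <= s -> lip_growth C1 beta K3 M t <= lip_growth C1 beta K3 M s.
Proof.
move=> C10 beta0 K30 M0 ts; rewrite /lip_growth lerD2r ler_wpM2l//.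
  by rewrite addr_ge0// coef_ge0.
by rewrite ler_expR ler_wpM2l// addr_ge0.
Qed.

(* [L (l |v|^2 + 1/l) / 2 >= L |v|], with equality for [l = 1 / |v|]; the
   distance of two characteristics contracts at rate [C1]. *)
Lemma lip_modulus (T C1 beta K3 M l0 : R) :
  0 <= C1 -> 0 <= beta -> 0 <= K3 -> 0 <= M -> 0 < l0 ->
  exists a b a' b', modulus T C1 beta K3 a b a' b' /\
    forall t, a t = lip_growth C1 beta K3 M t * (expR (C1 * t) / l0) / 2 /\
              b t = lip_growth C1 beta K3 M t / (expR (C1 * t) / l0) / 2.
Proof.
move=> C10 beta0 K30 M0 l00; set c := C1 * beta / (C1 + K3).
have c0 : 0 <= c by exact: coef_ge0.
have cE : c * (C1 + K3) = C1 * beta by exact: coef_growth.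
have Mc0 : 0 <= M + c by exact: addr_ge0.
exists (fun t => (M + c) / (2 * l0) * expR ((2 * C1 + K3) * t)
         + - (c / (2 * l0)) * expR (C1 * t)),
  (fun t => (M + c) * l0 / 2 * expR (K3 * t)
         + - (c * l0 / 2) * expR (- C1 * t)),
  (fun t => (M + c) / (2 * l0) * ((2 * C1 + K3) * expR ((2 * C1 + K3) * t))
         + - (c / (2 * l0)) * (C1 * expR (C1 * t))),
  (fun t => (M + c) * l0 / 2 * (K3 * expR (K3 * t))
         + - (c * l0 / 2) * (- C1 * expR (- C1 * t))).
have aE t : (M + c) / (2 * l0) * expR ((2 * C1 + K3) * t)
         + - (c / (2 * l0)) * expR (C1 * t) =
    lip_growth C1 beta K3 M t * (expR (C1 * t) / l0) / 2.
  have -> : (2 * C1 + K3) * t = (C1 + K3) * t + C1 * t by ring.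
  by rewrite expRD /lip_growth -/c; field; rewrite gt_eqF.
have bE t : (M + c) * l0 / 2 * expR (K3 * t)
         + - (c * l0 / 2) * expR (- C1 * t) =
    lip_growth C1 beta K3 M t / (expR (C1 * t) / l0) / 2.
  have -> : K3 * t = (C1 + K3) * t - C1 * t by ring.
  rewrite [- C1 * t]mulNr expRD expRN /lip_growth -/c; field.
  by rewrite !gt_eqF ?expR_gt0.
split; last by [].
split.
- by cont.
- by cont.
- by rewrite aE !mulr_ge0 ?invr_ge0 ?expR_ge0 ?(ltW l00)// (le_trans M0)// lip_growth_ge.
- rewrite bE divr_ge0// divr_ge0//; first by rewrite (le_trans M0)// lip_growth_ge.
  by rewrite divr_ge0 ?expR_ge0// ltW.
- move=> t /andP[t0 _]; rewrite !aE ler_pM2r// ler_pM//.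
  + by rewrite (le_trans M0)// lip_growth_ge.
  + by rewrite divr_ge0 ?expR_ge0// ltW.
  + exact: lip_growth_le.
  + by rewrite ler_pM2r ?invr_gt0// ler_expR ler_wpM2l.
- move=> t /andP[t0 _]; rewrite !mulr0 lerD//.
    by rewrite ler_wpM2l ?divr_ge0 ?mulr_ge0 ?(ltW l00)// ler_expR mulr_ge0.
  rewrite [- (c * _ / _) * _]mulNr [leRHS]mulNr lerN2; apply: ler_wpM2l.
    by rewrite divr_ge0// mulr_ge0// ltW.
  by rewrite ler_expR mulNr oppr_le0 mulr_ge0.
- by move=> t _; apply: qdiffD; apply: qdiffZ; exact: qdiff_exp.
- by move=> t _; apply: qdiffD; apply: qdiffZ; exact: qdiff_exp.
move=> t l /andP[t0 _] l_ge0; rewrite !aE !bE.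
have -> : (2 * C1 + K3) * t = (C1 + K3) * t + C1 * t by ring.
have -> : K3 * t = (C1 + K3) * t - C1 * t by ring.
rewrite expRD [- C1 * t]mulNr [expR (_ - C1 * t)]expRD expRN /lip_growth -/c.
set G := expR ((C1 + K3) * t); set P := expR (C1 * t).
have P0 : 0 < P by exact: expR_gt0.
have Pn : P != 0 by rewrite gt_eqF.
have ln : l0 != 0 by rewrite gt_eqF.
rewrite -subr_ge0.
(* Everything cancels except the term with [C1 beta], whose defect is that of AM-GM: [(q l - 1)^2 /
   (2 q) = (q l^2 + 1 / q) / 2 - l] with [q = P / l0]. *)
pose S := (C1 * beta) * ((P / l0 * l - 1) ^+ 2 / (2 * (P / l0))).
have S0 : 0 <= S.
  apply: mulr_ge0; first exact: mulr_ge0.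
  by rewrite divr_ge0 ?sqr_ge0// mulr_ge0// divr_ge0// ltW.
rewrite [leRHS](_ : _ = S)// /S [C1 * (beta + _)]mulrDr -cE; field.
by rewrite ln Pn.
Qed.

Lemma lipschitz_propagation (H : V -> R -> R -> V -> R)
    (C1 beta A2 B2 K3 T t0 d M : R) (u : V -> R -> R) (x0 : V) (rho rho' : R -> R) :
  hamiltonian H C1 beta A2 B2 K3 ->
  cone T A2 B2 K3 d x0 rho rho' ->
  continuous (fun z : V * R => u z.1 z.2) ->
  subsolution T H u -> supersolution T H u -> 0 <= M ->
  (forall x z, enorm (x - x0) <= rho 0 + d -> enorm (z - x0) <= rho 0 + d ->
     u x 0 - u z 0 <= M * enorm (x - z)) ->
  0 < t0 < T ->
  forall x z, enorm (x - x0) <= rho t0 -> enorm (z - x0) <= rho t0 ->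
     u x t0 - u z t0 <= lip_growth C1 beta K3 M t0 * enorm (x - z).
Proof.
move=> hH hcone cu subu supu M0 base t0T x z xr zr.
have [->|xz] := eqVneq x z; first by rewrite !subrr enorm0 mulr0.
have v0 : 0 < enorm (x - z) by apply: enorm_gt0; rewrite subr_eq0.
set v := enorm (x - z) in v0 *.
have [C10 beta0 K30] := And3 (ham_C1 _ _ _ _ _ _ hH) (ham_beta _ _ _ _ _ _ hH)
  (ham_K3 _ _ _ _ _ _ hH).
(* Makes [exp(C1 t0) / l0 = 1 / v], so that at time [t0] the modulus touches [L |.|] at the distance
   of the given pair. *)
pose l0 := v * expR (C1 * t0).
have l00 : 0 < l0 by rewrite mulr_gt0 ?expR_gt0.
have [a [b [a' [b' [hab abE]]]]] := lip_modulus T C1 beta K3 M l0 C10 beta0 K30 M0 l00.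
have l0n : l0 != 0 by rewrite gt_eqF.
have := doubling _ _ _ _ _ _ _ _ _ _ _ _ _ _ _ _ _ _ hH hcone hab cu cu subu supu _ t0T x z xr zr.
move=> /(_ _)/wrap[|h].
  move=> y y' yr y'r; rewrite (le_trans (base _ _ yr y'r))//.
  have [-> ->] := abE 0; rewrite /lip_growth !mulr0 expR0 mulr1 addrK.
  rewrite -/v; set N := enorm _.
  have -> : M * (1 / l0) / 2 * N ^+ 2 + M / (1 / l0) / 2 =
    M * N + M * ((N - l0) ^+ 2 / (2 * l0)) by field.
  by rewrite lerDl mulr_ge0// divr_ge0 ?sqr_ge0// mulr_ge0// ltW.
rewrite (le_trans h)// -/v; have [-> ->] := abE t0.
rewrite le_eqVlt; apply/orP; left; apply/eqP; rewrite /l0; field.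
by rewrite !gt_eqF ?expR_gt0.
Qed.

End Propagation.

(** * Infima over growing balls *)

Section InfBall.
Context {R : realType} {n : nat}.
Local Notation V := 'rV[R]_n.
Implicit Types (u w : V -> R -> R) (x y p q : V) (s t : R).

Lemma hamiltonian_near (H : V -> R -> R -> V -> R) (C1 beta A2 B2 K3 L e : R) w x t :
  hamiltonian H C1 beta A2 B2 K3 -> continuous (fun z : V * R => w z.1 z.2) ->
  0 < e -> exists2 d, 0 < d & forall y s q, enorm (y - x) < d ->
     `|s - t| < d -> enorm q <= L ->
     `|H y s (w y s) q - H x t (w x t) q| <= e.
Proof.
move=> [cH _ _ _ _ _ _ _ _ _] cw e0.
have cF : continuous (fun z : (V * R) * V => H z.1.1 z.1.2 (w z.1.1 z.1.2) z.2).
  apply: (continuous_compf _ _ _ (fun z : (V * R) * V =>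
    ((z.1.1, z.1.2), (w z.1.1 z.1.2, z.2))) _ _ cH).
  by cont.
have := compact_near_uniform _ _
  (fun (z : V * R) (q : V) => H z.1 z.2 (w z.1 z.2) q)
  (eball (0 : V) L) (x, t) e (eball_compact _ _) cF e0.
move=> /near_prod_eball[d d0 dP]; exists d => // y s q y1 s1 qL.
by apply/ltW; apply: (dP y s y1 s1 q); rewrite /eball /= subr0.
Qed.

(** With the unknown replaced by [u], the equation is convex in the slope alone; [L] keeps the
    slopes in a compact set, where its variation in [(x, t)] is uniformly small. *)
Lemma subsolution_prox_sub (H : V -> R -> R -> V -> R) (C1 beta A2 B2 K3 T L : R) u :
  hamiltonian H C1 beta A2 B2 K3 -> continuous (fun z : V * R => u z.1 z.2) ->
  subsolution T H u ->
  (forall x t p tau, 0 < t < T -> prox_sup u x t p tau -> enorm p <= L) ->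
  forall x t p tau, 0 < t < T -> prox_sub u x t p tau ->
    tau + H x t (u x t) p <= 0.
Proof.
move=> hH cu subu lipu x t p tau /andP[t0 tT].
have AB0 : 0 <= A2 * enorm x + B2.
  by case: hH => *; rewrite addr_ge0// mulr_ge0// enorm_ge0.
apply: (prox_sup_to_sub u (fun y s q => H y s (u y s) q) x t p tau L _ cu AB0).
- by case: hH => _ _ _ _ _ _ Hp _ _ _ q q'; exact: Hp.
- by case: hH => _ _ _ _ _ _ _ _ _ Hc q q' l; exact: Hc.
- by move=> e e0; exact: (hamiltonian_near _ _ _ _ _ _ _ _ _ _ _ hH).
exists (Num.min t (T - t)); first by rewrite lt_min t0 subr_gt0.
move=> y s q nu _; rewrite lt_min !ltr_norml => /andP[/andP[h1 _] /andP[_ h2]] qs.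
have sT : 0 < s < T by apply/andP; split; lra.
by split; [exact: lipu qs|exact: subu qs].
Qed.

(** The ball is parametrized by the unit ball, so the compact set of parameters stays fixed while
    the radius varies; the minimum is required to be attained because the minimizer carries the
    jets. *)
Definition is_inf_ball u (r : R -> R) w := forall x t,
  (exists2 e, enorm e <= 1 & w x t = u (x + r t *: e) t) /\
  (forall e, enorm e <= 1 -> w x t <= u (x + r t *: e) t).

Lemma inf_ball_exists u r : continuous (fun z : V * R => u z.1 z.2) ->
  exists w, is_inf_ball u r w.
Proof.
move=> cu.
have h (z : V * R) : exists v : R,
    (exists2 e, enorm e <= 1 & v = u (z.1 + r z.2 *: e) z.2) /\
    (forall e, enorm e <= 1 -> v <= u (z.1 + r z.2 *: e) z.2).
  have B0 : eball (0 : V) (1 : R) !=set0.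
    by exists 0; rewrite /eball /= subr0 enorm0.
  have [e] := continuous_min_attained _ (fun e : V => u (z.1 + r z.2 *: e) z.2)
    _ B0 (eball_compact _ _) ltac:(by cont).
  rewrite /eball /= subr0 => e1 emin; exists (u (z.1 + r z.2 *: e) z.2).
  by split=> [|e' e'1]; [exists e|apply: emin; rewrite subr0].
have [w hw] := choice h; exists (fun x t => w (x, t)) => x t; exact: (hw (x, t)).
Qed.

Lemma inf_ball_continuous u r w : continuous (fun z : V * R => u z.1 z.2) ->
  continuous r -> is_inf_ball u r w -> continuous (fun z : V * R => w z.1 z.2).
Proof.
move=> cu cr hw; apply: (@continuous_near R (V * R)%type) => -[x t] e e0.
have := compact_near_uniform _ _ (fun (z : V * R) (e : V) => u (z.1 + r z.2 *: e) z.2)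
  (eball (0 : V) 1) (x, t) e (eball_compact _ _) ltac:(by cont) e0.
apply: filterS => -[y s] /= hyx.
have [[d d1 wd] wx] := hw x t; have [[d' d'1 wd'] wy] := hw y s.
have h1 : w y s < w x t + e.
  rewrite (le_lt_trans (wy _ d1))// wd.
  have := hyx d; rewrite /eball /= subr0 => /(_ d1).
  by rewrite ltr_norml => /andP[_]; lra.
have h2 : w x t < w y s + e.
  rewrite (le_lt_trans (wx _ d'1))// wd'.
  have := hyx d'; rewrite /eball /= subr0 => /(_ d'1).
  by rewrite ltr_norml => /andP[+ _]; lra.
by rewrite ltr_norml; apply/andP; split; lra.
Qed.

(* The minimizer over the ball lies in the direction opposite to the
   gradient, so a growing radius contributes [r' |p|] to the time slope. *)
Lemma inf_ball_prox_sub u r w x t p (sigma dr : R) : is_inf_ball u r w ->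
  0 < r t -> qdiff r t dr -> prox_sub w x t p sigma ->
  exists e, [/\ enorm e <= 1, w x t = u (x + r t *: e) t &
    prox_sub u (x + r t *: e) t p (sigma + dr * enorm p)].
Proof.
move=> hw rt0 qr [k [d [k0 d0 hd]]].
have [[e e1 we] wmin] := hw x t; exists e; split=> //.
have pe : dotv p e = - enorm p.
  apply/le_anti/andP; split; last first.
    by rewrite (le_trans _ (dotv_ge _ _))// lerN2 ler_piMr ?enorm_ge0.
  have [->|p0] := eqVneq p 0; first by rewrite dotv0l enorm0 oppr0.
  have {}p0 := enorm_gt0 _ p0.
  pose e' := - ((enorm p)^-1 *: p).
  have e'1 : enorm e' = 1.
    by rewrite enormN enormZ ger0_norm ?invr_ge0 ?enorm_ge0// mulVf// gt_eqF.
  have pe' : dotv p e' = - enorm p.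
    rewrite dotvNr dotvZr -enorm_sqr expr2 mulrA mulVf ?gt_eqF// mul1r//.
  rewrite -pe'; apply/ler_addgt0Pr => eps eps0.
  pose h := Num.min 1 (Num.min (d / (2 * r t + 1)) (eps / (4 * k * r t + 1))).
  have r1 : 0 < 2 * r t + 1 by lra.
  have k1 : 0 < 4 * k * r t + 1 by rewrite ltr_wpDl// !mulr_ge0// ltW.
  have h0 : 0 < h by rewrite !lt_min ltr01 !divr_gt0.
  have h1 : h <= 1 by rewrite /h ge_min lexx.
  have h2 : h * (2 * r t + 1) <= d.
    by rewrite -ler_pdivlMr// /h !ge_min lexx !orbT.
  have h3 : h * (4 * k * r t + 1) <= eps.
    by rewrite -ler_pdivlMr// /h !ge_min lexx !orbT.
  pose eh := (1 - h) *: e + h *: e'.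
  have eh1 : enorm eh <= 1.
    rewrite (le_trans (enormD _ _))// !enormZ e'1 !ger0_norm ?subr_ge0 ?(ltW h0)//.
    have := ler_wpM2l (_ : 0 <= 1 - h) e1; rewrite subr_ge0 => /(_ h1); lra.
  (* The minimizer [x + r t *: e] also lies in the ball about [xh], where it is reached in the
     direction [eh]. Hence [w xh t <= w x t], and the subgradient inequality compares [p . e] with
     [p . e']. *)
  pose xh := x + (r t * h) *: (e - e').
  have xhE : xh + r t *: eh = x + r t *: e.
    apply/rowP => i; rewrite /xh /eh !mxE; ring.
  have := (hw xh t).2 eh eh1; rewrite xhE -we => wxh.
  have dE : xh - x = (r t * h) *: (e - e') by rewrite /xh addrC addKr.
  have ne : enorm (e - e') <= 2.
    by rewrite (le_trans (enormD _ _))// enormN e'1; lra.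
  have nd : enorm (xh - x) <= r t * h * 2.
    rewrite dE enormZ ger0_norm ?mulr_ge0 ?(ltW rt0) ?(ltW h0)// ler_wpM2l//.
    by rewrite mulr_ge0 ?ltW.
  have dd : enorm (xh - x) < d by rewrite (le_lt_trans nd)//; nra.
  have := hd xh t dd; rewrite subrr normr0 => /(_ d0).
  rewrite dE dotvZr -dE dotvBr mulr0 addr0 expr0n addr0 => hh.
  have sq : enorm (xh - x) ^+ 2 <= (r t * h * 2) ^+ 2.
    by rewrite ler_pXn2r ?nnegrE ?enorm_ge0// (le_trans _ nd)// enorm_ge0.
  have := ler_wpM2l k0 sq => sq'.
  have rh : 0 < r t * h by rewrite mulr_gt0.
  have : r t * h * (dotv p e - dotv p e') <= r t * h * (h * (4 * k * r t)) by lra.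
  by rewrite ler_pM2l//; lra.
have [k' [d' [k'0 d'0 hr]]] := qr; have [l [d2 [l0 d20 lr]]] := qdiff_lip _ _ _ qr.
pose D := Num.min (Num.min d' d2) (d / (l + 2)).
have l2 : 0 < l + 2 by lra.
have D0 : 0 < D by rewrite !lt_min d'0 d20 divr_gt0.
exists (k' * enorm p + k * (2 * (1 + l ^+ 2))), D; split=> //.
  by rewrite addr_ge0 ?mulr_ge0 ?enorm_ge0// addr_ge0// sqr_ge0.
move=> y s; rewrite /D !lt_min => /andP[/andP[_ _]]; rewrite ltr_pdivlMr// => y1.
move=> /andP[/andP[s1 s2]]; rewrite ltr_pdivlMr// => s3.
(* The centre [y - r s *: e] sees [y] in the fixed direction [e]; its displacement contains
   [- (r s - r t) *: e], whose product with [p] is [(r s - r t) |p|]. *)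
have := (hw (y - r s *: e) s).2 e e1; rewrite subrK; apply: le_trans.
have yE : y - r s *: e - x = (y - (x + r t *: e)) - (r s - r t) *: e.
  by apply/rowP => i; rewrite !mxE; ring.
have hl := lr s s2.
have ny : enorm (y - r s *: e - x) <= enorm (y - (x + r t *: e)) + l * `|s - t|.
  rewrite yE (le_trans (enormD _ _))// lerD2l enormN enormZ.
  by rewrite (le_trans _ hl)// ler_piMr.
have sl : `|s - t| < d by have := normr_ge0 (s - t); nra.
have yl : enorm (y - r s *: e - x) < d.
  rewrite (le_lt_trans ny)//; have := normr_ge0 (s - t).
  by have := enorm_ge0 (y - (x + r t *: e)); nra.
have := hd _ s yl sl; apply: le_trans; rewrite we.
have -> : dotv p (y - r s *: e - x) =
    dotv p (y - (x + r t *: e)) + (r s - r t) * enorm p.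
  by rewrite yE (dotvBr p (y - (x + r t *: e))) dotvZr pe mulrN opprK.
have nsq : enorm (y - r s *: e - x) ^+ 2 + (s - t) ^+ 2 <=
   2 * (1 + l ^+ 2) * (enorm (y - (x + r t *: e)) ^+ 2 + (s - t) ^+ 2).
  have : enorm (y - r s *: e - x) ^+ 2 <=
      (enorm (y - (x + r t *: e)) + l * `|s - t|) ^+ 2.
    rewrite ler_pXn2r ?nnegrE ?enorm_ge0//.
    by rewrite addr_ge0 ?mulr_ge0 ?enorm_ge0.
  rewrite -[(s - t) ^+ 2]real_normK ?num_real//.
  move: (enorm_ge0 (y - (x + r t *: e))) (normr_ge0 (s - t)).
  set N := enorm (y - (x + _)); set S := `|s - t| => N0 S0.
  have := sqr_ge0 (N - l * S); have := sqr_ge0 (l * N).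
  by have := sqr_ge0 S; have := sqr_ge0 N; lra.
have := ler_wpM2l k0 nsq => nsq'.
have := hr s s1; rewrite ler_norml => /andP[hr1 _].
have := ler_wpM2r (enorm_ge0 p) hr1 => hr2.
have : 0 <= k' * enorm p * enorm (y - (x + r t *: e)) ^+ 2.
  by rewrite !mulr_ge0 ?enorm_ge0.
by lra.
Qed.

(** Subgradients pass from the minimum [w] to [u] at the minimizer. There (H1) costs
    [C1 (beta + |p|) r] and the growing radius gains [C1 r |p|], so only [C1 beta r] remains; [psi']
    absorbs it together with [K3 psi]. Convexity finally turns the inequality at subgradients into
    one at supergradients. *)
Lemma inf_ball_subsolution (H : V -> R -> R -> V -> R)
    (C1 beta A2 B2 K3 T L r0 : R) u w (psi psi' : R -> R) :
  hamiltonian H C1 beta A2 B2 K3 -> continuous (fun z : V * R => u z.1 z.2) ->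
  (forall x t p tau, 0 < t < T -> prox_sub u x t p tau ->
     enorm p <= L /\ tau + H x t (u x t) p <= 0) ->
  0 < r0 -> is_inf_ball u (fun t => r0 * expR (C1 * t)) w ->
  (forall t, 0 < t < T -> [/\ qdiff psi t (psi' t), 0 <= psi t &
     psi' t = - (K3 * psi t) - C1 * beta * (r0 * expR (C1 * t))]) ->
  subsolution T H (fun x t => w x t + psi t).
Proof.
move=> hH cu subu r00 hw hpsi.
set r := fun t : R => r0 * expR (C1 * t) in hw *.
have cr : continuous r by rewrite /r; cont.
have r_gt0 t : 0 < r t by rewrite mulr_gt0 ?expR_gt0.
have rd t : qdiff r t (C1 * r t).
  rewrite /r (_ : C1 * (r0 * _) = r0 * (C1 * expR (C1 * t))); last by ring.
  by apply: qdiffZ; exact: qdiff_exp.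
have cw := inf_ball_continuous _ _ _ cu cr hw.
have wsub x t p tau : 0 < t < T -> prox_sub w x t p tau -> enorm p <= L /\
    tau + (H x t (w x t) p - C1 * beta * r t) <= 0.
  move=> tT /(inf_ball_prox_sub _ _ _ _ _ _ _ _ hw (r_gt0 t) (rd t)).
  move=> [e [e1 we /(subu _ _ _ _ tT)[pL]]]; rewrite -we => hu; split=> //.
  have hx := ham_x _ _ _ _ _ _ hH x (x + r t *: e) t (w x t) p.
  rewrite opprD addrA subrr sub0r enormN enormZ (gtr0_norm (r_gt0 t)) in hx.
  have re : r t * enorm e <= r t by rewrite ler_piMr// ltW.
  have C0 : 0 <= C1 * (beta + enorm p).
    by case: hH => *; rewrite mulr_ge0 ?addr_ge0 ?enorm_ge0.
  have := ler_wpM2l C0 re; move: hx; rewrite ler_norml => /andP[_].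
  by lra.
move=> x t p tau tT supf; have [qpsi psi0 psiE] := hpsi t tT.
have AB0 : 0 <= A2 * enorm x + B2.
  by case: hH => *; rewrite addr_ge0// mulr_ge0// enorm_ge0.
have supw : prox_sup w x t p (tau - psi' t).
  have q := prox_sup_time (fun s => -1 * psi s) x t _ (qdiffZ _ (-1) _ _ qpsi).
  have := prox_supD _ _ _ _ _ _ _ _ supf q; rewrite addr0 mulN1r.
  by apply: (prox_sup_dom _ _ _ _ _ _ 1) => // y s _ _; lra.
have := prox_sub_to_sup w (fun y s q => H y s (w y s) q - C1 * beta * r s) x t p
  (tau - psi' t) L _ cw AB0.
move: tT => /andP[t0 tT].
move=> /(_ _ _ _ _ supw)/wrap[||||hw1].
- case: hH => _ _ _ _ _ _ Hp _ _ _ q q'.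
  by rewrite opprB addrA subrK; exact: Hp.
- case: hH => _ _ _ _ _ _ _ _ _ Hc q q' l hl.
  by have := Hc x t (w x t) q q' l hl; lra.
- move=> e e0; have e20 : 0 < e / 2 by rewrite divr_gt0.
  have [d d0 hd] := hamiltonian_near _ _ _ _ _ _ L _ _ x t hH cw e20.
  have [d' d'0 hd'] := continuous_dist (fun _ s => C1 * beta * r s) x t _
    ltac:(by rewrite /r; cont) e20.
  exists (Num.min d d'); first by rewrite lt_min d0.
  move=> y s q; rewrite !lt_min => /andP[y1 y2] /andP[s1 s2] qL.
  have := hd y s q y1 s1 qL; have := ltW (hd' y s y2 s2).
  by rewrite !ler_norml => /andP[? ?] /andP[? ?]; apply/andP; split; lra.
- exists (Num.min t (T - t)); first by rewrite lt_min t0 subr_gt0.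
  move=> y s q nu _; rewrite lt_min !ltr_norml => /andP[/andP[h1 _] /andP[_ h2]].
  by apply: wsub; apply/andP; split; lra.
have := ham_u _ _ _ _ _ _ hH x t (w x t + psi t) (w x t) p.
rewrite [_ + psi t]addrC addrK (ger0_norm psi0) ler_norml => /andP[_ h].
by rewrite psiE -/(r t) in hw1; lra.
Qed.

(* Solution of [psi' = - K3 psi - C1 beta r0 exp(C1 t)] with [psi 0 = m r0]. *)
Definition decay (C1 beta K3 r0 m t : R) :=
  r0 * ((m + C1 * beta / (C1 + K3)) * expR (- K3 * t)
        - C1 * beta / (C1 + K3) * expR (C1 * t)).

Lemma decrease_propagation (H : V -> R -> R -> V -> R)
    (C1 beta A2 B2 K3 T t0 d L L0 r0 m : R) u x0 (rho rho' : R -> R) :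
  hamiltonian H C1 beta A2 B2 K3 ->
  cone T A2 B2 K3 d x0 rho rho' ->
  continuous (fun z : V * R => u z.1 z.2) ->
  subsolution T H u -> supersolution T H u ->
  (forall x t p tau, 0 < t < T -> prox_sup u x t p tau -> enorm p <= L) ->
  (forall x t p tau, 0 < t < T -> prox_sub u x t p tau -> enorm p <= L) ->
  (forall x z, u x 0 - u z 0 <= L0 * enorm (x - z)) ->
  0 < r0 -> (forall t, 0 < t < T -> 0 <= decay C1 beta K3 r0 m t) ->
  (forall x, enorm (x - x0) <= rho 0 + d ->
     exists2 y, enorm (y - x) <= r0 & u y 0 <= u x 0 - m * r0) ->
  0 < t0 < T ->
  exists2 y, enorm (y - x0) <= r0 * expR (C1 * t0) &
    u y t0 <= u x0 t0 - decay C1 beta K3 r0 m t0.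
Proof.
move=> hH hcone cu subu supu lipsup lipsub lip0 r00 decay0 base t0T.
have [C10 beta0 K30] := And3 (ham_C1 _ _ _ _ _ _ hH) (ham_beta _ _ _ _ _ _ hH)
  (ham_K3 _ _ _ _ _ _ hH).
set c := C1 * beta / (C1 + K3).
have cE : c * (C1 + K3) = C1 * beta by exact: coef_growth.
have [w hw] := inf_ball_exists u (fun t => r0 * expR (C1 * t)) cu.
have cr : continuous (fun t => r0 * expR (C1 * t)) by cont.
have cw := inf_ball_continuous _ _ _ cu cr hw.
have subu' := subsolution_prox_sub _ _ _ _ _ _ _ _ _ hH cu subu lipsup.
pose psi := decay C1 beta K3 r0 m.
pose psi' t := r0 * ((m + c) * (- K3 * expR (- K3 * t)) + - c * (C1 * expR (C1 * t))).
have psi_eq : psi = fun t => r0 * ((m + c) * expR (- K3 * t) + - c * expR (C1 * t)).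
  by apply/funext => t; rewrite /psi /decay -/c; ring.
have cpsi : continuous psi by rewrite psi_eq; cont.
have subw : subsolution T H (fun x t => w x t + psi t).
  apply: (inf_ball_subsolution _ _ _ _ _ _ _ L r0 u w psi psi' hH cu _ r00 hw).
    by move=> x t p tau tT q; split; [exact: lipsub q|exact: subu' q].
  move=> t tT; split; last first.
  - rewrite psi_eq /psi' -cE; ring.
  - exact: decay0.
  - rewrite psi_eq; apply: qdiffZ; apply: qdiffD; apply: qdiffZ; exact: qdiff_exp.
have cf : continuous (fun z : V * R => w z.1 z.2 + psi z.2) by cont.
have key : w x0 t0 + psi t0 - u x0 t0 <= 0.
  apply/ler_addgt0Pr => e e0; rewrite add0r.
  (* Only the diagonal point [(x0, x0)] matters at [t0], so it suffices that [b t0 = e]. The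
     coefficient [a0] may be large; it is chosen for Young's inequality [k l <= a0 l^2 + b0] with
     [k = C1 beta] and [k = L0]. *)
  pose b0 := e / expR ((K3 + 1) * t0).
  have b00 : 0 < b0 by rewrite divr_gt0 ?expR_gt0.
  pose a0 := ((C1 * beta) ^+ 2 + L0 ^+ 2) / (4 * b0).
  have a00 : 0 <= a0.
    apply: divr_ge0; first by apply: addr_ge0; exact: sqr_ge0.
    by rewrite mulr_ge0// ltW.
  have ab : a0 * b0 * 4 = (C1 * beta) ^+ 2 + L0 ^+ 2.
    by rewrite /a0; field; rewrite gt_eqF.
  have young (k l : R) : k ^+ 2 <= (C1 * beta) ^+ 2 + L0 ^+ 2 ->
      k * l <= a0 * l ^+ 2 + b0.
    rewrite -ab => kab; rewrite -(ler_pM2l b00).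
    have := sqr_ge0 (k * l - 2 * b0); have := ler_wpM2r (sqr_ge0 l) kab; lra.
  (* The terms [2 C1] and [K3] match the quadratic part of [mod_ineq]; the extra 1, here and in the
     rate of [b], leaves [a0 l^2 + b0 >= C1 beta l]. *)
  pose kk := 2 * C1 + K3 + 1.
  have kk0 : 0 <= kk by rewrite /kk; lra.
  have e1 (k t : R) : 0 <= k -> 0 <= t -> 1 <= expR (k * t).
    by move=> k0 t_ge0; rewrite -expR0 ler_expR mulr_ge0.
  have K1 : 0 <= K3 + 1 by lra.
  have hmod : modulus T C1 beta K3 (fun t => a0 * expR (kk * t))
     (fun t => b0 * expR ((K3 + 1) * t)) (fun t => a0 * (kk * expR (kk * t)))
     (fun t => b0 * ((K3 + 1) * expR ((K3 + 1) * t))).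
    split.
    - by cont.
    - by cont.
    - by rewrite mulr_ge0 ?expR_ge0.
    - by rewrite mulr_ge0 ?expR_ge0// ltW.
    - by move=> t /andP[h _]; rewrite mulr0 expR0 ler_wpM2l// e1.
    - by move=> t /andP[h _]; rewrite mulr0 expR0 ler_wpM2l ?e1// ltW.
    - by move=> t _; apply: qdiffZ; exact: qdiff_exp.
    - by move=> t _; apply: qdiffZ; exact: qdiff_exp.
    move=> t l /andP[h _] l0.
    have := young (C1 * beta) l; rewrite lerDl sqr_ge0 => /(_ isT) y1.
    have : a0 * l ^+ 2 <= a0 * expR (kk * t) * l ^+ 2.
      by rewrite ler_wpM2r ?sqr_ge0// ler_peMr// e1// ltW.
    have : b0 <= b0 * expR ((K3 + 1) * t) by rewrite ler_peMr ?(ltW b00)// e1// ltW.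
    rewrite /kk; set X := expR (_ * t); set Y := expR (_ * t); lra.
  have rt0 : 0 <= rho t0.
    by move: t0T => /andP[h1 h2]; rewrite (cone_ge0 _ _ _ _ _ _ _ _ hcone)// ltW.
  have := doubling H C1 beta A2 B2 K3 T t0 d _ _ x0 rho rho' _ _ _ _
    hH hcone hmod cf cu subw supu.
  move=> /(_ _ t0T x0 x0)/wrap[|].
    move=> x z xr zr; rewrite !mulr0 !expR0 !mulr1.
    have [y yx uy] := base x xr.
    have wx : w x 0 <= u y 0.
      have := (hw x 0).2 (r0^-1 *: (y - x)); rewrite mulr0 expR0 mulr1.
      rewrite scalerA divff ?gt_eqF// scale1r addrCA subrr addr0; apply.
      rewrite enormZ ger0_norm ?invr_ge0 ?(ltW r00)// mulrC ler_pdivrMr// mul1r//.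
    have psi00 : psi 0 = m * r0.
      by rewrite psi_eq !mulr0 expR0; ring.
    have := young L0 (enorm (x - z)); rewrite lerDr sqr_ge0 => /(_ isT).
    by have := lip0 x z; rewrite psi00; lra.
  rewrite subrr enorm0 => /(_ rt0 rt0).
  by rewrite expr0n mulr0 add0r /b0 divfK// gt_eqF ?expR_gt0.
have [[e e1 we] _] := hw x0 t0.
exists (x0 + (r0 * expR (C1 * t0)) *: e).
  rewrite addrC addKr enormZ ger0_norm ?mulr_ge0 ?expR_ge0 ?(ltW r00)//.
  by rewrite ler_piMr// mulr_ge0 ?expR_ge0// ltW.
by rewrite -we -/(psi t0); lra.
Qed.

End InfBall.

(** * Subgradients of the initial datum *)

Section InitialDatum.
Context {R : realType} {n : nat}.
Local Notation V := 'rV[R]_n.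
Implicit Types (x y z p q : V).

Lemma quad_increment (k : R) x y z :
  k * enorm (z - x) ^+ 2 - k * enorm (y - x) ^+ 2 - 2 * k * dotv (y - x) (z - y)
  = k * enorm (z - y) ^+ 2.
Proof.
have -> : z - x = (y - x) + (z - y) by rewrite [RHS]addrC addrA subrK.
by rewrite (enorm_sqrD (y - x)); ring.
Qed.

Lemma isC1_space_quad (k : R) p x :
  isC1_space (fun y => dotv p (y - x) + k * enorm (y - x) ^+ 2)
    (fun y => p + (2 * k) *: (y - x)).
Proof.
have K0 : 0 < 2 * `|k| + 1 by rewrite ltr_wpDl// mulr_ge0.
split=> y e e0; exists (e / (2 * `|k| + 1)); rewrite ?divr_gt0// => z.
  rewrite ltr_pdivlMr// => zy; rewrite dotvDl dotvZl.
  have -> : dotv p (z - x) = dotv p (y - x) + dotv p (z - y).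
    by rewrite -dotvDr [y - x + _]addrC addrA subrK.
  have -> : dotv p (y - x) + dotv p (z - y) + k * enorm (z - x) ^+ 2 -
    (dotv p (y - x) + k * enorm (y - x) ^+ 2) -
    (dotv p (z - y) + 2 * k * dotv (y - x) (z - y)) = k * enorm (z - y) ^+ 2.
    by rewrite -(quad_increment k x y z); ring.
  rewrite normrM [`|_ ^+ 2|]ger0_norm ?sqr_ge0//.
  by have := enorm_ge0 (z - y); have := normr_ge0 k; nra.
rewrite ltr_pdivlMr// => zy.
have -> : p + 2 * k *: (z - x) - (p + 2 * k *: (y - x)) = (2 * k) *: (z - y).
  by apply/rowP => i; rewrite !mxE; ring.
rewrite enormZ normrM ger0_norm//.
by have := enorm_ge0 (z - y); lra.
Qed.

Lemma prox_sub_subdiff (u0 : V -> R) x (t : R) p (tau : R) :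
  prox_sub (fun y _ => u0 y) x t p tau -> subdiff u0 x p.
Proof.
move=> [k [r [k0 r0 h]]].
exists (fun y => p + (2 * - k) *: (y - x)),
  (fun y => dotv p (y - x) + - k * enorm (y - x) ^+ 2); split.
  exact: isC1_space_quad.
split; last by rewrite subrr scaler0 addr0.
exists r => // y yr; rewrite subrr enorm0 dotv0r expr0n/= mulr0 addr0 subr0.
by have := h y t yr; rewrite subrr normr0 expr0n/= => /(_ r0); lra.
Qed.

Lemma subdiff_le_lipschitz (u0 : V -> R) x p (L : R) : 0 <= L ->
  (forall y z, `|u0 y - u0 z| <= L * enorm (y - z)) ->
  subdiff u0 x p -> enorm p <= L.
Proof.
move=> L0 lip [Dphi [phi [[c1 _] [[r r0 hmin] <-]]]].
apply: (enorm_le_slope x) => // e e0.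
have [d d0 hd] := c1 x e e0.
exists (Num.min r d); first by rewrite lt_min r0.
move=> y; rewrite lt_min => /andP[y1 y2].
have := hmin y y1; have := hd y y2; have := lip y x.
by rewrite !ler_norml => /andP[_ ?] /andP[? _]; lra.
Qed.

Lemma lipschitz_continuous (u0 : V -> R) (L : R) :
  (forall y z, `|u0 y - u0 z| <= L * enorm (y - z)) -> continuous u0.
Proof.
move=> lip; apply: (@continuous_near R V) => x e e0.
have L1 : 0 < `|L| + 1 by rewrite ltr_wpDl.
have := near_eball x (e / (`|L| + 1)) (divr_gt0 e0 L1); apply: filterS => y.
rewrite ltr_pdivlMr// enormB => yx; rewrite (le_lt_trans (lip _ _))//.
by have := ler_wpM2r (enorm_ge0 (x - y)) (ler_norm L); have := enorm_ge0 (x - y); lra.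
Qed.

(** Mean value inequality along the segment from [z] to [x], which stays in the ball by convexity;
    the gap [r1 - r] leaves room for the nearby points that carry subgradients. *)
Lemma subdiff_bound_lipschitz (u0 : V -> R) (x0 : V) (M r r1 : R) : continuous u0 ->
  (forall y p, enorm (y - x0) <= r1 -> subdiff u0 y p -> enorm p <= M) ->
  r < r1 -> forall x z, enorm (x - x0) <= r -> enorm (z - x0) <= r ->
  u0 x - u0 z <= M * enorm (x - z).
Proof.
move=> cu bnd rr1 x z xr zr.
have e0 : 0 < r1 - r by rewrite subr_gt0.
have := prox_sub_increment (fun y _ => u0 y) z 0 (x - z) 0 1
  (M * enorm (x - z)) (r1 - r) ltac:(by cont) ler01 e0.
move=> /(_ _)/wrap[|]; last by rewrite scale1r addrC subrK mulr1; lra.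
move=> a y s p tau /andP[a0 a1] ya _ /prox_sub_subdiff sub.
rewrite mulr0 addr0 (le_trans (dotv_le _ _))// ler_wpM2r ?enorm_ge0//.
apply: bnd sub; rewrite (le_trans (enorm_triangle (z + a *: (x - z)) _ _))//.
have -> : z + a *: (x - z) - x0 = (1 - a) *: (z - x0) + a *: (x - x0).
  by apply/rowP => i; rewrite !mxE; ring.
have := enormD ((1 - a) *: (z - x0)) (a *: (x - x0)).
rewrite !enormZ !ger0_norm ?subr_ge0// => h.
have h1 := ler_wpM2l a0 xr; have h2 : 0 <= 1 - a by rewrite subr_ge0.
by have := ler_wpM2l h2 zr; lra.
Qed.

(* Minimize [u0 y + m1 a + k (|y - x| - a)_+^2] over [0 <= a <= r0]: at a
   minimum with [a < r0] there is a subgradient of norm at most [m1]. *)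
Lemma subdiff_bound_decrease (u0 : V -> R) x (L m m' r0 r1 : R) : 0 <= L ->
  (forall y z, `|u0 y - u0 z| <= L * enorm (y - z)) ->
  (forall y p, enorm (y - x) <= r1 -> subdiff u0 y p -> m <= enorm p) ->
  0 < r0 < r1 -> 0 < m' < m ->
  exists2 y, enorm (y - x) <= r0 & u0 y <= u0 x - m' * r0.
Proof.
move=> L0 lip bnd /andP[r00 r01] /andP[m'0 m'm].
have cu := lipschitz_continuous _ _ lip.
pose m1 := (m' + m) / 2.
have mm1 : m' < m1 < m by rewrite /m1; apply/andP; split; lra.
move: mm1 => /andP[m'm1 m1m].
have L1 : 0 < L + 1 by rewrite ltr_wpDl.
(* The first bound keeps the minimizer inside the ball of radius [r1], the second pays for moving it
   back into the ball of radius [r0]. *)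
pose eps := Num.min ((r1 - r0) / 2) ((m1 - m') * r0 / (L + 1)).
have eps0 : 0 < eps by rewrite lt_min !divr_gt0 ?mulr_gt0 ?subr_gt0.
have eps1 : eps * 2 <= r1 - r0 by rewrite -ler_pdivlMr// /eps ge_min lexx.
have eps2 : eps * (L + 1) <= (m1 - m') * r0.
  by rewrite -ler_pdivlMr// /eps ge_min lexx orbT.
clearbody eps.
have r10 : 0 < r1 by rewrite (lt_trans r00).
pose k := (L * r1 + 1) / eps ^+ 2.
have Lr : 0 < L * r1 + 1 by rewrite ltr_wpDl// mulr_ge0// ltW.
have k0 : 0 < k by rewrite divr_gt0// exprn_gt0.
have keps : k * eps ^+ 2 = L * r1 + 1 by rewrite divfK// gt_eqF// exprn_gt0.
clearbody k.
pose Phi y a := u0 y + m1 * a + k * Num.max 0 (enorm (y - x) - a) ^+ 2.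
pose I : set R := `[0, r0].
have B0 : (eball x r1 `*` I) !=set0.
  exists (x, 0); split=> /=; first by rewrite /eball /= subrr enorm0 ltW.
  by rewrite /I /= in_itv/= lexx ltW.
have [[y a] [/= yB aI] Pmin] := continuous_min_attained _
  (fun z : V * R => Phi z.1 z.2) (eball x r1 `*` I)
  B0 (compact_setX (eball_compact x r1) (@segment_compact _ 0 r0))
  ltac:(by rewrite /Phi; cont).
move: (aI); rewrite /I /= in_itv/= => /andP[a0 ar0].
have {}Pmin y' a' : enorm (y' - x) <= r1 -> 0 <= a' <= r0 ->
    Phi y a <= Phi y' a'.
  by move=> h1 h2; apply: (Pmin (y', a')); split; [|rewrite /I /= in_itv].
set mu := Num.max 0 (enorm (y - x) - a).
have mu0 : 0 <= mu by exact: maxr0_ge0.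
have PhiE : Phi y a = u0 y + m1 * a + k * mu ^+ 2 by [].
have m10 : 0 < m1 by rewrite (lt_trans m'0).
have Px : Phi y a <= u0 x.
  have := Pmin x 0; rewrite subrr enorm0 (ltW r10) lexx (ltW r00) => /(_ isT isT).
  by rewrite {2}/Phi subrr enorm0 subrr maxxx expr0n !mulr0 !addr0.
have mueps : mu < eps.
  rewrite -(@ltr_pXn2r _ 2)// ?nnegrE ?(ltW eps0)// -(ltr_pM2l k0) keps.
  have := lip x y; rewrite ler_norml enormB => /andP[_ h1].
  have := ler_wpM2l L0 (yB : enorm (y - x) <= r1).
  by have := mulr_ge0 (ltW m10) a0; lra.
have yx : enorm (y - x) <= a + mu by rewrite -lerBlDl /mu le_max lexx orbT.
have yr1 : enorm (y - x) < r1 by lra.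
(* The penalty, opposed to [u0] at the interior minimizer, gives a subgradient of norm at most
   [2 k mu]. *)
have k2mu : m <= 2 * k * mu.
  have pB := prox_sup_barrier k (fun=> a) x y 0 0 (ltW k0) a0 (qdiff_cst a 0).
  have sub : prox_sub (fun y _ => u0 y) y 0
      (- ((2 * k * mu / enorm (y - x)) *: (y - x))) (- (2 * k * mu * - 0)).
    apply: prox_sup_opp; apply: (prox_sup_dom _ _ _ _ _ _ (r1 - enorm (y - x)) _ _ pB).
      by rewrite subr_gt0.
    move=> y' s y'y _.
    have y'r : enorm (y' - x) <= r1.
      by rewrite (le_trans (enorm_triangle y _ _))//; lra.
    by have := Pmin y' a y'r; rewrite a0 ar0 PhiE /Phi -/mu => /(_ isT); lra.
  apply: (le_trans (bnd _ _ yB (prox_sub_subdiff _ _ _ _ _ sub))).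
  rewrite enormN; apply: enorm_normalize_le.
  by rewrite !mulr_ge0// ltW.
have mu_gt0 : 0 < mu.
  rewrite lt_neqAle eq_sym mu0 andbT; apply/eqP => mu00.
  by move: k2mu; rewrite mu00 mulr0; lra.
(* Otherwise raising [a] by [l] would change the functional by [l (m1 - 2 k mu + k l)], negative for
   small [l] because [m1 < m <= 2 k mu]. *)
have ar : a = r0.
  apply/eqP; rewrite eq_le ar0 /= leNgt; apply/negP => ar.
  pose l := Num.min (Num.min mu (r0 - a)) ((m - m1) / (2 * k)).
  have l0 : 0 < l by rewrite !lt_min mu_gt0 subr_gt0 ar divr_gt0 ?subr_gt0 ?mulr_gt0.
  have [l1 l2] : l <= mu /\ l <= r0 - a.
    by rewrite /l; split; rewrite !ge_min lexx ?orbT.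
  have l3 : l * (2 * k) <= m - m1.
    by rewrite -ler_pdivlMr ?mulr_gt0// /l ge_min lexx orbT.
  have := Pmin y (a + l) (ltW yr1) _; rewrite PhiE /Phi => /(_ _)/wrap[|].
    by apply/andP; split; lra.
  have muE : mu = enorm (y - x) - a.
    by apply: max_r; move: mu_gt0; rewrite /mu lt_max ltxx /= => /ltW.
  have -> : Num.max 0 (enorm (y - x) - (a + l)) = mu - l.
    by rewrite max_r; lra.
  move=> h; have : l * (2 * k * mu - m1 - k * l) <= 0 by lra.
  rewrite pmulr_rle0//; nra.
have uy : u0 y + m1 * r0 <= u0 x.
  by move: Px; rewrite PhiE ar; have := mulr_ge0 (ltW k0) (sqr_ge0 mu); lra.
have [yr|yr] := leP (enorm (y - x)) r0.
  by exists y => //; have := ler_wpM2r (ltW r00) (ltW m'm1); lra.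
(* The minimizer overshoots by less than [eps]; moving it back radially raises [u0] by at most
   [L eps <= (m1 - m') r0], which turns the rate [m1] into [m']. *)
pose N := enorm (y - x).
have N0 : 0 < N by rewrite (lt_trans r00).
exists (x + (r0 / N) *: (y - x)).
  rewrite addrC addKr enormZ ger0_norm ?divr_ge0 ?(ltW r00) ?(ltW N0)//.
  by rewrite -/N divfK// gt_eqF.
have := lip (x + (r0 / N) *: (y - x)) y; rewrite ler_norml => /andP[_].
have -> : enorm (x + (r0 / N) *: (y - x) - y) = N - r0.
  have -> : x + (r0 / N) *: (y - x) - y = (r0 / N - 1) *: (y - x).
    by apply/rowP => i; rewrite !mxE; ring.
  rewrite enormZ -/N ler0_norm; last by rewrite subr_le0 ler_pdivrMr// mul1r ltW.
  by field; rewrite gt_eqF.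
have : L * (N - r0) <= L * eps by rewrite ler_wpM2l// lerBlDr /N; lra.
by lra.
Qed.

(** Without subgradients in the ball, any lower bound on their norms holds vacuously, and [u0] would
    decrease at rate [L + 1], faster than its Lipschitz constant allows. *)
Lemma subdiff_nonempty (u0 : V -> R) x (L r : R) : 0 <= L ->
  (forall y z, `|u0 y - u0 z| <= L * enorm (y - z)) -> 0 < r ->
  exists y p, enorm (y - x) <= r /\ subdiff u0 y p.
Proof.
move=> L0 lip r0; apply: contrapT => none.
have := @subdiff_bound_decrease u0 x L (L + 2) (L + 1) (r / 2) r L0 lip.
move=> /(_ _ _ _)/wrap[||| [y yr uy]].
- by move=> y p yr sub; exfalso; apply: none; exists y, p.
- by apply/andP; split; lra.
- by apply/andP; split; lra.
have := lip x y; rewrite enormB ler_norml => /andP[_ h].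
by have := ler_wpM2l L0 yr; lra.
Qed.

Lemma Rfun_ge0 (A2 B2 : R) x t : 0 <= B2 -> 0 <= t -> 0 <= Rfun A2 B2 x t.
Proof.
move=> B20 t0; rewrite /Rfun; case: ifPn => [A20|_]; last exact: mulr_ge0.
apply: mulr_ge0; first by rewrite addr_ge0 ?divr_ge0 ?enorm_ge0 ?(ltW A20).
by rewrite subr_ge0 -expR0 ler_expR mulr_ge0// ltW.
Qed.

(** The supremum is monotone in [d], so its right limit at 0 exists and is nearly attained at a
    small [d]. The set of norms is nonempty and bounded by [L], so [sup] is a true supremum. *)
Lemma Sbar_approx (u0 : V -> R) (A2 B2 L : R) x (t e : R) : 0 <= L ->
  (forall y z, `|u0 y - u0 z| <= L * enorm (y - z)) -> 0 <= Rfun A2 B2 x t ->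
  0 < e ->
  exists2 d, 0 < d & forall y p, enorm (y - x) <= Rfun A2 B2 x t + d ->
    subdiff u0 y p -> enorm p <= Sbar A2 B2 u0 x t + e.
Proof.
move=> L0 lip R0 e0; pose F d := sup (grad_norms A2 B2 u0 x t d).
have ub d : ubound (grad_norms A2 B2 u0 x t d) L.
  by move=> _ [y [p [_ [sub ->]]]]; exact: subdiff_le_lipschitz lip sub.
have ne d : 0 < d -> grad_norms A2 B2 u0 x t d !=set0.
  move=> d0; have [y [p [yd sub]]] := subdiff_nonempty u0 x L d L0 lip d0.
  exists (enorm p), y, p; split=> //; rewrite (le_trans yd)// lerDr//.
have sub_ d d' : d <= d' ->
    grad_norms A2 B2 u0 x t d `<=` grad_norms A2 B2 u0 x t d'.
  move=> dd' _ [y [p [yd [sub ->]]]]; exists y, p; split=> //.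
  by rewrite (le_trans yd)// lerD2l.
have cF : F d @[d --> 0^'+] --> inf (F @` [set` Interval (BRight 0) (BLeft (1 : R))]).
  apply: nondecreasing_at_right_cvgr.
  - by rewrite bnd_simp.
  - move=> d d'; rewrite !in_itv/= => /andP[d0 _] /andP[d'0 _] dd'.
    apply: sup_le; last by split; [exact: ne|exists L; exact: ub].
      by move=> r /(sub_ _ _ dd') h; exists r.
    exact: ne.
  - exists 0 => _ [d /= _ <-]; rewrite /F.
    have [h|/set0P[r rd]] := eqVneq (grad_norms A2 B2 u0 x t d) set0.
      by rewrite h sup0.
    apply: (@le_trans _ _ r); last by apply: ub_le_sup => //; exists L; exact: ub.
    by case: rd => [y [p [_ [_ ->]]]]; exact: enorm_ge0.
have SE : Sbar A2 B2 u0 x t = inf (F @` [set` Interval (BRight 0) (BLeft (1 : R))]).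
  exact: cvg_lim cF.
have near_e : \forall d \near 0^'+, F d < Sbar A2 B2 u0 x t + e.
  rewrite SE; move/cvgrPdist_lt : cF => /(_ _ e0); apply: filterS => d.
  by rewrite ltr_norml => /andP[h _]; lra.
have [d [hd d0]] := @filter_ex _ (0^'+ : set_system R) _ _
  (filterI near_e (nbhs_right_gt (0 : R))).
exists d => // y p yd sub; rewrite (le_trans _ (ltW hd))//.
apply: ub_le_sup; first by exists L; exact: ub.
by exists y, p.
Qed.

Lemma Ibar_approx (u0 : V -> R) (A2 B2 L : R) x (t e : R) : 0 <= L ->
  (forall y z, `|u0 y - u0 z| <= L * enorm (y - z)) -> 0 <= Rfun A2 B2 x t ->
  0 < e ->
  exists2 d, 0 < d & forall y p, enorm (y - x) <= Rfun A2 B2 x t + d ->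
    subdiff u0 y p -> Ibar A2 B2 u0 x t - e <= enorm p.
Proof.
move=> L0 lip R0 e0; pose F d := inf (grad_norms A2 B2 u0 x t d).
have lb d : lbound (grad_norms A2 B2 u0 x t d) 0.
  by move=> _ [y [p [_ [sub ->]]]]; exact: enorm_ge0.
have ne d : 0 < d -> grad_norms A2 B2 u0 x t d !=set0.
  move=> d0; have [y [p [yd sub]]] := subdiff_nonempty u0 x L d L0 lip d0.
  exists (enorm p), y, p; split=> //; rewrite (le_trans yd)// lerDr//.
have sub_ d d' : d <= d' ->
    grad_norms A2 B2 u0 x t d `<=` grad_norms A2 B2 u0 x t d'.
  move=> dd' _ [y [p [yd [sub ->]]]]; exists y, p; split=> //.
  by rewrite (le_trans yd)// lerD2l.
have cF : F d @[d --> 0^'+] --> sup (F @` [set` Interval (BRight 0) (BLeft (1 : R))]).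
  apply: nonincreasing_at_right_cvgr.
  - by rewrite bnd_simp.
  - move=> d d'; rewrite !in_itv/= => /andP[d0 _] /andP[d'0 _] dd'.
    apply: lb_le_inf; first exact: ne.
    move=> r /(sub_ _ _ dd'); apply: ge_inf; exists 0; exact: lb.
  - exists L => _ [d dI <-]; move: dI; rewrite /= in_itv/= => /andP[d0 _].
    rewrite /F.
    have [r rd] := ne d d0.
    apply: (@le_trans _ _ r); first by apply: ge_inf => //; exists 0; exact: lb.
    by case: rd => [y [p [_ [sub ->]]]]; exact: subdiff_le_lipschitz lip sub.
have SE : Ibar A2 B2 u0 x t = sup (F @` [set` Interval (BRight 0) (BLeft (1 : R))]).
  exact: cvg_lim cF.
have near_e : \forall d \near 0^'+, Ibar A2 B2 u0 x t - e < F d.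
  rewrite SE; move/cvgrPdist_lt : cF => /(_ _ e0); apply: filterS => d.
  by rewrite ltr_norml => /andP[_ h]; lra.
have [d [hd d0]] := @filter_ex _ (0^'+ : set_system R) _ _
  (filterI near_e (nbhs_right_gt (0 : R))).
exists d => // y p yd sub; rewrite (le_trans (ltW hd))//.
apply: ge_inf; first by exists 0; exact: lb.
by exists y, p.
Qed.

End InitialDatum.

(** * Gradient bounds *)

Section GradientBounds.
Context {R : realType} {n : nat}.
Local Notation V := 'rV[R]_n.
Implicit Types (u : V -> R -> R) (x y z p q : V).

Lemma cone_le (T T' A2 B2 K3 d : R) x0 rho rho' : T' <= T ->
  cone T A2 B2 K3 d x0 rho rho' -> cone T' A2 B2 K3 d x0 rho rho'.
Proof.
move=> TT [d0 c ge0 le0 df sp].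
by split=> // t /andP[h1 h2]; [apply: ge0|apply: le0|apply: df|apply: sp];
  rewrite h1 (lt_le_trans h2).
Qed.

Lemma subsolution_le (T T' : R) H u : T' <= T ->
  subsolution T H u -> subsolution T' H u.
Proof.
by move=> TT h x t p tau /andP[t0 tT]; apply: h; rewrite t0 (lt_le_trans tT).
Qed.

Lemma supersolution_le (T T' : R) H u : T' <= T ->
  supersolution T H u -> supersolution T' H u.
Proof.
by move=> TT h x t p tau /andP[t0 tT]; apply: h; rewrite t0 (lt_le_trans tT).
Qed.

Section Core.
Context (H : V -> R -> R -> V -> R) (C1 beta A2 B2 K3 T L : R) (u0 : V -> R)
  (u : V -> R -> R).
Hypotheses (hH : hamiltonian H C1 beta A2 B2 K3)
  (cu : continuous (fun z : V * R => u z.1 z.2))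
  (subu : subsolution T H u) (supu : supersolution T H u)
  (ini : forall x, u x 0 = u0 x) (L0 : 0 <= L)
  (lip : forall y z, `|u0 y - u0 z| <= L * enorm (y - z)).

(** Every point is the centre of some cone, and the propagated constant depends on [L] and the time
    only, not on the cone; this gives one bound for all slopes. *)
Lemma prox_bounded : exists L',
  (forall x t p tau, 0 < t < T -> prox_sup u x t p tau -> enorm p <= L') /\
  (forall x t p tau, 0 < t < T -> prox_sub u x t p tau -> enorm p <= L').
Proof.
case: (hH) => _ C10 beta0 _ A20 B20 _ K30 _ _.
have gr (x : V) (t : R) : 0 < t < T -> exists2 r, 0 < r &
    forall y z, enorm (y - x) < r -> enorm (z - x) < r ->
      u y t - u z t <= lip_growth C1 beta K3 L T * enorm (y - z).
  move=> tT; have [T1 [d [rho [rho' [/andP[tT1 T1T] hc rt _]]]]] :=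
    cone_exists A2 B2 K3 x t T 1 A20 B20 K30 tT ltr01.
  exists (rho t) => // y z /ltW yr /ltW zr; move: tT => /andP[t0 tT].
  have tT1' : 0 < t < T1 by rewrite t0.
  have := lipschitz_propagation H C1 beta A2 B2 K3 T1 t d L u x rho rho' hH hc cu
    (subsolution_le _ _ _ _ T1T subu) (supersolution_le _ _ _ _ T1T supu) L0.
  move=> /(_ _ tT1' y z yr zr)/wrap[|h].
    by move=> y' z' _ _; rewrite !ini (le_trans (ler_norm _)).
  rewrite (le_trans h)// ler_wpM2r ?enorm_ge0// lip_growth_le//.
  exact: ltW.
have G0 t : 0 < t < T -> 0 <= lip_growth C1 beta K3 L T.
  move=> /andP[t0 tT]; rewrite (le_trans L0)// lip_growth_ge//.
  by rewrite ltW// (lt_trans t0).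
exists (lip_growth C1 beta K3 L T); split=> x t p tau tT; have [r r0 hr] := gr x t tT;
  have xr : enorm (x - x) < r by rewrite subrr enorm0.
  apply: (prox_sup_le_lip u x t p tau _ r (G0 t tT) r0) => y yr.
  by rewrite enormB; exact: hr.
apply: (prox_sub_le_lip u x t p tau _ r (G0 t tT) r0) => y yr.
exact: hr.
Qed.

Context (x0 : V) (t0 : R) (p : V).
Hypotheses (t0T : 0 < t0 < T)
  (slope : forall e, 0 < e -> exists2 d, 0 < d & forall y, enorm (y - x0) < d ->
     u x0 t0 + dotv p (y - x0) - e * enorm (y - x0) <= u y t0).

Lemma gradient_upper_bound :
  enorm p <= lip_growth C1 beta K3 (Sbar A2 B2 u0 x0 t0) t0.
Proof.
case: (hH) => _ C10 beta0 _ A20 B20 _ K30 _ _.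
move: (t0T) => /andP[t00 t0T'].
apply/ler_addgt0Pr => e e0.
(* An error [e'] on the initial slope grows to exactly [e] at time [t0]. *)
pose e' := e / expR ((C1 + K3) * t0).
have e'0 : 0 < e' by rewrite divr_gt0 ?expR_gt0.
have R0 := Rfun_ge0 A2 B2 x0 t0 B20 (ltW t00).
have [d d0 hd] := Sbar_approx u0 A2 B2 L x0 t0 e' L0 lip R0 e'0.
pose M := Sbar A2 B2 u0 x0 t0 + e'.
have M0 : 0 <= M.
  have [y [q [yd sub]]] := subdiff_nonempty u0 x0 L d L0 lip d0.
  rewrite (le_trans (enorm_ge0 q))//; apply: hd sub.
  by rewrite (le_trans yd)// lerDr.
have -> : lip_growth C1 beta K3 (Sbar A2 B2 u0 x0 t0) t0 + e =
    lip_growth C1 beta K3 M t0.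
  have eE : e = e' * expR ((C1 + K3) * t0) by rewrite divfK// gt_eqF ?expR_gt0.
  by rewrite /lip_growth {1}eE /M; ring.
have d20 : 0 < d / 2 by rewrite divr_gt0.
have [T1 [d1 [rho [rho' [/andP[tT1 T1T] hc rt rR]]]]] :=
  cone_exists A2 B2 K3 x0 t0 T (d / 2) A20 B20 K30 t0T d20.
have d2 : rho 0 + d1 < Rfun A2 B2 x0 t0 + d.
  by rewrite (le_lt_trans rR)// ltrD2l; lra.
have u0lip := subdiff_bound_lipschitz u0 x0 M _ _
  (lipschitz_continuous _ _ lip) hd d2.
have tT1' : 0 < t0 < T1 by rewrite t00.
have := lipschitz_propagation H C1 beta A2 B2 K3 T1 t0 d1 M u x0 rho rho' hH hc cu
    (subsolution_le _ _ _ _ T1T subu) (supersolution_le _ _ _ _ T1T supu) M0.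
move=> /(_ _ tT1')/wrap[|ulip].
  by move=> x z xr zr; rewrite !ini; exact: u0lip.
apply: (enorm_le_slope x0).
  by rewrite (le_trans M0)// lip_growth_ge// ltW.
move=> e1 e10; have [d3 d30 hd3] := slope e1 e10.
exists (Num.min d3 (rho t0)); first by rewrite lt_min d30.
move=> y; rewrite lt_min => /andP[/hd3 y1 /ltW y2].
have := ulip y x0 y2; rewrite subrr enorm0 => /(_ (ltW rt)); lra.
Qed.

Lemma gradient_lower_bound :
  Ibar A2 B2 u0 x0 t0 * expR (- ((C1 + K3) * t0))
    - C1 * beta / (C1 + K3) * (1 - expR (- ((C1 + K3) * t0))) <= enorm p.
Proof.
case: (hH) => _ C10 beta0 _ A20 B20 _ K30 _ _.
move: (t0T) => /andP[t00 t0T'].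
set c := C1 * beta / (C1 + K3).
have c0 : 0 <= c by exact: coef_ge0.
set g := C1 + K3 in c c0 *.
have g0 : 0 <= g by exact: addr_ge0.
set G := expR (- (g * t0)).
have G0 : 0 < G by exact: expR_gt0.
have G1 : G <= 1 by rewrite -expR0 ler_expR oppr_le0 mulr_ge0// ltW.
apply/ler_addgt0Pr => e e0.
pose m := Ibar A2 B2 u0 x0 t0 - e.
pose low := (m + c) * G - c.
suff : low <= enorm p by have := ler_wpM2l (ltW e0) G1; rewrite /low /m; lra.
(* A nonpositive bound is trivial. Positivity of [low] gives [m > 0] and [psi t0 > 0], as the
   propagation requires. *)
have [low0|low0] := leP low 0; first exact: le_trans low0 (enorm_ge0 _).
have m0 : 0 < m.
  have h : 0 < m * G by have := ler_wpM2l c0 G1; move: low0; rewrite /low; lra.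
  by move: h; rewrite pmulr_lgt0.
apply/ler_addgt0Pr => e1 e10; have [d3 d30 hd3] := slope e1 e10.
have R0 := Rfun_ge0 A2 B2 x0 t0 B20 (ltW t00).
have e20 : 0 < e / 2 by rewrite divr_gt0.
have [d d0 hd] := Ibar_approx u0 A2 B2 L x0 t0 (e / 2) L0 lip R0 e20.
have d20 : 0 < d / 2 by rewrite divr_gt0.
have [T1 [d1 [rho [rho' [/andP[tT1 T1T] hc rt rR]]]]] :=
  cone_exists A2 B2 K3 x0 t0 T (d / 2) A20 B20 K30 t0T d20.
(* The propagation needs [psi >= 0] on an open interval reaching beyond [t0]. As
   [exp(- g h) >= 1 - g h], it stays nonnegative up to [t0 + h]; the [+ 1] covers [g = 0]. *)
pose h := low / ((m + c) * G * g + 1).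
have mcG : 0 <= (m + c) * G by rewrite mulr_ge0 ?ltW// ltr_pwDl.
have den : 0 < (m + c) * G * g + 1 by rewrite ltr_wpDl// mulr_ge0.
have h0 : 0 < h by rewrite divr_gt0.
have hh : h * ((m + c) * G * g + 1) = low by rewrite divfK// gt_eqF.
pose T2 := Num.min T1 (t0 + h).
have tT2 : 0 < t0 < T2 by rewrite t00 lt_min tT1 ltrDl.
have T21 : T2 <= T1 by rewrite /T2 ge_min lexx.
have T2T : T2 <= T by exact: le_trans T21 T1T.
have decayE (r t : R) : decay C1 beta K3 r m t =
    r * expR (C1 * t) * ((m + c) * expR (- (g * t)) - c).
  have -> : - (g * t) = - K3 * t - C1 * t by rewrite /g; ring.
  rewrite /decay -/g -/c expRD expRN; field.
  by rewrite gt_eqF ?expR_gt0.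
pose P := expR (C1 * t0); have P0 : 0 < P by exact: expR_gt0.
(* Balls of radius slightly above [r0] about the cone base must stay where subgradients are bounded
   below, and the ball of radius [r0 P] about [x0] must stay where [slope] applies. *)
pose r0 := Num.min (d / 4) (d3 / (2 * P)).
have r00 : 0 < r0 by rewrite lt_min !divr_gt0// mulr_gt0.
have r0d : r0 < d / 2.
  by rewrite (@le_lt_trans _ _ (d / 4))//; [rewrite /r0 ge_min lexx|lra].
have r0P : r0 * P < d3.
  have : r0 * (2 * P) <= d3 by rewrite -ler_pdivlMr ?mulr_gt0// /r0 ge_min lexx orbT.
  by have := mulr_gt0 r00 P0; lra.
have [L' [lsup lsub]] := prox_bounded.
have := decrease_propagation H C1 beta A2 B2 K3 T2 t0 d1 L' L r0 m u x0 rho rho'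
  hH (cone_le _ _ _ _ _ _ _ _ _ T21 hc) cu
  (subsolution_le _ _ _ _ T2T subu) (supersolution_le _ _ _ _ T2T supu).
move=> /(_ _ _ _ r00 _ _ tT2)/wrap[|||||[y yr uy]].
- move=> x t q tau /andP[t_gt0 tT]; apply: lsup.
  by rewrite t_gt0 (lt_le_trans tT).
- move=> x t q tau /andP[t_gt0 tT]; apply: lsub.
  by rewrite t_gt0 (lt_le_trans tT).
- by move=> x z; rewrite !ini (le_trans (ler_norm _)).
- move=> t /andP[t_gt0]; rewrite lt_min => /andP[_ tth].
  rewrite decayE; apply: mulr_ge0; first by rewrite mulr_ge0 ?expR_ge0// ltW.
  have -> : - (g * t) = - (g * t0) + g * (t0 - t) by ring.
  rewrite expRD -/G.
  have h1 := expR_ge1Dx (g * (t0 - t)).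
  have h2 : 0 <= g * (t0 + h - t) by rewrite mulr_ge0//; lra.
  have h3 : 1 - g * h <= expR (g * (t0 - t)) by lra.
  by have := ler_wpM2l mcG h3; move: hh; rewrite /low; lra.
- move=> x xr; rewrite !ini.
  have md : m < Ibar A2 B2 u0 x0 t0 - e / 2 by rewrite /m; lra.
  have [y yx uy] := subdiff_bound_decrease u0 x L (Ibar A2 B2 u0 x0 t0 - e / 2)
    m r0 (d / 2) L0 lip
    ltac:(move=> y q yx; apply: hd; rewrite (le_trans (enorm_triangle x _ _))//; lra)
    ltac:(by rewrite r00) ltac:(by rewrite m0).
  by exists y => //; rewrite ini.
have yd : enorm (y - x0) < d3 by exact: le_lt_trans yr r0P.
have := hd3 y yd; have := dotv_ge p (y - x0).
rewrite decayE -/P -/G -/low in uy.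
have pe : 0 <= enorm p + e1 by rewrite addr_ge0 ?enorm_ge0// ltW.
have := ler_wpM2l pe yr; rewrite -/P => k1 k2 k3.
have : r0 * P * low <= r0 * P * (enorm p + e1) by lra.
by rewrite ler_pM2l// mulr_gt0.
Qed.

End Core.
End GradientBounds.

(** * From viscosity solutions to data continuous at all times *)

Section Transfer.
Context {R : realType} {n : nat}.
Local Notation V := 'rV[R]_n.

Lemma isC1_st_quad (T k : R) (x p : V) (t tau : R) :
  isC1_st T (fun y s => dotv p (y - x) + tau * (s - t)
                        + k * (enorm (y - x) ^+ 2 + (s - t) ^+ 2))
    (fun y _ => p + (2 * k) *: (y - x)) (fun _ s => tau + 2 * k * (s - t)).
Proof.
have K0 : 0 < 2 * `|k| + 1 by rewrite ltr_wpDl// mulr_ge0.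
split=> y s _ e e0; exists (e / (2 * `|k| + 1)); rewrite ?divr_gt0// => z r _;
  rewrite !ltr_pdivlMr// => zy rs.
  rewrite dotvDl dotvZl.
  have -> : dotv p (z - x) = dotv p (y - x) + dotv p (z - y).
    by rewrite -dotvDr [y - x + _]addrC addrA subrK.
  rewrite [X in `|X|](_ : _ = k * (enorm (z - y) ^+ 2 + (r - s) ^+ 2)).
    rewrite normrM [`|_ + _|]ger0_norm ?addr_ge0 ?sqr_ge0//.
    rewrite -[(r - s) ^+ 2]real_normK ?num_real//.
    have := enorm_ge0 (z - y); have := normr_ge0 k; have := normr_ge0 (r - s).
    move: zy rs; set N := enorm _; set S := `|r - s|; set q := `|k|.
    move=> h1 h2 S0 q0 N0.
    have h3 : q * N ^+ 2 <= e * N by nra.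
    have h4 : q * S ^+ 2 <= e * S by nra.
    by lra.
  by have := quad_increment k x y z; lra.
split.
  have -> : p + 2 * k *: (z - x) - (p + 2 * k *: (y - x)) = (2 * k) *: (z - y).
    by apply/rowP => i; rewrite !mxE; ring.
  by rewrite enormZ normrM ger0_norm//; have := enorm_ge0 (z - y); lra.
have -> : tau + 2 * k * (r - t) - (tau + 2 * k * (s - t)) = 2 * k * (r - s).
  by ring.
by rewrite !normrM ger0_norm//; have := normr_ge0 (r - s); lra.
Qed.

Lemma viscosity_subsolution (T : R) H (u0 : V -> R) (u : V -> R -> R) :
  viscosity_solution T H u0 u -> subsolution T H u.
Proof.
move=> [_ [_ vs]] x t p tau tT [k [r [k0 r0 h]]].
have := (vs _ _ _ (isC1_st_quad T k x p t tau) x t tT).1.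
rewrite !subrr scaler0 mulr0 !addr0; apply.
exists r => // y s _ y1 s1; rewrite !subrr enorm0 dotv0r !mulr0 expr0n /=.
by have := h y s y1 s1; lra.
Qed.

Lemma viscosity_supersolution (T : R) H (u0 : V -> R) (u : V -> R -> R) :
  viscosity_solution T H u0 u -> supersolution T H u.
Proof.
move=> [_ [_ vs]] x t p tau tT [k [r [k0 r0 h]]].
have := (vs _ _ _ (isC1_st_quad T (- k) x p t tau) x t tT).2.
rewrite !subrr scaler0 mulr0 !addr0; apply.
exists r => // y s _ y1 s1; rewrite !subrr enorm0 dotv0r !mulr0 expr0n /=.
by have := h y s y1 s1; lra.
Qed.

(** For [a >= 0], the projection of the time axis onto [[0, a]]; composing with it freezes a
    function outside the interval. *)
Definition clamp (a t : R) := Num.max 0 (Num.min t a).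

Lemma clamp_id a t : 0 <= t <= a -> clamp a t = t.
Proof. by move=> /andP[t0 ta]; rewrite /clamp min_l// max_r. Qed.

Lemma clamp_in a t : 0 <= a -> 0 <= clamp a t <= a.
Proof.
by move=> a0; rewrite /clamp le_max lexx ge_max a0 ge_min lexx orbT.
Qed.

Lemma clamp_lip a s t : `|clamp a s - clamp a t| <= `|s - t|.
Proof.
rewrite /clamp ler_norml; have := ler_norm (s - t); have := ler_norm (t - s).
rewrite (distrC t s) => h1 h2; have h3 := normr_ge0 (s - t).
by case: (leP s a) => ?; case: (leP t a) => ?; case: (leP 0 s) => ?;
  case: (leP 0 t) => ?; case: (leP 0 a) => ?; apply/andP; split; lra.
Qed.

Lemma near_prod_dist (x : V) (t d : R) : 0 < d ->
  \forall z \near (x, t), enorm (z.1 - x) < d /\ `|z.2 - t| < d.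
Proof.
move=> d0; exists ([set y | enorm (y - x) < d], [set s | `|s - t| < d]).
  split=> /=; first exact: near_eball.
  by apply/nbhs_ballP; exists d => // s; rewrite -ball_normE /= distrC.
by move=> [y s].
Qed.

Lemma clamp_continuous (T a : R) (u : V -> R -> R) : cont_st T u -> 0 <= a < T ->
  continuous (fun z : V * R => u z.1 (clamp a z.2)).
Proof.
move=> cu /andP[a0 aT]; apply: (@continuous_near R (V * R)%type) => -[x t] e e0.
have inT s : 0 <= clamp a s < T.
  by have /andP[h1 h2] := clamp_in a s a0; rewrite h1 (le_lt_trans h2).
have [d d0 hd] := cu x (clamp a t) (inT t) e e0.
have := near_prod_dist x t d d0; apply: filterS => -[y s] /= [y1 s1].
by rewrite distrC; apply: hd => //; exact: le_lt_trans (clamp_lip _ _ _) s1.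
Qed.

Lemma clamp_hamiltonian (T : R) (H : V -> R -> R -> V -> R) :
  0 <= T -> cont_H T H ->
  continuous (fun z : V * R * (R * V) => H z.1.1 (clamp T z.1.2) z.2.1 z.2.2).
Proof.
move=> T0 cH; apply: (@continuous_near R (V * R * (R * V))%type).
move=> [[x t] [r p]] e e0.
have [d d0 hd] := cH x (clamp T t) r p (clamp_in T t T0) e e0.
exists ([set z : V * R | enorm (z.1 - x) < d /\ `|z.2 - t| < d],
  [set z : R * V | `|z.1 - r| < d /\ enorm (z.2 - p) < d]).
  split=> /=; first exact: near_prod_dist.
  exists ([set s | `|s - r| < d], [set q | enorm (q - p) < d]).
    split=> /=; last exact: near_eball.
    by apply/nbhs_ballP; exists d => // s; rewrite -ball_normE /= distrC.
  by move=> [s q].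
move=> [[y s] [v q]] /= [[y1 s1] [v1 q1]]; rewrite distrC.
apply: hd => //; first exact: clamp_in.
exact: le_lt_trans (clamp_lip _ _ _) s1.
Qed.

Lemma clamp_near (a t : R) : 0 < t < a -> exists2 r, 0 < r &
  forall s, `|s - t| < r -> clamp a s = s.
Proof.
move=> /andP[t0 ta]; exists (Num.min t (a - t)); first by rewrite lt_min t0 subr_gt0.
move=> s; rewrite lt_min !ltr_norml => /andP[/andP[h1 _] /andP[_ h2]].
by apply: clamp_id; apply/andP; split; lra.
Qed.

(** Two clamps occur: [u] is frozen after [a < T], since its continuity is known only on [[0, T)],
    and [H] after [T]. Near a time in [(0, a)] neither has any effect. *)
Lemma clamp_subsolution (T a : R) (H : V -> R -> R -> V -> R) (u : V -> R -> R) :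
  a < T -> subsolution T H u ->
  subsolution a (fun x t => H x (clamp T t)) (fun x t => u x (clamp a t)).
Proof.
move=> aT subu x t p tau tin sup; move: (tin) => /andP[t0 ta].
have [r r0 hr] := clamp_near a t tin.
rewrite !clamp_id ?(ltW t0) ?(ltW ta) ?(ltW (lt_trans ta aT))//.
apply: subu; first by rewrite t0 (lt_trans ta).
apply: prox_sup_dom r0 _ sup => y s _ sr /=.
by rewrite hr// clamp_id ?(ltW t0) ?(ltW ta).
Qed.

Lemma clamp_supersolution (T a : R) (H : V -> R -> R -> V -> R) (u : V -> R -> R) :
  a < T -> supersolution T H u ->
  supersolution a (fun x t => H x (clamp T t)) (fun x t => u x (clamp a t)).
Proof.
move=> aT supu x t p tau tin [k [r' [k0 r'0 h]]]; move: (tin) => /andP[t0 ta].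
have [r r0 hr] := clamp_near a t tin.
have ct : clamp a t = t by rewrite clamp_id// (ltW t0) (ltW ta).
rewrite ct clamp_id ?(ltW t0) ?(ltW (lt_trans ta aT))//.
apply: supu; first by rewrite t0 (lt_trans ta).
exists k, (Num.min r r'); split; [by []|by rewrite lt_min r0|].
move=> y s; rewrite !lt_min => /andP[_ y2] /andP[s1 s2].
by have := h y s y2 s2; rewrite ct hr.
Qed.

Lemma subdiff_x_slope (T : R) (u : V -> R -> R) x t p : 0 < t < T ->
  subdiff_x T u x t p -> forall e, 0 < e -> exists2 d, 0 < d &
  forall y, enorm (y - x) < d ->
     u x t + dotv p (y - x) - e * enorm (y - x) <= u y t.
Proof.
move=> tT [Dt [Dx [phi [[c1 _] [[r r0 hmin] <-]]]]] e e0.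
have [d d0 hd] := c1 x t tT e e0.
exists (Num.min r d); first by rewrite lt_min r0.
move=> y; rewrite lt_min => /andP[y1 y2].
have tt d' : 0 < d' -> `|t - t| < d' by rewrite subrr normr0.
have := hmin y t tT y1 (tt _ r0); have := hd y t tT y2 (tt _ d0).
by rewrite subrr normr0 mulr0 subr0 addr0 ler_norml => /andP[? _]; lra.
Qed.

End Transfer.

Theorem theorem1p4 (R : realType) (n : nat) (T : R)
  (H : 'rV[R]_n -> R -> R -> 'rV[R]_n -> R) (u0 : 'rV[R]_n -> R)
  (u : 'rV[R]_n -> R -> R) (C1 beta A2 B2 K3 : R) :
  (0 < n)%N -> 0 < T ->
  cont_H T H -> lipschitz_vec u0 ->
  (* (H1) *)
  0 <= C1 -> (beta = 0 \/ beta = 1) ->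
  (forall x y t r p, 0 <= t <= T ->
     `|H x t r p - H y t r p| <= C1 * (beta + enorm p) * enorm (x - y)) ->
  (* (H2) *)
  0 <= A2 -> 0 <= B2 ->
  (forall x t r p q, 0 <= t <= T ->
     `|H x t r p - H x t r q| <= (A2 * enorm x + B2) * enorm (p - q)) ->
  (* (H3) *)
  0 <= K3 ->
  (forall x t r v p, 0 <= t <= T ->
     `|H x t r p - H x t v p| <= K3 * `|r - v|) ->
  (* (H4) *)
  (forall x t r p q (l : R), 0 <= t <= T -> 0 <= l <= 1 ->
     H x t r ((1 - l) *: p + l *: q) <= (1 - l) * H x t r p + l * H x t r q) ->
  viscosity_solution T H u0 u ->
  (~ (C1 = 0 /\ K3 = 0) ->
    forall x t p, 0 < t < T -> subdiff_x T u x t p ->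
      Ibar A2 B2 u0 x t * expR (- ((C1 + K3) * t))
        - C1 * beta / (C1 + K3) * (1 - expR (- ((C1 + K3) * t))) <= enorm p /\
      enorm p <= Sbar A2 B2 u0 x t * expR ((C1 + K3) * t)
        + C1 * beta / (C1 + K3) * (expR ((C1 + K3) * t) - 1)) /\
  (C1 = 0 /\ K3 = 0 ->
    forall x t p, 0 < t < T -> subdiff_x T u x t p ->
      Ibar A2 B2 u0 x t <= enorm p /\ enorm p <= Sbar A2 B2 u0 x t).
Proof.
move=> _ T0 cH [L1 lip1] C10 beta01 h1 A20 B20 h2 K30 h3 h4 vs.
have L0 : 0 <= `|L1| by [].
have lip y z : `|u0 y - u0 z| <= `|L1| * enorm (y - z).
  by rewrite (le_trans (lip1 y z))// ler_wpM2r ?enorm_ge0// ler_norm.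
have beta0 : 0 <= beta by case: beta01 => ->.
have hH : hamiltonian (fun x t => H x (clamp T t)) C1 beta A2 B2 K3.
  have cT t := clamp_in T t (ltW T0).
  split=> //.
  - exact: clamp_hamiltonian (ltW T0) cH.
  - by move=> *; exact: h1.
  - by move=> *; exact: h2.
  - by move=> *; exact: h3.
  - by move=> *; exact: h4.
have bounds x t p : 0 < t < T -> subdiff_x T u x t p ->
    Ibar A2 B2 u0 x t * expR (- ((C1 + K3) * t))
        - C1 * beta / (C1 + K3) * (1 - expR (- ((C1 + K3) * t))) <= enorm p /\
    enorm p <= Sbar A2 B2 u0 x t * expR ((C1 + K3) * t)
        + C1 * beta / (C1 + K3) * (expR ((C1 + K3) * t) - 1).
  move=> tT hp; move: (tT) => /andP[t0 tT'].
  (* Any time strictly between [t] and [T] would do. *)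
  pose a := (t + T) / 2.
  have aT : a < T by rewrite /a; lra.
  have ta : 0 < t < a by rewrite t0 /a; lra.
  have a0 : 0 <= a by rewrite /a; lra.
  have cu : continuous (fun z : 'rV[R]_n * R => u z.1 (clamp a z.2)).
    by apply: (clamp_continuous T); [case: vs|rewrite a0].
  have subu := clamp_subsolution T a H u aT (viscosity_subsolution _ _ _ _ vs).
  have supu := clamp_supersolution T a H u aT (viscosity_supersolution _ _ _ _ vs).
  have ini x' : u x' (clamp a 0) = u0 x'.
    by rewrite clamp_id ?lexx//; case: vs => _ [].
  have ct : clamp a t = t by rewrite clamp_id// (ltW t0); case/andP: ta => _ /ltW.
  have slope e : 0 < e -> exists2 d, 0 < d & forall y, enorm (y - x) < d ->
      u x (clamp a t) + dotv p (y - x) - e * enorm (y - x) <= u y (clamp a t).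
    by rewrite ct; exact: subdiff_x_slope tT hp e.
  split.
    exact: (gradient_lower_bound _ _ _ _ _ _ a _ _ (fun x t => u x (clamp a t))
      hH cu subu supu ini L0 lip x t p ta slope).
  have := gradient_upper_bound _ _ _ _ _ _ a _ _ (fun x t => u x (clamp a t))
      hH cu subu supu ini L0 lip x t p ta slope.
  by rewrite /lip_growth; lra.
(* For [C1 = K3 = 0] the coefficient [C1 beta / (C1 + K3)] evaluates to 0 and the exponentials to 1,
   so the same formula gives the second case. *)
split=> [_|[C1_0 K3_0]] x t p tT hp; first exact: bounds.
have := bounds x t p tT hp.
by rewrite C1_0 K3_0 addr0 !mul0r oppr0 expR0 !mulr1 !addr0.
Qed.
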